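(* Let $K$ be a number field of degree $m$ over $\mathbb{Q}$ and let $n\ge2$. Then $$\gamma^p(n,K)\le\gamma^T(n,K)^m,$$ and equality holds if $K$ has class number one.
   Context: Let $K$ have $r$ real and $s$ pairs of complex embeddings, $m=r+2s$, with embeddings $\sigma_1,\dots,\sigma_r$ real and $\sigma_{r+j}=\overline{\sigma_{r+s+j}}$ complex ($1\le j\le s$); $h_K$ is the class number of $K$. An $n$-dimensional Humbert form over $K$ is a tuple $S=(S_1,\dots,S_{r+s})$ with $S_1,\dots,S_r$ positive definite real symmetric $n\times n$ matrices and $S_{r+1},\dots,S_{r+s}$ positive definite hermitian $n\times n$ matrices; $\mathcal P_{K,n}$ is the set of these. With $S_i[y]=y^*S_iy$, set, for $x\in\mathcal{O}_K^n$, $S[x]=\prod_{i=1}^rS_i[x^{\sigma_i}]\cdot\bigl(\prod_{i=r+1}^{r+s}S_i[x^{\sigma_i}]\bigr)^2$ and $\det(S)=\prod_{i=1}^r\det S_i\cdot\bigl(\prod_{i=r+1}^{r+s}\det S_i\bigr)^2$. For $x\ne0$, $\langle x\rangle$ is the ideal generated by the coordinates of $x$ and $N_K$ is the ideal norm. The projective Hermite-Humbert constant is $$\gamma^p(n,K)=\sup_{S\in\mathcal P_{K,n}}\ \min_{x\in\mathcal{O}_K^n\setminus\{0\}}\frac{S[x]}{N_K(\langle x\rangle)^2\det(S)^{1/n}}.$$ For a place $v$ of $K$, $K_v$ is the completion and $|\cdot|_v$ the absolute value normalized so that $\mu(\alpha C)=|\alpha|_v\mu(C)$ for a Haar measure $\mu$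 on $K_v$ (so for complex $v$ it is the square of the usual modulus). For $x\in K_v^n$, the local height is $H_v(x)=(\sum_i|x_i|_v^2)^{1/(2m)}$ if $v$ is real, $H_v(x)=(\sum_i|x_i|_v)^{1/m}$ if $v$ is complex, and $H_v(x)=(\max_i|x_i|_v)^{1/m}$ if $v$ is finite. Let $\mathbb{A}$ be the adele ring of $K$ and $|\cdot|_{\mathbb A}=\prod_v|\cdot|_v$. For $g\in\mathrm{GL}_n(\mathbb{A})$ and $x\in K^n$ put $H_g(x)=\prod_vH_v(g_vx)$. Let $\mathrm{GL}_n(K_\infty)=\prod_{v\mid\infty}\mathrm{GL}_n(K_v)$, regarded as a subgroup of $\mathrm{GL}_n(\mathbb{A})$, and $\mathrm{GL}_n(\mathbb{A}_\infty)=\mathrm{GL}_n(K_\infty)\prod_{v\nmid\infty}\mathrm{GL}_n(\mathcal{O}_{K_v})$. There is a double coset decomposition $\mathrm{GL}_n(\mathbb{A})=\bigcup_{i=1}^{h_K}\mathrm{GL}_n(\mathbb{A}_\infty)\lambda_i\mathrm{GL}_n(K)$ (disjoint), with $\lambda_1\in\mathrm{GL}_n(\mathbb{A}_\infty)$. Thunder's constant is $$\gamma^T(n,K)=\max_{1\le i\le h_K}\ \max_{g\in\mathrm{GL}_n(K_\infty)}\ \min_{x\in K^n\setminus\{0\}}\frac{H_{g\lambda_i}(x)^2}{|\det g\lambda_i|_{\mathbb A}^{2/(nm)}}.$$ *)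

(* Defs.v *)
From HB Require Import structures.
From mathcomp Require Import all_boot all_order all_algebra all_field.
From mathcomp Require Import ring_quotient finmap ring.
From mathcomp Require Import all_classical all_reals all_analysis.
From mathcomp Require Import complex.

Set Implicit Arguments.
Unset Strict Implicit.
Unset Printing Implicit Defensive.

Import Order.TTheory GRing.Theory Num.Theory.
Import numFieldNormedType.Exports.

Local Open Scope quotient_scope.
Local Open Scope classical_set_scope.
Local Open Scope ring_scope.

Record absval (R : realType) (K : fieldType) := AbsVal {
  absval_fun :> K -> R;
  absval_ge0 : forall x, 0 <= absval_fun x;
  absval_eq0 : forall x, (absval_fun x == 0) = (x == 0);
  absvalM : forall x y, absval_fun (x * y) = absval_fun x * absval_fun y;
  absvalD : forall x y, absval_fun (x + y) <= absval_fun x + absval_fun y }.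

Section AbsValTheory.
Variables (R : realType) (K : fieldType) (v : absval R K).

Lemma absval0 : v 0 = 0.
Proof. by apply/eqP; rewrite absval_eq0. Qed.

Lemma absval1 : v 1 = 1.
Proof.
have v1 : v 1 != 0 by rewrite absval_eq0 oner_eq0.
by apply: (mulfI v1); rewrite -absvalM !mulr1.
Qed.

Lemma absvalN x : v (- x) = v x.
Proof.
suff vN1 : v (-1) = 1 by rewrite -mulN1r absvalM vN1 mul1r.
have : v (-1) ^+ 2 = 1 by rewrite expr2 -absvalM mulrNN mulr1 absval1.
by move/eqP; rewrite sqrp_eq1 ?absval_ge0// => /eqP.
Qed.

Lemma absvalB x y : v (x - y) = v (y - x).
Proof. by rewrite -opprB absvalN. Qed.

Lemma absvalV x : v x^-1 = (v x)^-1.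
Proof.
have [->|x0] := eqVneq x 0; first by rewrite invr0 absval0 invr0.
have vx0 : v x != 0 by rewrite absval_eq0.
by apply: (mulfI vx0); rewrite -absvalM !divff// absval1.
Qed.

End AbsValTheory.

Section QuotientLemmas.
Variables (A : comNzRingType) (I : idealr A).

Lemma quot_eq0 (x : A) : x \in (I : pred A) -> \pi_({ideal_quot I}) x = 0.
Proof.
move=> xI; have -> : 0 = \pi_({ideal_quot I}) 0 by rewrite piE.
by apply/eqP; rewrite -Quotient.idealrBE subr0.
Qed.

Lemma quot_mul1 (x y : A) : x * y - 1 \in (I : pred A) ->
  \pi_({ideal_quot I}) x * \pi_({ideal_quot I}) y = 1.
Proof.
move=> xyI.
rewrite [LHS](_ : _ = \pi_({ideal_quot I}) (x * y)); last by rewrite piE.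
have -> : 1 = \pi_({ideal_quot I}) 1 by rewrite piE.
by apply/eqP; rewrite -Quotient.idealrBE.
Qed.

End QuotientLemmas.

Section Completion.
Variables (R : realType) (K : fieldType) (v : absval R K).
Implicit Types x y : nat -> K.

Definition cauchy_for x :=
  forall e : R, 0 < e -> exists N, forall i j, (N <= i)%N -> (N <= j)%N ->
    v (x i - x j) < e.

Definition null_for x :=
  forall e : R, 0 < e -> exists N, forall i, (N <= i)%N -> v (x i) < e.

Lemma cauchy_for_cst a : cauchy_for (fun=> a).
Proof. by move=> e e0; exists 0%N => i j _ _; rewrite subrr absval0. Qed.

Lemma cauchy_forB x y : cauchy_for x -> cauchy_for y -> cauchy_for (x - y).
Proof.
move=> cx cy e e0; have e2 : 0 < e / 2 by rewrite divr_gt0.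
have [N hN] := cx _ e2; have [M hM] := cy _ e2.
exists (maxn N M) => i j; rewrite !geq_max => /andP[Ni Mi] /andP[Nj Mj].
have -> : (x - y) i - (x - y) j = (x i - x j) - (y i - y j).
  by rewrite -[(x - y) i]/(x i - y i) -[(x - y) j]/(x j - y j); ring.
rewrite (le_lt_trans (absvalD _ _ _))// absvalN (splitr e).
by rewrite ltrD ?hN ?hM.
Qed.

Lemma cauchy_for_bounded x : cauchy_for x ->
  exists2 M : R, 0 < M & forall i, v (x i) <= M.
Proof.
move=> cx; have [N hN] := cx 1 ltr01.
have S0 k : 0 <= \sum_(i < k) v (x i) by apply: sumr_ge0 => i _; exact: absval_ge0.
exists (1 + v (x N) + \sum_(i < N) v (x i)).
  by apply: ltr_wpDr => //; apply: ltr_wpDr => //; exact: absval_ge0.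
move=> i; have [iN|Ni] := ltnP i N.
  rewrite (bigD1 (Ordinal iN))//= addrCA lerDl !addr_ge0 ?absval_ge0//.
  by apply: sumr_ge0 => j _; exact: absval_ge0.
rewrite -[x i](subrK (x N)) (le_trans (absvalD _ _ _))//.
by rewrite -[leLHS]addr0 lerD// lerD// ltW// hN.
Qed.

Lemma cauchy_forM x y : cauchy_for x -> cauchy_for y -> cauchy_for (x * y).
Proof.
move=> cx cy e e0.
have [A A0 hA] := cauchy_for_bounded cx; have [B B0 hB] := cauchy_for_bounded cy.
have eA : 0 < e / 2 / A by rewrite !divr_gt0.
have eB : 0 < e / 2 / B by rewrite !divr_gt0.
have [N hN] := cx _ eB; have [M hM] := cy _ eA.
exists (maxn N M) => i j; rewrite !geq_max => /andP[Ni Mi] /andP[Nj Mj].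
have -> : (x * y) i - (x * y) j = x i * (y i - y j) + (x i - x j) * y j.
  by rewrite -[(x * y) i]/(x i * y i) -[(x * y) j]/(x j * y j); ring.
rewrite (le_lt_trans (absvalD _ _ _))// !absvalM (splitr e) ltrD//.
  rewrite (@le_lt_trans _ _ (A * v (y i - y j))) ?ler_wpM2r ?absval_ge0//.
  by rewrite mulrC -ltr_pdivlMr// hM.
rewrite (@le_lt_trans _ _ (v (x i - x j) * B)) ?ler_wpM2l ?absval_ge0//.
by rewrite -ltr_pdivlMr// hN.
Qed.

Definition cauchy_pred : {pred nat -> K} := fun x => `[< cauchy_for x >].

Fact cauchy_subring : subring_closed cauchy_pred.
Proof.
split; first exact/asboolP/cauchy_for_cst.
- by move=> x y /asboolP cx /asboolP cy; exact/asboolP/cauchy_forB.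
- by move=> x y /asboolP cx /asboolP cy; exact/asboolP/cauchy_forM.
Qed.

HB.instance Definition _ :=
  GRing.isSubringClosed.Build (nat -> K) cauchy_pred cauchy_subring.

Record cauchy_seq := CauchySeq { cseq : nat -> K; _ : cseq \in cauchy_pred }.

HB.instance Definition _ := [isSub for cseq].
HB.instance Definition _ := [Choice of cauchy_seq by <:].
HB.instance Definition _ := [SubChoice_isSubComNzRing of cauchy_seq by <:].

Lemma cauchy_seqP (x : cauchy_seq) : cauchy_for (cseq x).
Proof. by case: x => x /= /asboolP. Qed.

Definition null_ideal : {pred cauchy_seq} := 
  fun x : cauchy_seq => `[< null_for (cseq x) >].

Fact null_ideal_closed : idealr_closed null_ideal.
Proof.
split.
- apply/asboolP => e e0; exists 0%N => i _.
  by rewrite (_ : cseq 0 i = 0)// absval0.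
- apply/negP => /asboolP /(_ 1 ltr01)[N /(_ N (leqnn N))].
  by rewrite (_ : cseq 1 N = 1)// absval1 ltxx.
- move=> a x y /asboolP nx /asboolP ny; apply/asboolP => e e0.
  have [A A0 hA] := cauchy_for_bounded (cauchy_seqP a).
  have e2 : 0 < e / 2 by rewrite divr_gt0.
  have eA : 0 < e / 2 / A by rewrite divr_gt0.
  have [N hN] := nx _ eA; have [M hM] := ny _ e2.
  exists (maxn N M) => i; rewrite geq_max => /andP[Ni Mi].
  rewrite (_ : cseq (a * x + y) i = cseq a i * cseq x i + cseq y i)//.
  rewrite (le_lt_trans (absvalD _ _ _))// (splitr e) ltrD ?hM// absvalM.
  rewrite (@le_lt_trans _ _ (A * v (cseq x i))) ?ler_wpM2r ?absval_ge0 ?hA//.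
  by rewrite mulrC -ltr_pdivlMr// hN.
Qed.

HB.instance Definition _ :=
  isIdealr.Build cauchy_seq null_ideal null_ideal_closed.

Definition completion := {ideal_quot null_ideal}.

HB.instance Definition _ := GRing.ComNzRing.on completion.

Lemma cauchy_for_inv x : cauchy_for x -> ~ null_for x ->
  cauchy_for (fun i => (x i)^-1) /\ exists N, forall i, (N <= i)%N -> x i != 0.
Proof.
move=> cx /existsNP[e /not_implyP[e0 /forallNP nx]].
have e2 : 0 < e / 2 by rewrite divr_gt0.
have [N hN] := cx _ e2.
have [i0 [Ni0 vi0]] : exists i0, (N <= i0)%N /\ e <= v (x i0).
  have /existsNP[i0 /not_implyP[Ni0 /negP]] := nx N.
  by rewrite -leNgt => ?; exists i0.
have low i : (N <= i)%N -> e / 2 <= v (x i).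
  move=> Ni; rewrite -(lerD2r (e / 2)) -splitr (le_trans vi0)//.
  rewrite -[x i0](subrK (x i)) (le_trans (absvalD _ _ _))// addrC lerD2l ltW//.
  exact: hN.
have xn0 i : (N <= i)%N -> x i != 0.
  by move=> /low h; rewrite -(absval_eq0 v) gt_eqF// (lt_le_trans e2).
split; last by exists N.
move: (e / 2) e2 low => c c0 low.
move=> d d0; have dd : 0 < d * c * c by rewrite !mulr_gt0.
have [M hM] := cx _ dd.
exists (maxn N M) => i j; rewrite !geq_max => /andP[Ni Mi] /andP[Nj Mj].
have -> : (x i)^-1 - (x j)^-1 = (x j - x i) * (x j)^-1 * (x i)^-1.
  by field; rewrite !xn0.
have ti : 0 < v (x i) := lt_le_trans c0 (low i Ni).
have tj : 0 < v (x j) := lt_le_trans c0 (low j Nj).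
rewrite !absvalM !absvalV !ltr_pdivrMr// (lt_le_trans (hM j i Mj Mi))//.
by rewrite !ler_pM ?low ?mulr_ge0// ltW.
Qed.

Lemma completion_inv_ex (a : completion) : a != 0 -> exists b, b * a = 1.
Proof.
elim/quotW: a => x a0.
have nx : ~ null_for (cseq x).
  by move=> nx; move/eqP: a0; apply; apply: quot_eq0; exact/asboolP.
have [cy [N hN]] := cauchy_for_inv (cauchy_seqP x) nx.
have cyP : (fun i => (cseq x i)^-1) \in cauchy_pred by exact/asboolP.
exists (\pi_({ideal_quot null_ideal}) (CauchySeq cyP)).
apply: quot_mul1; apply/asboolP => e e0; exists N => i Ni.
rewrite (_ : cseq _ i = (cseq x i)^-1 * cseq x i - 1)//.
by rewrite mulVf ?hN// subrr absval0.
Qed.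

Definition completion_inv (a : completion) : completion :=
  if pselect (exists b, b * a = 1) is left h then projT1 (cid h) else 0.

Fact completion_mulVf a : a != 0 -> completion_inv a * a = 1.
Proof.
move=> /completion_inv_ex h; rewrite /completion_inv.
by case: pselect => // h'; case: cid.
Qed.

Fact completion_inv0 : completion_inv 0 = 0.
Proof.
rewrite /completion_inv; case: pselect => // h; exfalso.
by case: h => b; rewrite mulr0 => /esym/eqP; rewrite oner_eq0.
Qed.

HB.instance Definition _ :=
  GRing.ComNzRing_isField.Build completion completion_mulVf completion_inv0.

Fact cst_cauchy (a : K) : (fun=> a) \in cauchy_pred.
Proof. exact/asboolP/cauchy_for_cst. Qed.

Definition to_completion (a : K) : completion :=
  \pi_({ideal_quot null_ideal})%qT (CauchySeq (cst_cauchy a)).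

(* The limit does not depend on the Cauchy sequence representing a. *)
Definition completion_abs (a : completion) : R :=
  limn (v \o cseq (repr a)).

Definition completion_int : set completion := [set a | completion_abs a <= 1].

End Completion.

Arguments completion_int {R K} v _.

Definition coset_index (V : zmodType) (A B : set V) : nat :=
  #|` fset_set [set [set x + y | y in B] | x in A]|.

(* A finite place, given by the normalized absolute value in its class.  For a
   Haar measure mu on K_v, the ring O_v is a disjoint union of [O_v : a O_v]
   translates of a O_v, so that mu (a O_v) = |a|_v mu (O_v) amounts to
   |a|_v = 1 / [O_v : a O_v]. *)
Record finplace (R : realType) (K : fieldType) := FinPlace {
  finplace_abs :> absval R K;
  finplace_ultra : forall x y : K,
    finplace_abs (x + y) <= Num.max (finplace_abs x) (finplace_abs y);
  finplace_nontriv : exists2 x : K, x != 0 & finplace_abs x != 1;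
  finplace_normalized : forall a : completion finplace_abs,
    a != 0 -> completion_int finplace_abs a ->
    completion_abs a =
      (coset_index (completion_int finplace_abs)
         [set a * x | x in completion_int finplace_abs])%:R^-1 }.

HB.instance Definition _ (R : realType) (K : fieldType) :=
  gen_eqMixin (finplace R K).
HB.instance Definition _ (R : realType) (K : fieldType) :=
  gen_choiceMixin (finplace R K).

Section NumberField.
Variable K : fieldExtType rat.

Definition ring_of_integers : set K :=
  [set x | integralOver (intr : int -> K) x].
Local Notation OK := ring_of_integers.

Definition is_fractional_ideal (I : set K) : Prop :=
  [/\ exists2 x, I x & x != 0,
      forall x y, I x -> I y -> I (x + y),
      forall a x, OK a -> I x -> I (a * x)
    & exists d, [/\ OK d, d != 0 & forall x, I x -> OK (d * x)]].

Definition ideal_class (I : set K) : set (set K) :=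
  [set [set c * x | x in I] | c in [set c : K | c != 0]].

Definition class_number : nat :=
  #|` fset_set [set ideal_class I | I in is_fractional_ideal]|.

Definition coord_ideal n (x : 'cV[K]_n) : set K :=
  [set y | exists2 a : 'I_n -> K,
     forall i, OK (a i) & y = \sum_(i < n) a i * x i 0].

Definition ideal_norm (I : set K) : nat := coset_index OK I.

End NumberField.

(* The r real embeddings and, one from each conjugate pair, s complex ones;
   the case i = j of [complex_emb_conj] says that complex_emb i is not real. *)
Record arch_embeddings (R : realType) (K : fieldExtType rat) (r s : nat) :=
  ArchEmbeddings {
  real_emb : 'I_r -> {rmorphism K -> R};
  complex_emb : 'I_s -> {rmorphism K -> R[i]};
  real_emb_inj : forall i j, real_emb i =1 real_emb j -> i = j;
  complex_emb_inj : forall i j, complex_emb i =1 complex_emb j -> i = j;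
  complex_emb_conj : forall i j,
    ~ (complex_emb i =1 fun x => (complex_emb j x)^*);
  emb_complete : forall f : {rmorphism K -> R[i]},
    [\/ exists i, f =1 (fun x => (real_emb i x)%:C%C),
        exists j, f =1 complex_emb j
      | exists j, f =1 fun x => (complex_emb j x)^*] }.


Section HermiteHumbert.
Variables (R : realType) (K : fieldExtType rat) (r s n : nat).

Definition real_form (A : 'M[R]_n) (y : 'cV[R]_n) : R := (y^T *m A *m y) 0 0.

Definition complex_form (A : 'M[R[i]]_n) (y : 'cV[R[i]]_n) : R[i] :=
  ((map_mx Num.conj y)^T *m A *m y) 0 0.

(* On R[i], 0 < z means that z is real and positive. *)
Record humbert_form := HumbertForm {
  humbert_real : 'I_r -> 'M[R]_n;
  humbert_complex : 'I_s -> 'M[R[i]]_n;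
  humbert_real_sym : forall i, humbert_real i \is symmetricmx;
  humbert_real_posdef : forall i (y : 'cV[R]_n), y != 0 -> 0 < real_form (humbert_real i) y;
  humbert_complex_herm : forall i, humbert_complex i \is hermsymmx;
  humbert_complex_posdef : forall i (y : 'cV[R[i]]_n), y != 0 ->
    0 < complex_form (humbert_complex i) y }.

(* Hermitian forms and determinants of hermitian matrices have real values. *)
Definition humbert_eval (E : arch_embeddings R K r s) (S : humbert_form)
    (x : 'cV[K]_n) : R :=
  (\prod_(i < r) real_form (humbert_real S i) (map_mx (real_emb E i) x)) *
  (\prod_(i < s) complex.Re
     (complex_form (humbert_complex S i) (map_mx (complex_emb E i) x))) ^+ 2.

Definition humbert_det (S : humbert_form) : R :=
  (\prod_(i < r) \det (humbert_real S i)) *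
  (\prod_(i < s) complex.Re (\det (humbert_complex S i))) ^+ 2.

Definition nonzero_integral_vectors : set 'cV[K]_n :=
  [set x | x != 0 /\ forall i, ring_of_integers (x i 0)].

Definition gamma_p (E : arch_embeddings R K r s) : \bar R :=
  ereal_sup [set ereal_inf
    [set (humbert_eval E S x /
          ((ideal_norm (coord_ideal x))%:R ^+ 2 *
           humbert_det S `^ n%:R^-1))%:E | x in nonzero_integral_vectors]
    | S in [set: humbert_form]].

End HermiteHumbert.

Section Adelic.
Variables (R : realType) (K : fieldExtType rat) (r s : nat).
Variable E : arch_embeddings R K r s.
Variable n : nat.

Local Notation m := (\dim {: K}).

Definition complex_abs (z : R[i]) : R := Normc.normc z ^+ 2.

Definition height_real (x : 'cV[R]_n) : R :=
  (\sum_(i < n) `|x i 0| ^+ 2) `^ (2 * m)%:R^-1.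

Definition height_complex (x : 'cV[R[i]]_n) : R :=
  (\sum_(i < n) complex_abs (x i 0)) `^ m%:R^-1.

Definition height_finite (v : finplace R K) (x : 'cV[completion v]_n) : R :=
  (\big[Num.max/0]_(i < n) completion_abs (x i 0)) `^ m%:R^-1.

(* Families of n x n matrices over K_v, v running over all places; a real or
   complex K_v is identified with R or R[i] through the chosen embedding. *)
Record adelic_family := AdelicFamily {
  at_real : 'I_r -> 'M[R]_n;
  at_complex : 'I_s -> 'M[R[i]]_n;
  at_finite : forall v : finplace R K, 'M[completion v]_n }.

Definition adelic_mul (g h : adelic_family) : adelic_family :=
  AdelicFamily (fun i => at_real g i *m at_real h i)
               (fun i => at_complex g i *m at_complex h i)
               (fun v => at_finite g v *m at_finite h v).

Definition diagonal (A : 'M[K]_n) : adelic_family :=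
  AdelicFamily (fun i => map_mx (real_emb E i) A)
               (fun i => map_mx (complex_emb E i) A)
               (fun v => map_mx (@to_completion R K v) A).

Definition GL_integral (v : finplace R K) : set 'M[completion v]_n :=
  [set A | [/\ A \in unitmx,
               forall i j, completion_int v (A i j)
             & forall i j, completion_int v (invmx A i j)]].

Definition GL_infinite (g : adelic_family) : Prop :=
  (forall i, at_real g i \in unitmx) /\ (forall i, at_complex g i \in unitmx).

(* GL_n of the adele ring: the restricted product of the GL_n(K_v) with
   respect to the GL_n(O_v). *)
Definition GL_adele : set adelic_family :=
  [set g | [/\ GL_infinite g,
               forall v, at_finite g v \in unitmx
             & finite_set [set v | ~ GL_integral (at_finite g v)]]].

Definition GL_Kinf : set adelic_family :=
  [set g | GL_infinite g /\ forall v, at_finite g v = 1%:M].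

Definition GL_Ainf : set adelic_family :=
  [set g | GL_infinite g /\ forall v, GL_integral (at_finite g v)].

Definition GL_K : set adelic_family :=
  [set diagonal A | A in [set A : 'M[K]_n | A \in unitmx]].

Definition double_coset (l : adelic_family) : set adelic_family :=
  [set adelic_mul (adelic_mul u l) c | u in GL_Ainf & c in GL_K].

Definition coset_decomposition (lambda : 'I_(class_number K) -> adelic_family)
    : Prop :=
  [/\ GL_adele = \bigcup_i double_coset (lambda i),
      trivIset setT (fun i => double_coset (lambda i))
    & forall i : 'I_(class_number K), i = 0%N :> nat -> GL_Ainf (lambda i)].

(* For x != 0 and g in GL_n(A), almost all factors are equal to 1. *)
Definition height (g : adelic_family) (x : 'cV[K]_n) : R :=
  (\prod_(i < r) height_real (at_real g i *m map_mx (real_emb E i) x)) *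
  (\prod_(i < s) height_complex (at_complex g i *m map_mx (complex_emb E i) x)) *
  \big[*%R/1]_(v \in [set: finplace R K])
    height_finite (at_finite g v *m map_mx (@to_completion R K v) x).

Definition adelic_abs_det (g : adelic_family) : R :=
  (\prod_(i < r) `|\det (at_real g i)|) *
  (\prod_(i < s) complex_abs (\det (at_complex g i))) *
  \big[*%R/1]_(v \in [set: finplace R K]) completion_abs (\det (at_finite g v)).

Definition gamma_T (lambda : 'I_(class_number K) -> adelic_family) : \bar R :=
  \big[maxe/-oo%E]_(i < class_number K)
    ereal_sup [set ereal_inf
      [set (height (adelic_mul g (lambda i)) x ^+ 2 /
            adelic_abs_det (adelic_mul g (lambda i)) `^ (2 / (n * m)%:R))%:E
       | x in [set x : 'cV[K]_n | x != 0]] | g in GL_Kinf].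

End Adelic.

(* Main.v *)
Require Import Defs.
From HB Require Import structures.
From mathcomp Require Import all_boot all_order all_algebra all_field.
From mathcomp Require Import ring_quotient finmap perm ring zify.
From mathcomp Require Import all_classical all_reals all_analysis.
From mathcomp Require Import complex.

Set Implicit Arguments.
Unset Strict Implicit.
Unset Printing Implicit Defensive.

Import Order.TTheory GRing.Theory Num.Theory.
Import numFieldNormedType.Exports.

Local Open Scope classical_set_scope.
Local Open Scope ring_scope.

(** A form [S] is written as [g^* g] with [g] in GL_n(K_infty), by a Cholesky
    decomposition.  If the finite components of [h] are integral with integral
    inverses, they do not change the local heights, so that the quotient
    [T(h, x)] in Thunder's constant satisfies
      [T(h, x) ^ m = S[x] * (prod_v max_i |x_i|_v) ^ 2 / det(S) ^ (1/n)],
    [v] running over the finite places.  For an integral vector this product is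
    the inverse of the norm of <x>: each maximal ideal P of O_K belongs to
    exactly one finite place, and |J / P J| = |O_K / P| for every ideal J.
    A general vector is made integral by an integer factor a; this does not
    increase the right-hand side, as a ^ (r + 2 s) <= a ^ m <= |O_K / a O_K|.
    The infimum attached to S is therefore the m-th power of the infimum
    attached to a point of the double coset of [lambda_1].

    The Dedekind property of O_K comes from the decomposition into
    [class_number] double cosets: it excludes the junk value 0 of that number, so
    there are finitely many ideal classes, and an ideal two of whose powers lie
    in the same class is invertible. *)

(** * Indices of subgroups *)

Section Index.
Variable V : zmodType.
Implicit Types A B C : set V.

(** The obstacle is that finite places are abstract absolute values, tied to O_K by nothing but
    their normalization, so that the arithmetic of K is rebuilt from indices of subgroups.
    Finiteness of O_K modulo a nonzero ideal yields the finite generation of ideals, a measure for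
    inductions on ideals, the maximality of the ideal of a place and the discreteness of valuations.

    Scaling by an integer a is in truth neutral, as r + 2 s = m and |O_K / a O_K| = a ^ m. Two
    inequalities suffice here, because nonzero integral vectors already compete in Thunder's
    infimum, which settles the other direction. One comes from counting roots of a minimal
    polynomial, the other from counting residues modulo high powers of a.

    The comparison concerns only the double coset of [lambda_1] and holds for every class number;
    the remaining cosets can only enlarge the maximum, which is why equality is claimed for class
    number one. Finiteness of the constants is not established, so that suprema are compared in the
    extended reals. *)

Definition is_subgroup A := A 0 /\ forall x y, A x -> A y -> A (x - y).

Lemma subgroupN A x : is_subgroup A -> A x -> A (- x).
Proof. by move=> [A0 AB] Ax; rewrite -sub0r; apply: AB. Qed.

Lemma subgroupD A x y : is_subgroup A -> A x -> A y -> A (x + y).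
Proof.
by move=> sA Ax Ay; rewrite -[y]opprK; apply: (proj2 sA) => //; exact: subgroupN.
Qed.

Definition coset_reps A B (T : finType) (f : T -> V) :=
  [/\ forall i, A (f i),
      forall x, A x -> exists i, B (x - f i)
    & forall i j, B (f i - f j) -> i = j].

(** A relation rather than a number: [coset_index] is 0 when there are infinitely many cosets, so
    finiteness has to be carried along. *)
Definition is_index A B N :=
  exists (T : finType) (f : T -> V), coset_reps A B f /\ #|T| = N.

Lemma is_index_coset_index A B N :
  is_subgroup B -> is_index A B N -> coset_index A B = N.
Proof.
move=> sB [T [f [[fA fcov finj] <-]]]; rewrite /coset_index.
have eqc x i : B (x - f i) -> [set x + y | y in B] = [set f i + y | y in B].
  move=> Bx; apply/seteqP; split=> _ [y By <-] /=.
    by exists ((x - f i) + y); [exact: subgroupD | rewrite addrA subrKC].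
  exists ((f i - x) + y); last by rewrite addrA subrKC.
  by apply: subgroupD => //; rewrite -opprB; exact: subgroupN.
have -> : [set [set x + y | y in B] | x in A] =
          [set [set f i + y | y in B] | i in [set: T]].
  apply/seteqP; split=> _ /= [x Ax <-]; last by exists (f x).
  by have [i Bi] := fcov x Ax; exists i => //; rewrite (eqc x i).
apply: card_fset_set.
apply: (card_eq_trans (inj_card_eq _)).
  move=> i j _ _ /seteqP[+ _] => /(_ (f i)) /=.
  case; first by exists 0; rewrite ?addr0 //; case: sB.
  move=> y By ey; apply: finj; rewrite -ey.
  by rewrite addrAC subrr add0r.
rewrite card_eq_sym; apply: card_eq_trans card_II _.
rewrite card_eq_sym.
have := @inj_card_eq _ _ [set: T] enum_rank (in2W enum_rank_inj).
suff -> : [set enum_rank x | x in [set: T]] = [set: 'I_#|T|] by rewrite card_eq_sym.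
by apply/seteqP; split=> // i _; exists (enum_val i) => //; rewrite enum_valK.
Qed.

Lemma is_index_uniq A B N M :
  is_subgroup B -> is_index A B N -> is_index A B M -> N = M.
Proof. by move=> sB /is_index_coset_index <-// /is_index_coset_index <-. Qed.

Lemma is_index_gt0 A B N : is_subgroup A -> is_index A B N -> (0 < N)%N.
Proof.
move=> sA [T [f [[fA fcov finj] <-]]]; apply/card_gt0P.
by have [i _] := fcov 0 (proj1 sA); exists i.
Qed.

Lemma is_index_trans A B C N M : is_subgroup A -> is_subgroup B ->
  is_subgroup C -> B `<=` A -> C `<=` B ->
  is_index A B N -> is_index B C M -> is_index A C (N * M).
Proof.
move=> sA sB sC BA CB [T [f [[fA fcov finj] <-]]] [U [g [[gA gcov ginj] <-]]].
exists (T * U)%type, (fun p => f p.1 + g p.2); split; last by rewrite card_prod.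
split=> [[i j]|x /fcov[i /gcov[j Cj]]|[i j] [k l] /= h].
- by apply: subgroupD => //; apply/BA.
- by exists (i, j); rewrite /= opprD addrA.
have eik : i = k.
  apply: finj; have := CB _ h; rewrite opprD addrACA => h'.
  rewrite -(addrK (g j - g l) (f i - f k)); apply: (proj2 sB) => //.
  by apply: (proj2 sB).
congr (_, _); first exact: eik.
by apply: ginj; move: h; rewrite eik opprD addrACA subrr add0r.
Qed.

(** The elements of [s] need not lie in [A]. Going through [s], one element of [A] is kept in each
    class that meets [A] and is not yet represented. *)
Lemma coset_reps_exist A B (s : seq V) : is_subgroup B ->
  (forall x, A x -> exists2 y, y \in s & B (x - y)) ->
  exists N, is_index A B N.
Proof.
move=> sB cov.
have Bsym x y : B (x - y) -> B (y - x).
  by move=> Bx; rewrite -opprB; exact: subgroupN.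
have Btr y x z : B (x - y) -> B (y - z) -> B (x - z).
  move=> Bx By; have -> : x - z = (x - y) + (y - z) by rewrite addrA subrK.
  exact: subgroupD.
suff [t [tA tcov tinj]] : exists t : seq V,
    [/\ forall y, y \in t -> A y,
      forall x y, A x -> y \in s -> B (x - y) -> exists2 z, z \in t & B (x - z)
    & forall i j, (i < size t)%N -> (j < size t)%N ->
        B (nth 0 t i - nth 0 t j) -> i = j].
  exists (size t), 'I_(size t), (fun i : 'I__ => nth 0 t i).
  split; last by rewrite card_ord.
  split=> [i|x Ax|i j Bij].
  - by apply: tA; exact: mem_nth.
  - have [y ys Bxy] := cov x Ax; have [z zt Bxz] := tcov x y Ax ys Bxy.
    have zi : (index z t < size t)%N by rewrite index_mem.
    by exists (Ordinal zi); rewrite /= nth_index.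
  - by apply/val_inj/tinj => //; exact: ltn_ord.
elim: s {cov} => [|y s [t [tA tcov tinj]]]; first by exists [::].
have [[x [Ax Bxy nx]]|no] := pselect (exists x, [/\ A x, B (x - y) &
    forall z, z \in t -> ~ B (x - z)]).
  exists (x :: t); split.
  - by move=> z; rewrite inE => /predU1P[->//|]; exact: tA.
  - move=> u w Au; rewrite inE => /predU1P[-> Buy|ws Buw].
      by exists x; [rewrite inE eqxx|apply: (Btr y) => //; exact: Bsym].
    by have [z zt Bz] := tcov u w Au ws Buw; exists z => //; rewrite inE zt orbT.
  - case=> [|i] [|j] //=; rewrite ?ltnS => hi hj Bij.
    + by exfalso; apply: (nx (nth 0 t j)) => //; exact: mem_nth.
    + by exfalso; apply: (nx (nth 0 t i)); [exact: mem_nth|exact: Bsym].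
    + by congr S; exact: tinj.
exists t; split=> // u w Au; rewrite inE => /predU1P[-> Buy|]; last exact: tcov.
have [//|nz] := pselect (exists2 z, z \in t & B (u - z)).
exfalso; apply: no; exists u; split=> // z zt Bz; apply: nz; by exists z.
Qed.

Lemma is_index_of_classes A B (T : finType) (cl : V -> T) : is_subgroup B ->
  (forall x y, A x -> A y -> cl x = cl y -> B (x - y)) -> exists N, is_index A B N.
Proof.
move=> sB h; pose g t := xget 0 [set x | A x /\ cl x = t].
apply: (@coset_reps_exist _ _ [seq g t | t <- enum T]) => // x Ax.
have [Ag cg] : [set y | A y /\ cl y = cl x] (g (cl x)) by apply: (xgetPex 0); exists x.
exists (g (cl x)); first by apply: map_f; rewrite mem_enum.
by apply: h => //; rewrite cg.
Qed.

Lemma is_index_ge A B N (T : finType) (g : T -> V) : is_subgroup B ->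
  is_index A B N -> (forall t, A (g t)) ->
  (forall t u, B (g t - g u) -> t = u) -> (#|T| <= N)%N.
Proof.
move=> sB [U [f [[fA fcov finj] <-]]] Ag ginj.
have /choice[h hP] t : exists i, B (g t - f i) by apply: fcov.
apply: (leq_card h) => t u tu; apply: ginj.
have -> : g t - g u = (g t - f (h t)) - (g u - f (h u)).
  by rewrite tu opprB addrA subrK.
exact: (proj2 sB).
Qed.

End Index.

Lemma is_index_image (V W : zmodType) (h : {additive V -> W}) (A B : set V) N :
  injective h -> is_index A B N ->
  is_index [set h x | x in A] [set h x | x in B] N.
Proof.
move=> hi [T [f [[fA fcov finj] <-]]].
exists T, (h \o f); split=> //; split=> [i|_ [x Ax <-]|i j] /=.
- by exists (f i).
- by have [i Bi] := fcov x Ax; exists i; exists (x - f i); rewrite ?raddfB.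
- by rewrite -raddfB => -[y By /hi yE]; apply: finj; rewrite -yE.
Qed.

Lemma pigeonhole (T : finType) (g : nat -> T) :
  exists i d, g i = g (i + d.+1)%N.
Proof.
have /injectivePn[i [j ij gij]] : ~~ injectiveb (fun k : 'I_#|T|.+1 => g k).
  by apply/injectiveP => /leq_card; rewrite card_ord ltnn.
wlog lij : i j ij gij / (i < j)%N.
  move=> H; case: (ltngtP i j) => [|ji|/val_inj eij]; first exact: H.
    by apply: (H j i) => //; rewrite eq_sym.
  by rewrite eij eqxx in ij.
by exists i, (j - i).-1; rewrite prednK ?subn_gt0 // subnKC // ltnW.
Qed.

(** * The ring of integers *)

Section RingOfIntegers.
Variable K : fieldExtType rat.
Local Notation OK := (@ring_of_integers K).
Local Notation m := (\dim {: K}).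

Let intK : {rmorphism int -> K} := intr.

Lemma OK_int (a : int) : OK a%:~R. Proof. exact: integral_id. Qed.
Lemma OK0 : OK 0. Proof. exact: (mxpoly.integral0 intK). Qed.
Lemma OK1 : OK 1. Proof. exact: (integral1 intK). Qed.
Lemma OK_nat (a : nat) : OK a%:R. Proof. exact: (integral_nat intK). Qed.
Lemma OKB x y : OK x -> OK y -> OK (x - y). Proof. exact: (@integral_sub _ _ intK). Qed.
Lemma OKD x y : OK x -> OK y -> OK (x + y). Proof. exact: (@integral_add _ _ intK). Qed.
Lemma OKM x y : OK x -> OK y -> OK (x * y). Proof. exact: (@integral_mul _ _ intK). Qed.
Lemma OKN x : OK x -> OK (- x). Proof. exact: (@integral_opp _ _ intK). Qed.

Lemma OKX x k : OK x -> OK (x ^+ k).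
Proof.
move=> x_int; elim: k => [|k IH]; first by rewrite expr0; exact: OK1.
by rewrite exprS; exact: OKM.
Qed.

Lemma OK_sum (I : Type) (r : seq I) (P : pred I) (F : I -> K) :
  (forall i, OK (F i)) -> OK (\sum_(i <- r | P i) F i).
Proof. by move=> h; elim/big_ind: _ => // *; [exact: OK0|exact: OKD]. Qed.

Lemma OK_subgroup : is_subgroup OK.
Proof. by split; [exact: OK0|exact: OKB]. Qed.

(** Clearing denominators in the minimal polynomial gives an integer polynomial with root [x]; its
    leading coefficient times [x] is integral. *)
Lemma OK_frac (x : K) : exists2 a : nat, a != 0%N & OK (a%:R * x).
Proof.
have [p pE] := polyOver1P (minPolyOver 1 x).
have pmon := monic_minPoly 1 x.
have [q [c c0 pq]] := rat_poly_scale p.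
have qx : root (map_poly intr q) x.
  have : root (minPoly 1 x) x by exact: root_minPoly.
  rewrite pE pq map_polyZ rootZ; last first.
    by rewrite fmorph_eq0 invr_eq0 intr_eq0.
  rewrite -map_poly_comp /=.
  by rewrite (eq_map_poly (g := intr)) // => z /=; exact: (rmorph_int (in_alg K)).
have q0 : q != 0.
  apply: contraTneq pmon => q0.
  by rewrite pE pq q0 map_poly0 scaler0 map_poly0 monicE lead_coef0 eq_sym oner_eq0.
pose c1 := lead_coef q; have c10 : c1 != 0 by rewrite lead_coef_eq0.
have c1K : c1%:~R != 0 :> K.
  by rewrite -(rmorph_int (in_alg K)) fmorph_eq0 intr_eq0.
suff h : OK (c1%:~R * x).
  exists `|c1|%N; first by rewrite absz_eq0.
  case: (c1) h => n //= /OKN; rewrite NegzE mulrNz mulNr opprK //.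
pose k := (size q).-1.
have sq : size q = k.+1 by rewrite prednK // size_poly_gt0.
(* These are the coefficients of c1 ^ (k - 1) q(X / c1), which is monic and vanishes at c1 x. *)
pose e i := if i == k then 1 else q`_i * c1 ^+ (k.-1 - i).
have ei i : (i <= k)%N -> c1 * e i * c1 ^+ i = c1 ^+ k * q`_i.
  rewrite /e; case: eqP => [->|ik] lik.
    by rewrite mulr1 mulrC /c1 lead_coefE sq.
  have {ik}lik : (i < k)%N by rewrite ltn_neqAle lik andbT; apply/eqP.
  rewrite [q`_i * _]mulrC !mulrA -exprS mulrAC -exprD; congr (_ ^+ _ * _).
  by lia.
exists (\poly_(i < k.+1) e i).
  rewrite monicE lead_coef_poly ?lt0n //; rewrite /e eqxx ?oner_eq0 //.
rewrite /root; apply/eqP/(mulfI c1K); rewrite mulr0.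
rewrite poly_def rmorph_sum /= horner_sum mulr_sumr.
have qE : q = \sum_(i < k.+1) q`_i *: 'X^i by rewrite -poly_def -sq coefK.
have h : \sum_(i < k.+1) (map_poly intr (q`_i *: 'X^i)).[x] = 0 :> K.
  by rewrite -horner_sum -rmorph_sum -qE; exact/rootP.
transitivity (c1%:~R ^+ k * (0 : K)); last by rewrite mulr0.
rewrite -[in RHS]h [in RHS]mulr_sumr; apply: eq_bigr => i _.
rewrite !map_polyZ !map_polyXn !hornerZ !hornerXn exprMn !mulrA.
congr (_ * _); rewrite -!rmorphXn -!rmorphM /=; congr (_ %:~R).
by apply: ei; rewrite -ltnS.
Qed.

Lemma natK_neq0 (a : nat) : a != 0%N -> a%:R != 0 :> K.
Proof.
by move=> a0; rewrite -(rmorph_nat (in_alg K)) fmorph_eq0 pnatr_eq0.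
Qed.

Lemma OK_dvd_nat x : OK x -> x != 0 ->
  exists a : nat, a != 0%N /\ exists2 y, OK y & a%:R = x * y.
Proof.
move=> x_int x0; have [a a0 ay] := OK_frac x^-1.
by exists a; split=> //; exists (a%:R * x^-1); rewrite // mulrCA divff ?mulr1.
Qed.

End RingOfIntegers.

(** * The trace form, and integral bases up to a denominator *)

Section Lattice.
Variable K : fieldExtType rat.
Local Notation OK := (@ring_of_integers K).
Local Notation m := (\dim {: K}).
Local Notation b := (vbasis {: K}).

Definition coord_row (y : K) : 'rV[rat]_m := \row_j coord b j y.

Definition mulK_mx (x : K) : 'M[rat]_m := \matrix_(i, j) coord b j (x * b`_i).

Lemma sum_coord (y : K) : y = \sum_i coord b i y *: b`_i.
Proof. by apply: coord_vbasis; rewrite memvf. Qed.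

Lemma coord_row_mul x y : coord_row y *m mulK_mx x = coord_row (x * y).
Proof.
apply/rowP => j; rewrite !mxE {2}(sum_coord y) mulr_sumr linear_sum.
by apply: eq_bigr => i _; rewrite !mxE -scalerAr linearZ.
Qed.

Lemma row_mulK_mx x i : row i (mulK_mx x) = coord_row (x * b`_i).
Proof. by apply/rowP => j; rewrite !mxE. Qed.

Lemma mulK_mxM x y : mulK_mx (x * y) = mulK_mx y *m mulK_mx x.
Proof.
by apply/row_matrixP => i; rewrite row_mul !row_mulK_mx coord_row_mul mulrA.
Qed.

Lemma mulK_mxD x y : mulK_mx (x + y) = mulK_mx x + mulK_mx y.
Proof. by apply/matrixP => i j; rewrite !mxE mulrDl linearD. Qed.

Lemma mulK_mxZ a x : mulK_mx (a *: x) = a *: mulK_mx x.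
Proof. by apply/matrixP => i j; rewrite !mxE -scalerAl linearZ. Qed.

Lemma mulK_mx1 : mulK_mx 1 = 1%:M.
Proof.
apply/matrixP => i j; rewrite !mxE mul1r coord_free; first by rewrite eq_sym.
by rewrite (basis_free (vbasisP _)).
Qed.

Lemma mulK_mx0 : mulK_mx 0 = 0.
Proof. by rewrite -(scale0r 0) mulK_mxZ scale0r. Qed.

Definition trK (x : K) : rat := \tr (mulK_mx x).

Lemma trK_linear : GRing.linear_for *%R trK.
Proof. by move=> a x y; rewrite /trK mulK_mxD mulK_mxZ mxtraceD mxtraceZ. Qed.

HB.instance Definition _ := GRing.isLinear.Build rat K rat _ trK trK_linear.

Lemma trK1 : trK 1 = m%:R.
Proof. by rewrite /trK mulK_mx1 mxtrace1. Qed.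

Lemma dimK_gt0 : (0 < m)%N.
Proof. by rewrite adim_gt0. Qed.

(* The eigenvalues of multiplication by an integral element are themselves
   algebraic integers. *)
Lemma trK_int (x : K) : OK x -> trK x \is a Num.int.
Proof.
case=> p p_mon px.
pose C (y : K) : 'M[algC]_m := map_mx ratr (mulK_mx y).
have [rs rsE] := closed_field_poly_normal (char_poly (C x)).
have lc1 : lead_coef (char_poly (C x)) = 1 by apply/monicP/char_poly_monic.
rewrite lc1 scale1r in rsE.
have rs_int z : z \in rs -> z \in Aint.
  rewrite -root_prod_XsubC -rsE -eigenvalue_root_char.
  case/eigenvalueP => v vz v0.
  have pz (P : {poly int}) :
      v *m C (map_poly intr P).[x] = (map_poly intr P).[z] *: v.
    elim/poly_ind: P => [|P a IH].
      by rewrite !rmorph0 !horner0 /C mulK_mx0 map_mx0 mulmx0 scale0r.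
    rewrite !rmorphD !rmorphM /= !map_polyX !map_polyC /= !hornerMXaddC.
    have CD y y' : C (y + y') = C y + C y' by rewrite /C mulK_mxD map_mxD.
    have CM y y' : C (y * y') = C y' *m C y by rewrite /C mulK_mxM map_mxM.
    have Ca : C a%:~R = (a%:~R)%:M.
      have -> : a%:~R = (a%:~R : rat) *: (1 : K).
        exact/esym/(rmorph_int (in_alg K)).
      rewrite /C mulK_mxZ mulK_mx1 scalemx1 map_scalar_mx.
      congr (_ %:M); exact: ratr_int.
    rewrite CD CM Ca mulmxDr mulmxA vz -scalemxAl IH scalerA mul_mx_scalar.
    by rewrite scalerDl mulrC.
  have := pz p; rewrite (rootP px) /C mulK_mx0 map_mx0 mulmx0 => /esym/eqP.
  rewrite scaler_eq0 (negPf v0) orbF => pz0.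
  apply: (@root_monic_Aint (map_poly intr p)) => //.
    exact: monic_map.
  by apply/polyOverP => i; rewrite coef_map /=; exact: intr_int.
have tr_Aint : \tr (C x) \in Aint.
  rewrite -[\tr _]opprK -char_poly_trace ?dimK_gt0 // rpredN rsE.
  suff /polyOverP : \prod_(z <- rs) ('X - z%:P) \is a polyOver Aint by apply.
  rewrite big_seq; apply: rpred_prod => z /rs_int zint.
  by rewrite polyOverXsubC.
have trE : \tr (C x) = ratr (trK x).
  by rewrite /mxtrace rmorph_sum; apply: eq_bigr => i _; rewrite !mxE.
rewrite trE in tr_Aint.
have /intrP[z zE] := Cint_rat_Aint (Crat_rat _) tr_Aint.
have -> : trK x = z%:~R by apply: (fmorph_inj (ratr : {rmorphism rat -> algC})); exact: (etrans zE (esym (ratr_int _ z))).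
exact: intr_int.
Qed.

(** [D] is the absolute value of the determinant of the Gram matrix [G] of the trace form on an
    integral basis [e] of K over Q. If x has coordinates v, then v G consists of traces of integers,
    and Cramer's rule makes det(G) v integral. *)
Lemma integral_basis_multiple : exists (D : nat) (e : 'I_m -> K),
  [/\ D != 0%N, forall i, OK (e i),
      forall c : 'I_m -> int, \sum_i (c i)%:~R * e i = 0 -> forall i, c i = 0
    & forall x, OK x -> exists c : 'I_m -> int,
        D%:R * x = \sum_i (c i)%:~R * e i].
Proof.
have /choice[a a_prop] (i : 'I_m) : exists a : nat, a != 0%N /\ OK (a%:R * b`_i).
  by have [a] := OK_frac b`_i; exists a.
pose e i := (a i)%:R * b`_i.
have eE i : e i = (a i)%:R *: b`_i.
  by rewrite /e scaler_nat mulr_natl.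
have e_int i : OK (e i) by case: (a_prop i).
pose G : 'M[rat]_m := \matrix_(i, j) trK (e i * e j).
have G_int i j : G i j \is a Num.int.
  by rewrite mxE; apply: trK_int; exact: OKM.
have trE (v : 'rV[rat]_m) j : (v *m G) 0 j = trK ((\sum_i v 0 i *: e i) * e j).
  rewrite !mxE mulr_suml linear_sum; apply: eq_bigr => i _.
  by rewrite mxE -scalerAl linearZ.
have e_span y : exists v : 'rV[rat]_m, y = \sum_i v 0 i *: e i.
  exists (\row_i (coord b i y / (a i)%:R)); rewrite {1}(sum_coord y).
  apply: eq_bigr => i _; rewrite mxE eE scalerA divfK //.
  by rewrite pnatr_eq0; case: (a_prop i).
have e_free (v : 'rV[rat]_m) : \sum_i v 0 i *: e i = 0 -> v = 0.
  move=> v0; apply/rowP => i; rewrite mxE.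
  have h : \sum_i (v 0 i * (a i)%:R) *: b`_i = 0.
    by rewrite -[RHS]v0; apply: eq_bigr => j _; rewrite eE scalerA.
  have /freeP/(_ _ h i)/eqP := basis_free (vbasisP {: K}).
  rewrite mulf_eq0 pnatr_eq0; have [/negPf -> _] := a_prop i.
  by rewrite orbF => /eqP.
(* A vector in the kernel gives some y orthogonal to all of K; pairing y with its inverse would give
   trace 0 instead of m. *)
have G_unit : \det G != 0.
  apply/negP => /det0P[v v0 vG]; case/negP: v0; apply/eqP/e_free.
  set y := \sum_i _; apply: contra_eq (trK1) => y0.
  have [w wE] := e_span y^-1.
  rewrite -(divff y0) wE mulr_sumr linear_sum big1 => [|j _].
    by rewrite eq_sym pnatr_eq0 -lt0n dimK_gt0.
  by rewrite -scalerAr linearZ /= /y -trE vG mxE mulr0.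
have int_det (k : nat) (M : 'M[rat]_k) : (forall i j, M i j \is a Num.int) ->
    \det M \is a Num.int.
  move=> M_int; apply: rpred_sum => s _; apply: rpredM.
    by rewrite rpred_sign.
  exact: rpred_prod.
have /intrP[d dE] : \det G \is a Num.int by exact: int_det.
exists `|d|%N, e; split=> //.
- by rewrite absz_eq0 -(intr_eq0 rat) -dE.
- move=> c c0 i; apply/eqP; rewrite -(intr_eq0 rat); apply/eqP.
  have /rowP/(_ i) : \row_i (c i)%:~R = 0 :> 'rV[rat]_m.
    apply: e_free; rewrite -[RHS]c0; apply: eq_bigr => j _.
    by rewrite mxE scaler_int mulrzl.
  by rewrite !mxE.
- move=> x x_int; have [v vE] := e_span x.
  have vd_int i : \det G * v 0 i \is a Num.int.
    have -> : \det G * v 0 i = (v *m G *m \adj G) 0 i.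
      by rewrite -mulmxA mul_mx_adj mul_mx_scalar mxE.
    rewrite mxE; apply: rpred_sum => j _; apply: rpredM.
      by rewrite trE -vE; apply: trK_int; exact: OKM.
    rewrite mxE; apply: rpredM; first by rewrite rpred_sign.
    by apply: int_det => k l; rewrite !mxE; apply: trK_int; exact: OKM.
  have /choice[c cE] i : exists c : int, `|d|%:R * v 0 i = c%:~R.
    apply/intrP; have := vd_int i; rewrite dE.
    case: (d) => n //=; rewrite NegzE mulrNz mulNr => /rpredNr.
    by rewrite opprK.
  exists c; rewrite {1}vE mulr_sumr; apply: eq_bigr => i _.
  by rewrite mulr_natl -scaler_nat scalerA cE scaler_int mulrzl.
Qed.
End Lattice.

Section ScaleSet.
Variable K : fieldType.

Definition scale_set (c : K) (I : set K) : set K := [set c * x | x in I].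

Lemma scale_subgroup c (I : set K) : is_subgroup I -> is_subgroup (scale_set c I).
Proof.
move=> [I0 IB]; split; first by exists 0; rewrite ?mulr0.
by move=> _ _ [x Ix <-] [y Iy <-]; exists (x - y); [exact: IB|rewrite mulrBr].
Qed.

Lemma is_index_scale c (A B : set K) N : c != 0 ->
  is_index A B N -> is_index (scale_set c A) (scale_set c B) N.
Proof.
move=> c0; have cI : injective (GRing.mull_fun c (idfun : K -> K)) by exact: mulfI.
exact: (@is_index_image _ _ (GRing.mull_fun c (idfun : K -> K))).
Qed.

Lemma scale_set1 (A : set K) : scale_set 1 A = A.
Proof.
apply/seteqP; split=> [_ [x Ax <-]|x Ax]; first by rewrite mul1r.
by exists x; rewrite ?mul1r.
Qed.

Lemma scale_setM c d (A : set K) : scale_set (c * d) A = scale_set c (scale_set d A).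
Proof.
apply/seteqP; split=> [_ [x Ax <-]|_ [_ [x Ax <-] <-]].
  by exists (d * x); [exists x|rewrite mulrA].
by exists x; rewrite ?mulrA.
Qed.

End ScaleSet.

Lemma is_index_refl (V : zmodType) (A : set V) : is_subgroup A -> is_index A A 1.
Proof.
move=> [A0 AB]; exists unit, (fun=> 0); split; last by rewrite card_unit.
split=> //; last by move=> [] [].
by move=> x Ax; exists tt; rewrite subr0.
Qed.

(** * The index of a O_K for an integer a *)

Section IdealIndex.
Variable K : fieldExtType rat.
Local Notation OK := (@ring_of_integers K).
Local Notation m := (\dim {: K}).

Lemma scale_OK_sub c : OK c -> scale_set c OK `<=` OK.
Proof. by move=> c_int _ [x x_int <-]; exact: OKM. Qed.

Lemma is_index_OK_exp (a : K) k N : OK a -> a != 0 ->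
  is_index OK (scale_set a OK) N -> is_index OK (scale_set (a ^+ k) OK) (N ^ k).
Proof.
move=> a_int a0 aN; have sOK := @OK_subgroup K; elim: k => [|k IH].
  by rewrite expr0 scale_set1 expn0; exact: is_index_refl.
rewrite expnSr exprSr.
apply: (is_index_trans _ _ _ _ _ IH) => //.
- exact: scale_subgroup.
- exact: scale_subgroup.
- by apply: scale_OK_sub; exact: OKX.
- by rewrite scale_setM => _ [_ [x x_int <-] <-]; exists (a * x) => //; exact: OKM.
- by rewrite scale_setM; apply: is_index_scale => //; exact: expf_neq0.
Qed.

(** The class of x is read off from the coordinates of D x modulo a D: if they agree for x and y,
    then D (x - y) is a D times an integral element, so that x - y lies in a O_K. *)
Lemma is_index_OK_nat_ex (a : nat) : a != 0%N ->
  exists N, is_index OK (scale_set a%:R OK) N.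
Proof.
move=> a0; have [D [e [D0 e_int e_free e_span]]] := integral_basis_multiple K.
have /choice[co coP] x : exists c : 'I_m -> int,
    OK x -> D%:R * x = \sum_i (c i)%:~R * e i.
  by have [/e_span[c cE]|nx] := pselect (OK x); [exists c|exists (fun=> 0)].
have aD0 : (0 < a * D)%N by rewrite muln_gt0 !lt0n a0.
pose cl x := [ffun i => inord `|(co x i %% (a * D)%N)%Z|] : {ffun 'I_m -> 'I_(a * D).-1.+1}.
apply: (is_index_of_classes (cl := cl)); first exact/scale_subgroup/OK_subgroup.
move=> x y x_int y_int /ffunP clxy.
have /choice[t tE] i : exists t : int, co x i - co y i = t * (a * D)%N.
  apply/dvdzP; rewrite -eqz_mod_dvd; apply/eqP.
  have := clxy i; rewrite !ffunE => /(congr1 val) /=.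
  have lt z : (`|(z %% (a * D)%N)%Z| < (a * D).-1.+1)%N.
    rewrite prednK // -ltz_nat gez0_abs ?modz_ge0 ?ltz_pmod //.
    by rewrite eqz_nat -lt0n.
  rewrite !inordK // => /(congr1 Posz).
  by rewrite !gez0_abs ?modz_ge0 // eqz_nat -lt0n.
exists (\sum_i (t i)%:~R * e i).
  by apply: OK_sum => i; apply: OKM => //; exact: OK_int.
have DK := natK_neq0 K D0.
apply: (mulfI DK); rewrite mulrBr (coP x x_int) (coP y y_int) -sumrB mulrA mulr_sumr.
apply: eq_bigr => i _; rewrite -mulrBl -rmorphB /= tE mulrA; congr (_ * _).
by rewrite rmorphM /= mulrC -[(Posz _)%:~R]/((a * D)%:R) natrM [a%:R * _]mulrC.
Qed.

(** The sums of the t_i e_i with 0 <= t_i < B = a ^ k %/ D are pairwise incongruent modulo a ^ k: a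
    congruence makes D (t_i - u_i) a multiple of a ^ k of absolute value less than a ^ k. *)
Lemma is_index_OK_nat_pow_le (a N : nat) : a != 0%N ->
  is_index OK (scale_set a%:R OK) N ->
  exists2 D, (D != 0)%N & forall k, ((a ^ k %/ D) ^ m <= N ^ k)%N.
Proof.
move=> a0 aN; have [D [e [D0 e_int e_free e_span]]] := integral_basis_multiple K.
exists D => // k; set B := (a ^ k %/ D)%N.
have BD : (B * D <= a ^ k)%N by rewrite leq_divM.
have := is_index_OK_exp k (OK_nat K a) (natK_neq0 K a0) aN; rewrite -natrX => akN.
rewrite -[X in (X ^ m)%N](card_ord B) -[X in (_ ^ X)%N](card_ord m) -card_ffun.
pose g (t : {ffun 'I_m -> 'I_B}) : K := \sum_i (t i)%:R * e i.
apply: (is_index_ge (g := g) _ akN).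
- exact/scale_subgroup/OK_subgroup.
- by move=> t; apply: OK_sum => i; apply: OKM => //; exact: OK_nat.
move=> t u [y y_int yE]; have [c cE] := e_span y y_int.
apply/ffunP => i; apply/val_inj/eqP => /=.
have /e_free/(_ i) : \sum_i (D%:Z * ((t i : nat)%:Z - (u i : nat)%:Z)
    - (a ^ k)%N%:Z * c i)%:~R * e i = 0.
  transitivity (D%:R * (g t - g u) - (a ^ k)%:R * (D%:R * y)).
    rewrite cE -sumrB !mulr_sumr -sumrB; apply: eq_bigr => j _.
    by rewrite rmorphB !rmorphM rmorphB /=; ring.
  by rewrite -yE mulrCA subrr.
have tu : (`|(D%:Z * ((t i : nat)%:Z - (u i : nat)%:Z))%R| < a ^ k)%N.
  apply: leq_trans BD; rewrite abszM mulnC ltn_pmul2r ?lt0n //=.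
  by case: (t i) (u i) => [p hp] [q hq] /=; lia.
move=> /eqP; rewrite subr_eq0 => /eqP h.
move: tu; rewrite h abszM /=.
case: (c i =P 0) => [c0 _|c0]; last first.
  by rewrite ltnNge leq_pmulr // absz_gt0; apply/eqP.
move/eqP: h; rewrite c0 mulr0 mulf_eq0 eqz_nat (negPf D0) /= subr_eq0.
by rewrite eqz_nat.
Qed.

(** Bernoulli's inequality for 1 + 1 / N, with denominators cleared. *)
Lemma expnS_growth N k : (N ^ k * (N + k) <= N * N.+1 ^ k)%N.
Proof.
elim: k => [|k IH]; first by rewrite !expn0 mul1n muln1 addn0.
rewrite [(N.+1 ^ _)%N]expnSr mulnA; apply: leq_trans (leq_mul IH (leqnn N.+1)).
by rewrite expnSr -!mulnA leq_mul2l; apply/orP; right; nia.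
Qed.

(** The preceding bound loses a constant factor that does not depend on k. Were N < a ^ m, it would
    give (N + 1) ^ k <= C N ^ k for large k, against Bernoulli's inequality. *)
Lemma is_index_OK_nat_le (a N : nat) : a != 0%N ->
  is_index OK (scale_set a%:R OK) N -> (a ^ m <= N)%N.
Proof.
move=> a0 aN; have [D D0 h] := is_index_OK_nat_pow_le a0 aN.
have N0 := is_index_gt0 (@OK_subgroup K) aN.
have [a1|a1] := leqP a 1.
  have -> : a = 1%N by apply/eqP; rewrite eqn_leq a1 lt0n.
  by rewrite exp1n.
rewrite leqNgt; apply/negP => Na.
(* The term D in k ensures D <= a ^ k, hence a ^ k <= 2 D (a ^ k %/ D); the term N C makes N + k
   exceed N C. *)
pose C := ((2 * D) ^ m)%N; pose k := (D + N * C)%N.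
have ak : (D <= a ^ k)%N.
  apply: leq_trans (ltnW (ltn_expl k a1)); exact: leq_addr.
have up : (N.+1 ^ k <= C * N ^ k)%N.
  apply: leq_trans (leq_mul (leqnn C) (h k)).
  rewrite -expnMn; apply: (@leq_trans ((a ^ m) ^ k)); first by rewrite leq_exp2r ?addn_gt0 ?lt0n ?D0.
  rewrite -expnM [(m * k)%N]mulnC expnM leq_exp2r ?dimK_gt0 //.
  have B0 : (0 < a ^ k %/ D)%N by rewrite divn_gt0 // lt0n.
  have := ltn_ceil (a ^ k) (_ : 0 < D)%N; rewrite lt0n => /(_ D0).
  move=> lt; apply: leq_trans (ltnW lt) _; rewrite mulnAC leq_mul2r.
  by apply/orP; right; lia.
have := leq_trans (expnS_growth N k) (leq_mul (leqnn N) up).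
rewrite mulnCA mulnA [(N ^ k * _)%N]mulnC leq_pmul2r ?expn_gt0 ?N0 //.
by rewrite /k mulnC; lia.
Qed.

End IdealIndex.

(** * Ideals and their invertibility *)

Section Ideals.
Variable K : fieldExtType rat.
Local Notation OK := (@ring_of_integers K).
Local Notation frac := (@is_fractional_ideal K).
Implicit Types I J L : set K.

Lemma frac_mul I a x : frac I -> OK a -> I x -> I (a * x).
Proof. by case=> _ _ h _; exact: h. Qed.

Lemma frac_subgroup I : frac I -> is_subgroup I.
Proof.
move=> fI; have [[x Ix _] ID _ _] := fI; split.
  by rewrite -(mul0r x); apply: frac_mul => //; exact: OK0.
move=> y z Iy Iz; apply: ID => //; rewrite -mulN1r; apply: frac_mul => //.
exact/OKN/OK1.
Qed.

Lemma frac0 I : frac I -> I 0.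
Proof. by move=> /frac_subgroup[]. Qed.

Lemma fracD I x y : frac I -> I x -> I y -> I (x + y).
Proof. by case=> _ h _ _; exact: h. Qed.

Lemma fracB I x y : frac I -> I x -> I y -> I (x - y).
Proof. by move=> /frac_subgroup[_]; apply. Qed.

Lemma fracMr I a x : frac I -> OK a -> I x -> I (x * a).
Proof. by move=> *; rewrite mulrC; exact: frac_mul. Qed.

Lemma frac_OK : frac OK.
Proof.
split.
- by exists 1; [exact: OK1|exact: oner_neq0].
- exact: OKD.
- exact: OKM.
- by exists 1; split=> [|| x]; [exact: OK1|exact: oner_neq0|rewrite mul1r].
Qed.

Lemma frac_sub_int I J : frac I -> J 0 ->
  (exists2 x, J x & x != 0) -> (forall x y, J x -> J y -> J (x + y)) ->
  (forall a x, OK a -> J x -> J (a * x)) -> J `<=` I -> frac J.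
Proof.
move=> [_ _ _ [d [d_int d0 dI]]] J0 Jn JD JM JI; split=> //.
by exists d; split=> // x /JI; exact: dI.
Qed.

Lemma frac_scale c I : c != 0 -> frac I -> frac (scale_set c I).
Proof.
move=> c0 [[x Ix x0] ID IM [d [d_int d0 dI]]]; split.
- by exists (c * x); [exists x|rewrite mulf_neq0].
- by move=> _ _ [y Iy <-] [z Iz <-]; exists (y + z); [exact: ID|rewrite mulrDr].
- by move=> a _ a_int [y Iy <-]; exists (a * y); [exact: IM|rewrite mulrCA].
- have [a a0 ac] := OK_frac c; exists (a%:R * d * 1); rewrite mulr1; split.
  + by apply: OKM => //; exact: OK_nat.
  + by rewrite mulf_neq0 // natK_neq0.
  + move=> _ [y Iy <-]; have -> : a%:R * d * (c * y) = (a%:R * c) * (d * y) by ring.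
    by apply: OKM => //; exact: dI.
Qed.

(** Since [x] divides a positive integer a, x O_K contains a O_K, and representatives modulo a O_K
    also cover the classes modulo x O_K. *)
Lemma OK_index_ex x : OK x -> x != 0 ->
  exists N, is_index OK (scale_set x OK) N.
Proof.
move=> x_int x0; have [a [a0 [y y_int ay]]] := OK_dvd_nat x_int x0.
have [N [T [f [[_ fcov _] _]]]] := is_index_OK_nat_ex K a0.
apply: (@coset_reps_exist _ _ _ [seq f t | t <- enum T]).
  exact/scale_subgroup/OK_subgroup.
move=> z /fcov[t [w w_int tE]]; exists (f t); first by rewrite map_f ?mem_enum.
by exists (y * w); [exact: OKM|rewrite -tE ay mulrA].
Qed.

Lemma frac_index_ex I : frac I -> I `<=` OK -> exists N, is_index OK I N.
Proof.
move=> fI IOK; have [[x Ix x0] _ _ _] := fI.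
have [N [T [f [[_ fcov _] _]]]] := OK_index_ex (IOK _ Ix) x0.
apply: (@coset_reps_exist _ _ _ [seq f t | t <- enum T]); first exact: frac_subgroup.
move=> z /fcov[t [w w_int tE]]; exists (f t); first by rewrite map_f ?mem_enum.
by rewrite -tE; exact: fracMr.
Qed.

Lemma coord_ideal_gen n (x : 'cV[K]_n) i : coord_ideal x (x i 0).
Proof.
exists (fun j => (j == i)%:R) => [j|]; first exact: OK_nat.
rewrite (bigD1 i) //= eqxx mul1r big1 ?addr0 // => j /negPf ->; exact: mul0r.
Qed.

Lemma coord_ideal_frac n (x : 'cV[K]_n) : x != 0 -> frac (coord_ideal x).
Proof.
move=> x0; split.
- have /cV0Pn[i xi] := x0; exists (x i 0) => //; exact: coord_ideal_gen.
- move=> _ _ [a a_int ->] [b b_int ->]; exists (fun i => a i + b i).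
    by move=> i; exact: OKD.
  by rewrite -big_split; apply: eq_bigr => i _; rewrite mulrDl.
- move=> c _ c_int [a a_int ->]; exists (fun i => c * a i).
    by move=> i; exact: OKM.
  by rewrite mulr_sumr; apply: eq_bigr => i _; rewrite mulrA.
- have /choice[d dP] i : exists d : nat, d != 0%N /\ OK (d%:R * x i 0).
    by have [d] := OK_frac (x i 0); exists d.
  exists (\prod_i d i)%:R; split; first exact: OK_nat.
    rewrite natK_neq0 // -lt0n prodn_gt0 // => i; rewrite lt0n.
    by case: (dP i).
  move=> _ [a a_int ->]; rewrite mulr_sumr; apply: OK_sum => i.
  rewrite (bigD1 i) //= natrM.
  have -> : (d i)%:R * (\prod_(j < n | j != i) d j)%:R * (a i * x i 0) =
    ((\prod_(j < n | j != i) d j)%:R * a i) * ((d i)%:R * x i 0) by ring.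
  apply: OKM; last by case: (dP i).
  by apply: OKM => //; exact: OK_nat.
Qed.

(** For a nonzero b in I, the quotient of O_K by d b O_K is finite. Generators of I are b together
    with one element of I for each class that meets d I. *)
Lemma frac_fg I : frac I -> exists n (x : 'cV[K]_n), I = coord_ideal x.
Proof.
move=> fI; have [[b Ib b0] _ _ [d [d_int d0 dI]]] := fI.
have [N [T [f [[f_int fcov _] _]]]] := OK_index_ex (dI _ Ib) (mulf_neq0 d0 b0).
(* The default 0 serves the classes that d I does not meet; it is harmless, as 0 lies in I. *)
pose g t := xget 0 [set y | I y /\ exists2 w, OK w & d * y - f t = d * b * w].
pose x : 'cV[K]_(#|T|.+1) := \col_i if unlift 0 i is Some j then g (enum_val j) else b.
exists #|T|.+1, x; apply/seteqP; split.
  move=> z Iz; have [t [w w_int tE]] := fcov _ (dI _ Iz).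
  have [Ig [v v_int vE]] : [set y | I y /\ exists2 w, OK w & d * y - f t = d * b * w] (g t).
    by apply: (xgetPex 0); exists z; split=> //; exists w.
  have -> : z = (w - v) * b + 1 * g t.
    apply: (mulfI d0); rewrite mul1r mulrDr.
    have -> : d * ((w - v) * b) = d * b * w - d * b * v by ring.
    by rewrite tE -vE; ring.
  have fx : frac (coord_ideal x).
    apply: coord_ideal_frac; apply/cV0Pn; exists 0.
    by rewrite mxE unlift_none.
  apply: fracD => //; apply: frac_mul => //.
  - exact: OKB.
  - by have := coord_ideal_gen x 0; rewrite mxE unlift_none.
  - exact: OK1.
  - have := coord_ideal_gen x (lift 0 (enum_rank t)).
    by rewrite mxE liftK enum_rankK.
move=> _ [a a_int ->]; elim/big_ind: _ => [|u v|i _]; first exact: frac0.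
  exact: fracD.
apply: frac_mul => //; rewrite mxE; case: unliftP => [j _|_] //.
rewrite /g; case: xgetP => [y _ [] //|_]; exact: frac0.
Qed.

(* An impredicative form of the set of finite sums of products. *)
Definition idmul I J : set K := [set z | forall C : set K, C 0 ->
  (forall x y, C x -> C y -> C (x + y)) ->
  (forall x y, I x -> J y -> C (x * y)) -> C z].

Lemma idmul_mem I J x y : I x -> J y -> idmul I J (x * y).
Proof. by move=> Ix Jy C _ _; apply. Qed.

Lemma idmul0 I J : idmul I J 0. Proof. by move=> C. Qed.

Lemma idmulD I J x y : idmul I J x -> idmul I J y -> idmul I J (x + y).
Proof. by move=> hx hy C C0 CD CM; exact: CD (hx C C0 CD CM) (hy C C0 CD CM). Qed.

Lemma idmul_ind I J (C : set K) : C 0 ->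
  (forall x y, C x -> C y -> C (x + y)) ->
  (forall x y, I x -> J y -> C (x * y)) -> idmul I J `<=` C.
Proof. by move=> C0 CD CM z; apply. Qed.

Lemma idmulS I I' J J' : I `<=` I' -> J `<=` J' -> idmul I J `<=` idmul I' J'.
Proof.
move=> II JJ; apply: idmul_ind; [exact: idmul0|exact: idmulD|].
by move=> x y /II Ix /JJ Jy; exact: idmul_mem.
Qed.

Lemma idmulC I J : idmul I J = idmul J I.
Proof.
by apply/seteqP; split; apply: idmul_ind; do ?[exact: idmul0|exact: idmulD];
  move=> x y Ix Jy; rewrite mulrC; exact: idmul_mem.
Qed.

Lemma idmulA I J L : idmul I (idmul J L) = idmul (idmul I J) L.
Proof.
apply/seteqP; split; apply: idmul_ind; do ?[exact: idmul0|exact: idmulD].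
- move=> x y Ix; move: y; apply: idmul_ind; first by rewrite mulr0; exact: idmul0.
  + by move=> u v; rewrite mulrDr; exact: idmulD.
  + by move=> u v Ju Lv; rewrite mulrA; apply: idmul_mem => //; exact: idmul_mem.
- move=> x y + Ly; move: x; apply: idmul_ind; first by rewrite mul0r; exact: idmul0.
  + by move=> u v; rewrite mulrDl; exact: idmulD.
  + by move=> u v Iu Jv; rewrite -mulrA; apply: idmul_mem => //; exact: idmul_mem.
Qed.

Lemma idmul_frac I J : frac I -> frac J -> frac (idmul I J).
Proof.
move=> [[x Ix x0] ID IM [d [d_int d0 dI]]] [[y Jy y0] JD JM [e [e_int e0 eJ]]].
split.
- by exists (x * y); [exact: idmul_mem|rewrite mulf_neq0].
- by move=> *; exact: idmulD.
- move=> a z a_int; move: z; apply: idmul_ind; first by rewrite mulr0; exact: idmul0.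
    by move=> u v; rewrite mulrDr; exact: idmulD.
  by move=> u v Iu Jv; rewrite mulrA; apply: idmul_mem => //; exact: IM.
- exists (d * e); split; [exact: OKM|by rewrite mulf_neq0|].
  apply: idmul_ind; first by rewrite mulr0; exact: OK0.
    by move=> u v; rewrite mulrDr; exact: OKD.
  move=> u v Iu Jv; rewrite mulrACA; apply: OKM; [exact: dI|exact: eJ].
Qed.

Lemma idmul_OK I : frac I -> idmul OK I = I.
Proof.
move=> fI; apply/seteqP; split.
  by apply: idmul_ind; [exact: frac0|move=> *; exact: fracD|move=> *; exact: frac_mul].
by move=> z Iz; rewrite -[z]mul1r; apply: idmul_mem => //; exact: OK1.
Qed.

Lemma idmul_sub I J : frac J -> I `<=` OK -> idmul I J `<=` J.
Proof. by move=> fJ IOK; rewrite -{2}(idmul_OK fJ); exact: idmulS. Qed.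

Lemma idmul_scale c I J : idmul (scale_set c I) J = scale_set c (idmul I J).
Proof.
apply/seteqP; split=> [|_ [z hz <-]].
  apply: idmul_ind; first by exists 0; [exact: idmul0|rewrite mulr0].
    by move=> _ _ [u hu <-] [v hv <-]; exists (u + v); [exact: idmulD|rewrite mulrDr].
  move=> _ y [x Ix <-] Jy; exists (x * y); [exact: idmul_mem|by rewrite mulrA].
move: z hz; apply: idmul_ind; first by rewrite mulr0; exact: idmul0.
  by move=> u v; rewrite mulrDr; exact: idmulD.
by move=> x y Ix Jy; rewrite mulrA; apply: idmul_mem => //; exists x.
Qed.

Lemma idmul_coord n (x : 'cV[K]_n) J z : frac J -> idmul J (coord_ideal x) z ->
  exists b : 'I_n -> K, (forall i, J (b i)) /\ z = \sum_i b i * x i 0.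
Proof.
move=> fJ; move: z; apply: idmul_ind.
- exists (fun=> 0); split; first by move=> _; exact: frac0.
  by rewrite big1 // => i _; rewrite mul0r.
- move=> _ _ [a [Ja ->]] [b [Jb ->]]; exists (fun i => a i + b i); split.
    by move=> i; exact: fracD.
  by rewrite -big_split; apply: eq_bigr => i _; rewrite mulrDl.
- move=> y _ Jy [a a_int ->]; exists (fun i => y * a i); split.
    by move=> i; exact: fracMr.
  by rewrite mulr_sumr; apply: eq_bigr => i _; rewrite mulrA.
Qed.

End Ideals.

(** * Two determinant arguments and the invertibility of ideals *)

Section Invertibility.
Variable K : fieldExtType rat.
Local Notation OK := (@ring_of_integers K).
Local Notation frac := (@is_fractional_ideal K).
Implicit Types I J : set K.

Definition OK_pred : {pred K} := fun x => `[< OK x >].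

Fact OK_pred_subring : subring_closed OK_pred.
Proof.
split; first exact/asboolP/OK1.
- by move=> x y /asboolP hx /asboolP hy; exact/asboolP/OKB.
- by move=> x y /asboolP hx /asboolP hy; exact/asboolP/OKM.
Qed.

HB.instance Definition _ := GRing.isSubringClosed.Build K OK_pred OK_pred_subring.

(** Multiplication by y in J sends generators of I to integral combinations of them. Thus y is an
    eigenvalue of a matrix over O_K, a root of its monic characteristic polynomial, and O_K is
    integrally closed. *)
Lemma frac_mulr_sub_OK I J : frac I -> frac J -> idmul J I `<=` I -> J `<=` OK.
Proof.
move=> fI fJ JI y Jy; have [n [x xE]] := frac_fg fI.
have [[z Iz z0] _ _ _] := fI.
have /choice[a aP] i : exists a : 'I_n -> K,
    (forall j, OK (a j)) /\ y * x i 0 = \sum_j a j * x j 0.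
  have : I (y * x i 0).
    by apply: JI; apply: idmul_mem => //; rewrite xE; exact: coord_ideal_gen.
  by rewrite xE => -[a a_int aE]; exists a.
pose M := \matrix_(i, j) a j i.
have My : root (char_poly M) y.
  rewrite -eigenvalue_root_char; apply/eigenvalueP; exists x^T.
    apply/rowP => j; rewrite !mxE; have [_ ->] := aP j.
    by apply: eq_bigr => k _; rewrite !mxE mulrC.
  rewrite trmx_eq0; apply: contraNneq z0 => x0; move: Iz; rewrite xE x0.
  by move=> [b _ ->]; rewrite big1 // => i _; rewrite mxE mulr0.
apply: (integral_root_monic (char_poly_monic M) My).
apply/(@integral_poly _ _ (intr : {rmorphism int -> K})) => i.
suff /polyOverP/(_ i)/asboolP : char_poly M \is a polyOver OK_pred by [].
apply: rpred_sum => s _; apply: rpredM; first by rewrite rpred_sign.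
apply: rpred_prod => k _; rewrite !mxE rpredB //.
  by rewrite rpredMn // polyOverX.
by rewrite polyOverC; apply/asboolP; case: (aP (s k)).
Qed.

(** Nakayama's argument: the generators satisfy x = B x with B over J, so that det(1 - B) vanishes,
    while it is congruent to 1 modulo J. *)
Lemma frac_mulr_eq_1 I J : frac I -> frac J -> J `<=` OK -> idmul J I = I -> J 1.
Proof.
move=> fI fJ JOK JI; have [n [x xE]] := frac_fg fI.
have [[z Iz z0] _ _ _] := fI.
have /choice[b bP] i : exists b : 'I_n -> K,
    (forall j, J (b j)) /\ x i 0 = \sum_j b j * x j 0.
  by apply: idmul_coord => //; rewrite -xE JI xE; exact: coord_ideal_gen.
pose M := 1%:M - \matrix_(i, j) b j i.
have M0 : \det M = 0.
  apply/eqP/det0P; exists x^T.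
    rewrite trmx_eq0; apply: contraNneq z0 => x0; move: Iz; rewrite xE x0.
    by move=> [c _ ->]; rewrite big1 // => i _; rewrite mxE mulr0.
  rewrite mulmxBr mulmx1; apply/rowP => j; rewrite !mxE.
  have [_ {1}->] := bP j; rewrite -sumrB big1 // => k _.
  by rewrite !mxE mulrC subrr.
(* Congruence modulo J, carried through the Leibniz expansions of the determinants of 1 and 1 -
   B. *)
pose Rel u v := [/\ OK u, OK v & J (u - v)].
have RelM u v u' v' : Rel u v -> Rel u' v' -> Rel (u * u') (v * v').
  move=> [hu hv huv] [hu' hv' huv']; split; [exact: OKM|exact: OKM|].
  have -> : u * u' - v * v' = u' * (u - v) + v * (u' - v') by ring.
  by apply: fracD => //; exact: frac_mul.
have [_ _] : Rel (\det (1%:M : 'M[K]_n)) (\det M).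
  apply: big_ind2 => [|u v u' v' [hu hv huv] [hu' hv' huv']|s _].
  - by split; [exact: OK0|exact: OK0|rewrite subrr; exact: frac0].
  - split; [exact: OKD|exact: OKD|].
    by rewrite opprD addrACA; exact: fracD.
  - apply: (RelM).
      have sgn_int : OK ((-1) ^+ s) by apply: OKX; exact/OKN/OK1.
      by split=> //; rewrite subrr; exact: frac0.
    apply: big_ind2 => [|u v u' v'|i _].
    + by split; [exact: OK1|exact: OK1|rewrite subrr; exact: frac0].
    + exact: RelM.
    + rewrite !mxE; have Jb : J (b (s i) i) by case: (bP (s i)).
      split; first exact: OK_nat.
        by apply: OKB; [exact: OK_nat|exact: JOK].
      by rewrite opprB addrCA subrr addr0.
by rewrite M0 det1 subr0.
Qed.

Definition idpow I k := iter k (idmul I) OK.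

Lemma idpow_frac I k : frac I -> frac (idpow I k).
Proof. by move=> fI; elim: k => [|k IH]; [exact: frac_OK|exact: idmul_frac]. Qed.

Lemma idpowD I j k : frac I -> idmul (idpow I j) (idpow I k) = idpow I (j + k).
Proof.
move=> fI; elim: j => [|j IH]; first by apply: idmul_OK; exact: idpow_frac.
by rewrite addSn /= -IH idmulA.
Qed.

Definition frac_invertible :=
  forall I, frac I -> exists2 J, frac J & idmul I J = OK.

(* If the classes of the powers of I repeat then I ^ i = c I ^ (i + d + 1), and
   c I ^ (d + 1) is the unit ideal by the two determinant arguments above. *)
Lemma class_number_frac_invertible : class_number K <> 0%N -> frac_invertible.
Proof.
rewrite /class_number => h0 I fI.
set S := [set ideal_class I | I in _] in h0.
(* An infinite set has an empty [fset_set], which would give the excluded value 0. *)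
have finS : finite_set S.
  apply: contrapT => nfin; apply: h0.
  by rewrite /fset_set; case: pselect => // _; rewrite cardfs0.
have [s sE] := (finite_seqP S).1 finS.
have In k : ideal_class (idpow I k) \in s.
  have : S (ideal_class (idpow I k)) by exists (idpow I k) => //; exact: idpow_frac.
  by rewrite sE.
pose g k : 'I_(size s).+1 := inord (index (ideal_class (idpow I k)) s).
have [i [d]] := pigeonhole g.
move=> /(congr1 val); rewrite /= !inordK ?ltnS ?index_size // => gE.
have {gE}cE : ideal_class (idpow I i) = ideal_class (idpow I (i + d.+1)).
  by rewrite -(nth_index set0 (In i)) gE nth_index.
have [c c0 cP] : ideal_class (idpow I (i + d.+1)) (idpow I i).
  by rewrite -cE; exists 1; [exact: oner_neq0|exact: scale_set1].
pose J := scale_set c (idpow I d.+1).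
have fJ : frac J by apply: frac_scale => //; exact: idpow_frac.
have fIi := idpow_frac i fI.
have JI : idmul J (idpow I i) = idpow I i by rewrite idmul_scale idpowD // addnC.
have JOK : J `<=` OK by apply: frac_mulr_sub_OK fIi fJ _; rewrite JI.
have J1 := frac_mulr_eq_1 fIi fJ JOK JI.
exists (scale_set c (idpow I d)); first by apply: frac_scale => //; exact: idpow_frac.
rewrite idmulC idmul_scale idmulC; apply/seteqP; split=> [|z z_int]; first exact: JOK.
by rewrite -[z]mulr1; exact: (frac_mul fJ).
Qed.

End Invertibility.

(** * Maximal ideals and their valuations *)

Section MaximalIdeals.
Variable K : fieldExtType rat.
Local Notation OK := (@ring_of_integers K).
Local Notation frac := (@is_fractional_ideal K).
Implicit Types I J P : set K.

(** Maximality is expressed by its consequence for the residue ring: an integral element outside [P]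
    is invertible modulo [P]. The requirement [frac P] excludes the zero ideal. *)
Definition max_ideal P := [/\ frac P, P `<=` OK, ~ P 1 &
  forall b, OK b -> ~ P b -> exists2 b', OK b' & P (1 - b * b')].

Lemma max_ideal_prime P a b : max_ideal P -> OK a -> OK b ->
  P (a * b) -> ~ P a -> P b.
Proof.
move=> [fP PO _ Pmax] a_int b_int Pab /(Pmax a a_int)[c c_int Pc].
have -> : b = b * (1 - a * c) + c * (a * b) by ring.
by apply: fracD => //; exact: frac_mul.
Qed.

Lemma is_index_sub (A A' B : set K) N : is_subgroup B -> A' `<=` A ->
  is_index A B N -> exists M, is_index A' B M.
Proof.
move=> sB AA' [T [f [[_ fcov _] _]]].
have /choice[cl clP] x : exists t : option T,
    A x -> exists2 i, t = Some i & B (x - f i).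
  have [/fcov[i Bi]|nA] := pselect (A x); last by exists None.
  by exists (Some i) => _; exists i.
apply: (is_index_of_classes (cl := cl)) => // x y /AA' /clP[i -> Bi] /AA' /clP[j -> Bj] [ij].
have -> : x - y = (x - f i) - (y - f j) by rewrite ij; ring.
exact: (proj2 sB).
Qed.

Lemma is_index1 (A B : set K) : is_subgroup A -> is_subgroup B ->
  is_index A B 1 -> A `<=` B.
Proof.
move=> sA sB [T [f [[_ fcov _] T1]]] x Ax.
have [i Bi] := fcov x Ax; have [j Bj] := fcov 0 (proj1 sA).
have /fintype_le1P/(_ j i) ij : (#|T| <= 1)%N by rewrite T1.
have {}ij : i = j by exact: ij.
have -> : x = (x - f i) - (0 - f j) by rewrite ij; ring.
exact: (proj2 sB).
Qed.

(** Multiplicativity of the index, with a second factor that is 1 only if the ideals coincide. The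
    index thus serves as the measure for inductions on ideals. *)
Lemma is_index_proper_lt I J N M : frac I -> frac J -> J `<=` I -> I `<=` OK ->
  ~ I `<=` J -> is_index OK J N -> is_index OK I M -> (M < N)%N.
Proof.
move=> fI fJ JI IO nIJ JN IM.
have [[sI sJ] sO] := (frac_subgroup fI, frac_subgroup fJ, @OK_subgroup K).
have [L IL] := is_index_sub sJ IO JN.
have NE := is_index_uniq sJ JN (is_index_trans sO sI sJ IO JI IM IL).
have M0 := is_index_gt0 sO IM; have L0 := is_index_gt0 sI IL.
rewrite NE -{1}[M]muln1 ltn_pmul2l // ltn_neqAle L0 andbT eq_sym.
by apply/eqP => L1; apply: nIJ; apply: is_index1 => //; rewrite -L1.
Qed.

(** Induction on the index: if some b outside I has no inverse modulo I, then I + b O_K is still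
    proper and has a smaller index. *)
Lemma exists_max_ideal I : frac I -> I `<=` OK -> ~ I 1 ->
  exists2 P, max_ideal P & I `<=` P.
Proof.
move=> fI IO; have [N] := frac_index_ex fI IO.
elim/ltn_ind: N I fI IO => N IH I fI IO IN nI1.
have [Imax|] := pselect (forall b, OK b -> ~ I b -> exists2 b', OK b' & I (1 - b * b')).
  by exists I.
move=> /existsNP[b /not_implyP[b_int /not_implyP[nIb nb']]].
pose I' := [set z | exists x y, [/\ I x, OK y & z = x + b * y]].
have II' : I `<=` I' by move=> x Ix; exists x, 0; split; rewrite ?mulr0 ?addr0 //; exact: OK0.
have I'b : I' b by exists 0, 1; split; rewrite ?mulr1 ?add0r //; [exact: frac0|exact: OK1].
have I'O : I' `<=` OK.
  by move=> _ [x [y [Ix y_int ->]]]; apply: OKD; [exact: IO|exact: OKM].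
have fI' : frac I'.
  apply: (frac_sub_int (@frac_OK K)) => //.
  - by apply: II'; exact: frac0.
  - by have [[x Ix x0] _ _ _] := fI; exists x => //; exact: II'.
  - move=> _ _ [x [y [Ix y_int ->]]] [z [w [Iz w_int ->]]].
    by exists (x + z), (y + w); split; [exact: fracD|exact: OKD|ring].
  - move=> a _ a_int [x [y [Ix y_int ->]]].
    by exists (a * x), (a * y); split; [exact: frac_mul|exact: OKM|ring].
have [M I'M] := frac_index_ex fI' I'O.
have MN : (M < N)%N.
  by apply: (is_index_proper_lt fI' fI II' I'O) => // h; exact/nIb/h.
have [|P Pmax I'P] := IH M MN I' fI' I'O I'M; last by exists P => // x /II'/I'P.
move=> [x [y [Ix y_int e1]]]; apply: nb'; exists y => //.
by rewrite e1 addrK.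
Qed.

Hypothesis invK : frac_invertible K.

(** Let J be the inverse of I = O_K + y O_K. As I contains 1 and y, both J and y J consist of
    integers, and 1 in I J decomposes as b + y c with b and c in J. *)
Lemma pruefer (y : K) : exists b c,
  [/\ OK b, OK c, OK (b * y), OK (c * y) & b + y * c = 1].
Proof.
pose I := [set z : K | exists u v, [/\ OK u, OK v & z = u + y * v]].
have I1 : I 1 by exists 1, 0; split; rewrite ?mulr0 ?addr0 //; [exact: OK1|exact: OK0].
have Iy : I y by exists 0, 1; split; rewrite ?mulr1 ?add0r //; [exact: OK0|exact: OK1].
have fI : frac I.
  split.
  - by exists 1 => //; exact: oner_neq0.
  - move=> _ _ [u [v [hu hv ->]]] [u' [v' [hu' hv' ->]]].
    by exists (u + u'), (v + v'); split; [exact: OKD|exact: OKD|ring].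
  - move=> a _ ha [u [v [hu hv ->]]].
    by exists (a * u), (a * v); split; [exact: OKM|exact: OKM|ring].
  - have [a a0 ay] := OK_frac y; exists a%:R; split.
    + exact: OK_nat.
    + exact: natK_neq0.
    + move=> _ [u [v [hu hv ->]]].
      have -> : a%:R * (u + y * v) = a%:R * u + (a%:R * y) * v by ring.
      by apply: OKD; apply: OKM => //; exact: OK_nat.
have [J fJ IJ] := invK fI.
have JO t : J t -> OK t /\ OK (t * y).
  move=> Jt; split; last by rewrite -IJ mulrC; exact: idmul_mem.
  by rewrite -[t]mul1r -IJ; exact: idmul_mem.
have : idmul I J 1 by rewrite IJ; exact: OK1.
suff h : idmul I J `<=` [set z | exists b c, [/\ J b, J c & z = b + y * c]].
  move=> /h[b [c [/JO[hb hby] /JO[hc hcy] e1]]].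
  by exists b, c; split.
apply: idmul_ind.
- by exists 0, 0; split; rewrite ?mulr0 ?addr0 //; exact: frac0.
- move=> _ _ [u [v [hu hv ->]]] [u' [v' [hu' hv' ->]]].
  by exists (u + u'), (v + v'); split; [exact: fracD|exact: fracD|ring].
- move=> _ t [u [v [hu hv ->]]] Jt.
  by exists (u * t), (v * t); split; [exact: frac_mul|exact: frac_mul|ring].
Qed.

Section Local.
Variable P : set K.
Hypothesis Pmax : max_ideal P.

Let fP : frac P. Proof. by case: Pmax. Qed.
Let PO : P `<=` OK. Proof. by case: Pmax. Qed.
Let P1 : ~ P 1. Proof. by case: Pmax. Qed.

Lemma max_ideal_notM a b : OK a -> OK b -> ~ P a -> ~ P b -> ~ P (a * b).
Proof. by move=> ha hb na nb /(max_ideal_prime Pmax ha hb)/(_ na). Qed.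

(** The localization of O_K at P as a subset of K, written without division; [lunit] below is its
    group of units. *)
Definition loc (y : K) := exists a b, [/\ OK a, OK b, ~ P b & y * b = a].

Definition lunit (y : K) := exists a b, [/\ OK a, OK b, ~ P a, ~ P b & y * b = a].

Lemma lunit_loc y : lunit y -> loc y.
Proof. by move=> [a [b [ha hb _ nb e]]]; exists a, b. Qed.

Lemma OK_loc y : OK y -> loc y.
Proof. by move=> hy; exists y, 1; split; rewrite ?mulr1 //; exact: OK1. Qed.

Lemma locM x y : loc x -> loc y -> loc (x * y).
Proof.
move=> [a [b [ha hb nb e]]] [a' [b' [ha' hb' nb' e']]].
exists (a * a'), (b * b'); split; [exact: OKM|exact: OKM| |].
  exact: max_ideal_notM.
by rewrite -e -e'; ring.
Qed.

Lemma locX x k : loc x -> loc (x ^+ k).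
Proof.
move=> lx; elim: k => [|k IH]; first by rewrite expr0; exact/OK_loc/OK1.
by rewrite exprS; exact: locM.
Qed.

Lemma locD x y : loc x -> loc y -> loc (x + y).
Proof.
move=> [a [b [ha hb nb e]]] [a' [b' [ha' hb' nb' e']]].
exists (a * b' + a' * b), (b * b'); split.
- by apply: OKD; exact: OKM.
- exact: OKM.
- exact: max_ideal_notM.
- by rewrite -e -e'; ring.
Qed.

Lemma notP_neq0 a : ~ P a -> a != 0.
Proof. by move=> na; apply/eqP => a0; apply: na; rewrite a0; exact: frac0. Qed.

Lemma lunit_neq0 x : lunit x -> x != 0.
Proof.
move=> [a [b [ha hb na nb e]]]; apply: contraTneq (notP_neq0 na) => x0.
by rewrite -e x0 mul0r eqxx.
Qed.

Lemma lunitM x y : lunit x -> lunit y -> lunit (x * y).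
Proof.
move=> [a [b [ha hb na nb e]]] [a' [b' [ha' hb' na' nb' e']]].
exists (a * a'), (b * b'); split; [exact: OKM|exact: OKM| | |].
- exact: max_ideal_notM.
- exact: max_ideal_notM.
- by rewrite -e -e'; ring.
Qed.

Lemma lunitV x : lunit x -> lunit x^-1.
Proof.
move=> xu; have x0 := lunit_neq0 xu; move: xu => [a [b [ha hb na nb e]]].
by exists b, a; split=> //; rewrite -e mulKf.
Qed.

Lemma loc_lunit_or_P y : loc y -> lunit y \/
  exists a b, [/\ P a, OK b, ~ P b & y * b = a].
Proof.
move=> [a [b [ha hb nb e]]]; have [Pa|nPa] := pselect (P a).
  by right; exists a, b.
by left; exists a, b.
Qed.

(** Otherwise P P = P, and Nakayama's argument would put 1 in P. *)
Lemma uniformizer_ex : exists2 p, P p & ~ idmul P P p.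
Proof.
apply: contrapT => no; apply: P1; apply: (frac_mulr_eq_1 fP fP PO).
apply/seteqP; split; first exact: idmul_sub.
by move=> x Px; apply: contrapT => nx; apply: no; exists x.
Qed.

Section Uniformizer.
Variable p : K.
Hypotheses (Pp : P p) (nPPp : ~ idmul P P p).

Let p0 : p != 0.
Proof. by apply/eqP => p0; apply: nPPp; rewrite p0; exact: idmul0. Qed.

(* [p P^-1] is an integral ideal not contained in [P], so some [t] in [P^-1]
   makes [p t] a unit of the local ring. *)
Lemma P_loc_dvd x : P x -> exists2 w, loc w & x = p * w.
Proof.
move=> Px; have [Q fQ PQ] := invK fP.
have [t [Qt npt]] : exists t, Q t /\ ~ P (p * t).
  apply: contrapT => no; apply: nPPp.
  have pQ t : Q t -> P (p * t).
    by move=> Qt; apply: contrapT => nt; apply: no; exists t.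
  rewrite -[p]mulr1; have : idmul P Q 1 by rewrite PQ; exact: OK1.
  suff h : idmul P Q `<=` [set z | idmul P P (p * z)] by move=> /h.
  apply: idmul_ind => [|u v|u v Pu Qv] /=; first by rewrite mulr0; exact: idmul0.
    by rewrite mulrDr; exact: idmulD.
  by rewrite mulrCA; apply: idmul_mem => //; exact: pQ.
have PtO z : P z -> OK (z * t) by move=> Pz; rewrite -PQ; exact: idmul_mem.
have pt0 := notP_neq0 npt.
exists (x / p); last by rewrite mulrC divfK.
exists (x * t), (p * t); split; rewrite ?PtO //; [exact: PtO|exact: PtO|].
by rewrite mulrA divfK.
Qed.

Lemma loc_dvd y : loc y -> lunit y \/ exists2 w, loc w & y = p * w.
Proof.
move=> /loc_lunit_or_P[|[a [b [Pa hb nb e]]]]; first by left.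
right; have [w lw wE] := P_loc_dvd Pa; exists (w / b).
  apply: locM => //; exists 1, b; split=> //; first exact: OK1.
  by rewrite mulVf // notP_neq0.
by rewrite mulrA -wE -e mulfK // notP_neq0.
Qed.

Lemma lunit_not_dvd w : loc w -> ~ lunit (p * w).
Proof.
move=> [a [b [ha hb nb e]]] [c [d [hc hd nc nd e']]].
have : P (c * b).
  have -> : c * b = p * (a * d) by rewrite -e' -e; ring.
  by apply: fracMr => //; exact: OKM.
exact: max_ideal_notM.
Qed.

(** If division by p never stopped, every power of p would divide x locally. But powers of p repeat
    modulo x O_K, so that x divides p ^ i (1 - p ^ (d + 1)); as p ^ (i + 1) divides x, p would
    divide the unit 1 - p ^ (d + 1). *)
Lemma ord_nat_ex x : OK x -> x != 0 -> exists k u, lunit u /\ x = p ^+ k * u.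
Proof.
move=> x_int x0; apply: contrapT => no.
have dvd k : exists2 w, loc w & x = p ^+ k * w.
  elim: k => [|k [w lw wE]]; first by exists x; [exact: OK_loc|rewrite mul1r].
  have [wu|[z lz zE]] := loc_dvd lw; first by exfalso; apply: no; exists k, w.
  by exists z => //; rewrite exprSr -mulrA -zE.
have [N [T [f [[_ fcov _] _]]]] := OK_index_ex x_int x0.
have /choice[g gP] i : exists t, scale_set x OK (p ^+ i - f t).
  by apply: fcov; apply: OKX; exact: PO.
have [i [d gid]] := pigeonhole g.
have [z z_int zE] : scale_set x OK (p ^+ i - p ^+ (i + d.+1)).
  have -> : p ^+ i - p ^+ (i + d.+1) =
    (p ^+ i - f (g i)) - (p ^+ (i + d.+1) - f (g (i + d.+1)%N)) by rewrite gid; ring.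
  exact: (proj2 (scale_subgroup x (@OK_subgroup K))).
have Ppd : P (p ^+ d.+1) by rewrite exprS; apply: fracMr => //; apply: OKX; exact: PO.
have u1 : lunit (1 - p ^+ d.+1).
  exists (1 - p ^+ d.+1), 1; split; rewrite ?mulr1 //; do ?exact: OK1.
    by apply: OKB; [exact: OK1|exact: PO].
  by move=> h; apply: P1; rewrite -[1](subrK (p ^+ d.+1)); exact: fracD.
have [w lw wE] := dvd i.+1.
apply: (@lunit_not_dvd (w * z)); first by apply: locM => //; exact: OK_loc.
suff -> : p * (w * z) = 1 - p ^+ d.+1 by [].
apply: (@mulfI _ (p ^+ i)); first exact: expf_neq0.
by rewrite mulrBr mulr1 -exprD -zE wE exprSr; ring.
Qed.

(** The hypothesis on [x] comes after the quantifier so that [choice] yields a total function,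
    arbitrary at 0. *)
Lemma ord_ex x : exists k : int, x != 0 -> exists2 u, lunit u & x = p ^ k * u.
Proof.
have [->|x0] := eqVneq x 0; first by exists 0.
have [a a0 ax] := OK_frac x; have aK := natK_neq0 K a0.
have [i [u [uu uE]]] := ord_nat_ex (OK_nat K a) aK.
have [j [w [wu wE]]] := ord_nat_ex ax (mulf_neq0 aK x0).
exists (j%:Z - i%:Z) => _; exists (w / u); first by apply: lunitM => //; exact: lunitV.
have u0 := lunit_neq0 uu.
apply: (mulfI aK); rewrite wE uE expfzDr // -!exprnN -!exprnP.
by field; rewrite u0 expf_neq0.
Qed.

Lemma ord_uniq (k l : int) u w : lunit u -> lunit w -> p ^ k * u = p ^ l * w -> k = l.
Proof.
wlog lkl : k l u w / k <= l.
  move=> H uu wu e; have [kl|/ltW lk] := leP k l; first exact: (H _ _ u w).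
  by apply/esym; exact: (H _ _ w u).
move=> uu wu e; apply/eqP/negPn/negP => kl.
have [d dE] : exists d : nat, l = k + d.+1%:Z.
  exists (`|l - k|.-1)%N; have : k < l by rewrite lt_neqAle kl.
  by move: lkl kl; clear; lia.
have {}e : p ^+ d.+1 * w = u.
  apply: (@mulfI _ (p ^ k)); first by rewrite expfz_neq0.
  by rewrite e dE expfzDr // -exprnP mulrA.
apply: (@lunit_not_dvd (p ^+ d * w)).
  by apply: locM; [apply: locX; exact/OK_loc/PO|exact: lunit_loc].
by rewrite mulrA -exprS e.
Qed.

End Uniformizer.

(** The P-adic valuation. Its value at 0 is arbitrary, which is why each clause excludes 0. *)
Lemma ord_exists : exists ord : K -> int,
  [/\ forall x y, x != 0 -> y != 0 -> ord (x * y) = ord x + ord y,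
      forall x y, x != 0 -> y != 0 -> x + y != 0 ->
        Num.min (ord x) (ord y) <= ord (x + y),
      forall x, x != 0 -> 0 <= ord x <-> loc x,
      forall x, OK x -> x != 0 -> 0 < ord x <-> P x
    & exists2 x, x != 0 & ord x = 1].
Proof.
have [p Pp nPP] := uniformizer_ex.
have p0 : p != 0 by apply/eqP => p0; apply: nPP; rewrite p0; exact: idmul0.
have /choice[ord ordP] := ord_ex Pp nPP.
have ordE x k u : lunit u -> x = p ^ k * u -> ord x = k.
  move=> uu xE; have x0 : x != 0 by rewrite xE mulf_neq0 ?expfz_neq0 // lunit_neq0.
  by have [w wu wE] := ordP x x0; apply: (ord_uniq Pp nPP wu uu); rewrite -wE.
have lu1 : lunit 1 by exists 1, 1; split; rewrite ?mulr1 //; exact: OK1.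
have ordM x y : x != 0 -> y != 0 -> ord (x * y) = ord x + ord y.
  move=> /ordP[u uu uE] /ordP[w wu wE].
  apply: (ordE _ _ (u * w)); first exact: lunitM.
  by rewrite {1}uE {1}wE expfzDr //; ring.
have ordX k : ord (p ^ k) = k by apply: (ordE _ _ 1); rewrite ?mulr1.
have ord_loc x : x != 0 -> 0 <= ord x <-> loc x.
  move=> x0; have [u uu uE] := ordP x x0; split.
    case: (ord x) uE => // k uE _; rewrite uE -exprnP.
    by apply: locM; [apply: locX; exact/OK_loc/PO|exact: lunit_loc].
  move=> lx; rewrite leNgt; apply/negP => ox.
  have [d dE] : exists d : nat, - ord x = d.+1%:Z.
    by exists (`|ord x|.-1)%N; move: ox; clear; lia.
  apply: (@lunit_not_dvd p Pp (p ^+ d * x)).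
    by apply: locM => //; apply: locX; exact/OK_loc/PO.
  suff -> : p * (p ^+ d * x) = u by [].
  rewrite mulrA -exprS exprnP -dE {2}uE mulrA -expfzDr // addNr expr0z.
  exact: mul1r.
exists ord; split=> //.
- move=> x y; wlog xy : x y / ord x <= ord y.
    move=> H x0 y0 xy0; have [xy|/ltW yx] := leP (ord x) (ord y).
      by have := H x y xy x0 y0 xy0; rewrite min_l.
    rewrite addrC in xy0 *; have := H y x yx y0 x0 xy0.
    by rewrite min_l.
  move=> x0 y0 xy0; rewrite min_l //.
  (* Multiplying by this power brings the smaller valuation to 0; the inequality becomes closure of
     the local ring under addition. *)
  have q0 : p ^ (- ord x) != 0 by rewrite expfz_neq0.
  have h z : z != 0 -> ord (p ^ (- ord x) * z) = ord z - ord x.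
    by move=> z0; rewrite ordM // ordX addrC.
  have : 0 <= ord (p ^ (- ord x) * (x + y)).
    apply/ord_loc; first exact: mulf_neq0.
    rewrite mulrDr; apply: locD; apply/ord_loc; rewrite ?mulf_neq0 // h //.
      by rewrite subrr.
    by rewrite subr_ge0.
  by rewrite h // subr_ge0.
- move=> x x_int x0; have ox : 0 <= ord x by apply/ord_loc => //; exact: OK_loc.
  split=> [lt0|Px].
    apply: contrapT => nPx.
    suff xE : ord x = 0 by rewrite xE in lt0.
    apply: (ordE _ _ x); last by rewrite expr0z mul1r.
    by exists x, 1; split; rewrite ?mulr1 //; exact: OK1.
  have [w lw wE] := P_loc_dvd Pp nPP Px.
  have w0 : w != 0 by apply: contraNneq x0 => w0; rewrite wE w0 mulr0.
  rewrite wE ordM // -[p]expr1z ordX.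
  by have := (ord_loc w w0).2 lw; clear; lia.
- by exists p => //; rewrite -[p]expr1z ordX.
Qed.

End Local.
End MaximalIdeals.

(** * Completions and discrete valuations *)

Section CompletionAbs.
Variables (R : realType) (K : fieldType) (v : absval R K).
Hypothesis ultra : forall x y : K, v (x + y) <= Num.max (v x) (v y).
Local Notation Kv := (completion v).
Local Notation Ov := (completion_int v).
Local Notation emb := (to_completion v).
Local Notation qpi := (\pi_({ideal_quot (@null_ideal R K v)})%qT).
Local Notation cabs := (@completion_abs R K v).
Implicit Types (a b : Kv) (x y : cauchy_seq v).

Lemma absval_lt_eq (s t : K) : v (s - t) < v t -> v s = v t.
Proof.
move=> st; apply/eqP; rewrite eq_le; apply/andP; split.
  by have := ultra (s - t) t; rewrite subrK max_r // ltW.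
rewrite leNgt; apply/negP => lt.
have := ultra s (t - s); rewrite addrC subrK absvalB leNgt => /negP; apply.
by rewrite gt_max lt.
Qed.

(** A sequence that is not null has eventually constant absolute values, by the ultrametric
    inequality. *)
Lemma cseq_abs_cvg x : exists L : R, (v \o cseq x) @ \oo --> L.
Proof.
have [nx|nx] := pselect (null_for v (cseq x)).
  exists 0; apply/cvgrPdist_lt => e e0; have [N hN] := nx e e0.
  near=> i; rewrite sub0r normrN ger0_norm ?absval_ge0 // hN //.
  by near: i; exact: nbhs_infty_ge.
move: nx => /existsNP[e /not_implyP[e0 /forallNP nx]].
have [N hN] := cauchy_seqP x e0.
have [i0 [Ni0 vi0]] : exists i0, (N <= i0)%N /\ e <= v (cseq x i0).
  have /existsNP[i0 /not_implyP[Ni0 /negP]] := nx N.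
  by rewrite -leNgt => ?; exists i0.
exists (v (cseq x i0)); apply: cvg_near_cst; near=> i.
apply: absval_lt_eq; apply: lt_le_trans vi0; apply: hN => //.
by near: i; exact: nbhs_infty_ge.
Unshelve. all: by end_near. Qed.

Lemma pi_null x y : qpi x = qpi y -> null_for v (fun i => cseq x i - cseq y i).
Proof. by move=> /eqP; rewrite -Quotient.idealrBE => /asboolP. Qed.

(** Frees [completion_abs] from the representative chosen by [repr]: two representatives differ by a
    null sequence, which bounds the difference of their absolute values. *)
Lemma completion_absE x (L : R) : (v \o cseq x) @ \oo --> L -> cabs (qpi x) = L.
Proof.
move=> xL; apply: cvg_lim => //.
have nl : null_for v (fun i => cseq x i - cseq (repr (qpi x)) i).
  by apply: pi_null; rewrite reprK.
apply/cvgrPdist_lt => e e0; have e2 : 0 < e / 2 by rewrite divr_gt0.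
have [N hN] := nl _ e2.
have /cvgrPdist_lt/(_ _ e2) xLe := xL.
near=> i.
have h1 : `|L - v (cseq x i)| < e / 2 by near: i.
have h2 : v (cseq x i - cseq (repr (qpi x)) i) < e / 2.
  by apply: hN; near: i; exact: nbhs_infty_ge.
set s := cseq x i in h1 h2 *; set t := cseq _ i in h2 *.
rewrite [L - _](_ : _ = (L - v s) + (v s - v t)); last by rewrite addrA subrK.
rewrite (splitr e) (le_lt_trans (ler_normD _ _)) // ltrD //.
apply: le_lt_trans h2; rewrite ler_norml; apply/andP; split.
  by rewrite lerNl opprB lerBlDr absvalB -{1}[t](subrK s) absvalD.
by rewrite lerBlDr -{1}[s](subrK t) absvalD.
Unshelve. all: by end_near. Qed.

Lemma completion_abs_emb (s : K) : cabs (emb s) = v s.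
Proof.
apply: (@completion_absE (CauchySeq (cst_cauchy v s))).
exact: (cvg_cst (v s)).
Qed.

Lemma completion_abs_ge0 a : 0 <= cabs a.
Proof.
elim/quotW: a => x; have [L xL] := cseq_abs_cvg x; rewrite (completion_absE xL).
apply: (ler_cvg_to (cvg_cst 0) xL); apply: nearW => i; exact: absval_ge0.
Qed.

Lemma completion_absM a b : cabs (a * b) = cabs a * cabs b.
Proof.
elim/quotW: a => x; elim/quotW: b => y.
have [L xL] := cseq_abs_cvg x; have [M yM] := cseq_abs_cvg y.
rewrite (completion_absE xL) (completion_absE yM).
rewrite [X in cabs X](_ : _ = qpi (x * y)); last by rewrite piE.
apply: completion_absE.
rewrite (_ : v \o _ = (v \o cseq x) \* (v \o cseq y)); first exact: cvgM.
by apply/funext => i /=; rewrite -absvalM.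
Qed.

Lemma completion_absD a b : cabs (a + b) <= Num.max (cabs a) (cabs b).
Proof.
elim/quotW: a => x; elim/quotW: b => y.
have [L xL] := cseq_abs_cvg x; have [M yM] := cseq_abs_cvg y.
rewrite (completion_absE xL) (completion_absE yM).
rewrite [X in cabs X](_ : _ = qpi (x + y)); last by rewrite piE.
have [Z xyZ] := cseq_abs_cvg (x + y); rewrite (completion_absE xyZ).
apply/ler_addgt0Pr => e e0.
apply: (ler_cvg_to xyZ (cvg_cst (Num.max L M + e))); near=> i.
apply: le_trans (ultra _ _) _; rewrite ge_max; apply/andP; split.
  apply: (@le_trans _ _ (L + e)); last by rewrite lerD2r le_max lexx.
  by near: i; apply: (cvgr_le _ xL); rewrite ltrDl.
apply: (@le_trans _ _ (M + e)); last by rewrite lerD2r le_max lexx orbT.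
by near: i; apply: (cvgr_le _ yM); rewrite ltrDl.
Unshelve. all: by end_near. Qed.

Lemma completion_abs0 : cabs 0 = 0.
Proof.
have := completion_abs_emb 0; rewrite absval0 => <-; congr cabs.
by rewrite /to_completion; apply/esym/quot_eq0; apply/asboolP => e e0; exists 0%N => i _ /=; rewrite absval0.
Qed.

Lemma completion_abs_eq0 a : (cabs a == 0) = (a == 0).
Proof.
apply/eqP/eqP => [|->]; last exact: completion_abs0.
elim/quotW: a => x; have [L xL] := cseq_abs_cvg x; rewrite (completion_absE xL) => L0.
apply: quot_eq0; apply/asboolP => e e0.
have /cvgrPdist_lt/(_ _ e0)[N _ hN] := xL; exists N => i Ni.
by have := hN i Ni; rewrite /= L0 sub0r normrN ger0_norm ?absval_ge0.
Qed.

Lemma completion_dense a (e : R) : 0 < e -> exists s, cabs (a - emb s) <= e.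
Proof.
elim/quotW: a => x e0; have [N hN] := cauchy_seqP x e0.
exists (cseq x N); pose c := CauchySeq (cst_cauchy v (cseq x N)).
rewrite [X in cabs X](_ : _ = qpi (x - c)); last by rewrite piE.
have [L xL] := cseq_abs_cvg (x - c); rewrite (completion_absE xL).
apply: (ler_cvg_to xL (cvg_cst e)); near=> i.
apply/ltW/hN => //; near: i; exact: nbhs_infty_ge.
Unshelve. all: by end_near. Qed.

Lemma to_completionB s t : emb (s - t) = emb s - emb t.
Proof.
rewrite /to_completion [RHS](_ : _ = qpi (CauchySeq (cst_cauchy v s) - CauchySeq (cst_cauchy v t))).
  by congr (qpi _); apply/val_inj.
by rewrite piE.
Qed.

Lemma to_completionM s t : emb (s * t) = emb s * emb t.
Proof.
rewrite /to_completion [RHS](_ : _ = qpi (CauchySeq (cst_cauchy v s) * CauchySeq (cst_cauchy v t))).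
  by congr (qpi _); apply/val_inj.
by rewrite piE.
Qed.

Lemma to_completion1 : emb 1 = 1.
Proof.
rewrite /to_completion [RHS](_ : _ = qpi 1); last by rewrite piE.
by congr (qpi _); apply/val_inj.
Qed.

HB.instance Definition _ :=
  GRing.isZmodMorphism.Build K Kv (to_completion v) to_completionB.
HB.instance Definition _ :=
  GRing.isMonoidMorphism.Build K Kv (to_completion v) (conj to_completion1 to_completionM).

Lemma completion_absN a : cabs (- a) = cabs a.
Proof.
have -> : - a = emb (-1) * a by rewrite rmorphN1 mulN1r.
by rewrite completion_absM completion_abs_emb absvalN absval1 mul1r.
Qed.

Lemma completion_abs_lt_eq a b : cabs (a - b) < cabs b -> cabs a = cabs b.
Proof.
move=> ab; apply/eqP; rewrite eq_le; apply/andP; split.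
  by have := completion_absD (a - b) b; rewrite subrK max_r // ltW.
rewrite leNgt; apply/negP => lt.
have := completion_absD a (b - a); rewrite addrC subrK -[b - a]opprB completion_absN.
by rewrite leNgt => /negP; apply; rewrite gt_max lt.
Qed.

End CompletionAbs.

(** * Residue rings of the completed valuation ring *)

Section DiscreteValuation.
Variables (R : realType) (K : fieldExtType rat).
Local Notation OK := (@ring_of_integers K).
Local Notation frac := (@is_fractional_ideal K).
Local Notation emb := (to_completion _).
Local Notation cabs := (@completion_abs R K _).

(** Stated for an absolute value, not for a place, so as to serve twice: for a given place, and for
    the absolute value built from a maximal ideal, whose normalization is still to be proved. [p] is
    a uniformizer and [N] the cardinality of the residue field. *)
Record dvr_data (v : absval R K) (P : set K) (p : K) (N : nat) : Prop := DvrData {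
  dvr_ultra : forall x y : K, v (x + y) <= Num.max (v x) (v y);
  dvr_max : max_ideal P;
  dvr_index : is_index OK P N;
  dvr_int : forall x, OK x -> v x <= 1;
  dvr_ideal : forall x, OK x -> v x < 1 <-> P x;
  dvr_p0 : p != 0;
  dvr_p1 : v p < 1;
  dvr_unif : forall y, v y < 1 -> v y <= v p;
  dvr_loc : forall y, v y <= 1 -> exists a b, [/\ OK a, OK b, v b = 1 & y * b = a] }.

Section Data.
Variables (v : absval R K) (P : set K) (p : K) (N : nat).
Hypothesis D : dvr_data v P p N.
Local Notation Ov := (completion_int v).

Let ultra := dvr_ultra D.

Let vp0 : 0 < v p.
Proof. by rewrite lt_def absval_ge0 absval_eq0 (dvr_p0 D). Qed.

Lemma absvalX (w : absval R K) x k : w (x ^+ k) = w x ^+ k.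
Proof. by elim: k => [|k IH]; rewrite ?expr0 ?absval1 // !exprS absvalM IH. Qed.

(** Let j + 1 be the least exponent with v p ^ (j + 1) < v y. If v y were less than v p ^ j, then y
    / p ^ j would have absolute value below 1, hence at most v p, against the choice of j. *)
Lemma dvr_abs_pow y : y != 0 -> v y <= 1 -> exists k : nat, v y = v p ^+ k.
Proof.
move=> y0 vy1; have vy0 : 0 < v y by rewrite lt_def absval_ge0 absval_eq0 y0.
have ex : exists k, v p ^+ k < v y.
  have : (fun k => v p ^+ k) @ \oo --> 0.
    by apply: cvg_expr; rewrite ger0_norm ?absval_ge0 // (dvr_p1 D).
  move=> /cvgr_lt/(_ _ vy0)[k _ hk]; exists k; exact: hk k (leqnn k).
case: (ex_minnP ex) => -[|j]; first by rewrite expr0 ltNge vy1.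
move=> jlt jmin; exists j.
have vyj : v y <= v p ^+ j.
  by rewrite leNgt; apply/negP => /jmin; rewrite ltnn.
have vpj0 : 0 < v p ^+ j by rewrite exprn_gt0.
have zE : v (y / p ^+ j) = v y / v p ^+ j by rewrite absvalM absvalV absvalX.
apply/eqP; rewrite eq_le vyj leNgt /=; apply/negP => lt.
have /(dvr_unif D) : v (y / p ^+ j) < 1 by rewrite zE ltr_pdivrMr // mul1r.
by rewrite zE ler_pdivrMr // -exprS leNgt jlt.
Qed.

Lemma scale_completion_int (c : completion v) : c != 0 ->
  scale_set c Ov = [set a | cabs a <= cabs c].
Proof.
move=> c0; have cc0 : 0 < cabs c.
  by rewrite lt_def completion_abs_ge0 // completion_abs_eq0 // c0.
apply/seteqP; split=> [_ [a a1 <-]|a ac] /=.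
  rewrite completion_absM //; apply: ler_piMr => //; exact: ltW.
exists (c^-1 * a); last by rewrite mulVKf.
rewrite /completion_int /= -(ler_pM2l cc0) -completion_absM // mulVKf //.
by rewrite mulr1.
Qed.

Lemma completion_int_subgroup : is_subgroup Ov.
Proof.
split; first by rewrite /completion_int /= completion_abs0.
move=> a b a1 b1; rewrite /completion_int /=.
apply: le_trans (completion_absD ultra _ _) _.
by rewrite ge_max a1 completion_absN.
Qed.

(** Representatives of O_K modulo P also represent O_v modulo p O_v. Approximate an element of O_v
    by y = c / b in K with b a unit, and replace 1 / b by an inverse b' of b modulo P: then y - c b'
    = y (1 - b b') is a multiple of p. *)
Lemma dvr_index_uniformizer : is_index Ov (scale_set (emb p : completion v) Ov) N.
Proof.
have [fP PO P1 Pmax] := dvr_max D.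
have [T [f [[f_int fcov finj] TN]]] := dvr_index D.
exists T, (fun t => emb (f t) : completion v); split=> //.
have p0 : emb p != 0 :> completion v by rewrite fmorph_eq0 (dvr_p0 D).
rewrite scale_completion_int // completion_abs_emb //.
split=> [t|a a1|s t] /=.
- by rewrite /completion_int /= completion_abs_emb // (dvr_int D).
- have [y ay] := completion_dense ultra a vp0.
  have vy : v y <= 1.
    rewrite -(completion_abs_emb v) -[emb y](subrK a).
    apply: le_trans (completion_absD ultra _ _) _; rewrite ge_max a1 andbT.
    rewrite -opprB completion_absN //; exact/(le_trans ay)/ltW/(dvr_p1 D).
  have [c [b [hc hb vb1 yb]]] := dvr_loc D vy.
  have nPb : ~ P b by move=> /(dvr_ideal D hb); rewrite vb1 ltxx.
  have [b' hb' Pb] := Pmax b hb nPb.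
  have hcb : OK (c * b') by exact: OKM.
  have [t Pt] := fcov _ hcb; exists t.
  have vP z : P z -> v z <= v p.
    by move=> Pz; apply: (dvr_unif D); apply/(dvr_ideal D) => //; exact: PO.
  have -> : a - emb (f t) = (a - emb y) +
      (emb (y * (1 - b * b')) + emb (c * b' - f t)).
    rewrite -rmorphD /= -addrA; congr (_ + _); rewrite addrC.
    rewrite -[X in emb X + _](_ : y - f t = _); last by rewrite -yb; ring.
    by rewrite rmorphB /= addrC addrA addNr add0r.
  apply: le_trans (completion_absD ultra _ _) _; rewrite ge_max ay /=.
  apply: le_trans (completion_absD ultra _ _) _; rewrite !completion_abs_emb //.
  rewrite ge_max (vP _ Pt) andbT absvalM; apply: le_trans (vP _ Pb).
  by rewrite ler_piMl // absval_ge0.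
- rewrite -rmorphB /= completion_abs_emb // => h; apply: finj.
  apply/(dvr_ideal D); first by apply: OKB; exact: f_int.
  exact: le_lt_trans h (dvr_p1 D).
Qed.

(** As a O_v depends only on |a|, it equals p ^ k O_v, and each step of the chain of the p ^ i O_v
    has index N. *)
Lemma dvr_index_scale (a : completion v) : a != 0 -> cabs a <= 1 ->
  exists k, cabs a = v p ^+ k /\ is_index Ov (scale_set a Ov) (N ^ k).
Proof.
move=> a0 a1; have ca0 : 0 < cabs a.
  by rewrite lt_def completion_abs_ge0 // completion_abs_eq0 // a0.
(* An error below |a| makes the ultrametric inequality give |a| = v y; half of |a| is such a
   bound. *)
have [y ay] := completion_dense ultra a (divr_gt0 ca0 (ltr0n R 2)).
have aE : cabs a = v y.
  rewrite -(completion_abs_emb v); apply/esym/(completion_abs_lt_eq ultra).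
  rewrite -opprB completion_absN //; apply: le_lt_trans ay _.
  by rewrite ltr_pdivrMr // ltr_pMr // ltr1n.
have y0 : y != 0 by rewrite -(absval_eq0 v) -aE gt_eqF.
have vy1 : v y <= 1 by rewrite -aE.
have [k kE] := dvr_abs_pow y0 vy1; exists k; split; first by rewrite aE.
have p0 : emb p != 0 :> completion v by rewrite fmorph_eq0 (dvr_p0 D).
have -> : scale_set a Ov = scale_set (emb p ^+ k) Ov.
  rewrite !scale_completion_int ?expf_neq0 // -rmorphXn /=.
  by rewrite completion_abs_emb // absvalX -kE aE.
clear -D p0 ultra vp0; elim: k => [|k IH].
  by rewrite expr0 scale_set1 expn0; apply: is_index_refl; exact: completion_int_subgroup.
have sub c : c != 0 -> is_subgroup (scale_set c Ov).
  by move=> c0; apply: scale_subgroup; exact: completion_int_subgroup.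
have mono (c d : completion v) : c != 0 -> d != 0 -> cabs c <= cabs d ->
    scale_set c Ov `<=` scale_set d Ov.
  by move=> c0 d0 cd; rewrite !scale_completion_int // => z /= /le_trans; apply.
rewrite expnSr exprSr.
apply: (is_index_trans _ _ _ _ _ IH); do ?[exact: completion_int_subgroup];
  do ?[by apply: sub; rewrite ?mulf_neq0 ?expf_neq0].
- rewrite -[X in _ `<=` X]scale_set1; apply: mono; rewrite ?expf_neq0 ?oner_neq0 //.
  rewrite -rmorphXn -[1](rmorph1 (to_completion v)) /= !completion_abs_emb //.
  by rewrite absvalX absval1 exprn_ile1 ?absval_ge0 // ltW // (dvr_p1 D).
- apply: mono; rewrite ?mulf_neq0 ?expf_neq0 // completion_absM // .
  rewrite ler_piMr ?completion_abs_ge0 // completion_abs_emb //.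
  by rewrite ltW // (dvr_p1 D).
- rewrite scale_setM; apply: is_index_scale; first exact: expf_neq0.
  exact: dvr_index_uniformizer.
Qed.

End Data.
End DiscreteValuation.

(** * Finite places and maximal ideals *)

Section Places.
Variables (R : realType) (K : fieldExtType rat).
Local Notation OK := (@ring_of_integers K).
Local Notation frac := (@is_fractional_ideal K).

Lemma ultra_sum (v : absval R K) (c : R) (I : Type) (r : seq I) (Q : pred I) (F : I -> K) :
  (forall x y : K, v (x + y) <= Num.max (v x) (v y)) -> 0 <= c ->
  (forall i, Q i -> v (F i) <= c) -> v (\sum_(i <- r | Q i) F i) <= c.
Proof.
move=> ultra c0 Fc; apply: (big_ind (fun x => v x <= c)) => //.
  by rewrite absval0.
by move=> x y xc yc; apply: le_trans (ultra _ _) _; rewrite ge_max xc.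
Qed.

(** Rational integers have absolute value at most 1, so that with v x > 1 the leading term of a
    monic integral equation would dominate all the others. *)
Lemma ultra_int_le1 (v : absval R K) x :
  (forall x y : K, v (x + y) <= Num.max (v x) (v y)) -> OK x -> v x <= 1.
Proof.
move=> ultra [q q_mon qx].
have vnat n : v n%:R <= 1.
  elim: n => [|n IH]; first by rewrite absval0.
  by rewrite -natr1; apply: le_trans (ultra _ _) _; rewrite ge_max IH absval1 /=.
have vint (z : int) : v z%:~R <= 1.
  case: z => n; first exact: vnat.
  by rewrite NegzE mulrNz absvalN; exact: vnat.
rewrite leNgt; apply/negP => x1.
set P := map_poly intr q in qx; set n := (size q).-1.
have lc : lead_coef q = 1 by apply/monicP.
have sq : size q = n.+1 by rewrite prednK // size_poly_gt0 monic_neq0.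
have qE : x ^+ n = - \sum_(i < n) (q`_i)%:~R * x ^+ i.
  apply/eqP; rewrite -addr_eq0; apply/eqP; rewrite -[RHS](rootP qx) horner_coef.
  rewrite size_map_poly_id0; last by rewrite lc oner_eq0.
  rewrite sq big_ord_recr /= addrC !coef_map /= -[q`_n]/(lead_coef q) lc mul1r.
  by congr (_ + _); apply: eq_bigr => i _; rewrite coef_map.
have x0 : 0 < v x by exact: lt_trans x1.
case: n qE {sq} => [|n] qE.
  by move/eqP: qE; rewrite big_ord0 expr0 oppr0 oner_eq0.
have : v (x ^+ n.+1) <= v x ^+ n.
  rewrite qE absvalN; apply: ultra_sum => // [|i _]; first by rewrite exprn_ge0 ?absval_ge0.
  rewrite absvalM absvalX -[leRHS]mul1r ler_pM ?absval_ge0 ?exprn_ge0 ?absval_ge0 ?vint //.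
  by rewrite ler_weXn2l ?ltW // -ltnS.
by rewrite absvalX exprS leNgt -{1}[v x ^+ n]mul1r ltr_pM2r ?exprn_gt0 // x1.
Qed.

(** By finite generation: the maximum is reached at a generator, since integral coefficients have
    absolute value at most 1. *)
Lemma frac_absmax (v : absval R K) I :
  (forall x y : K, v (x + y) <= Num.max (v x) (v y)) -> frac I ->
  exists2 x, I x & forall y, I y -> v y <= v x.
Proof.
move=> ultra fI; have [n [x xE]] := frac_fg fI.
have [[z Iz z0] _ _ _] := fI.
case: n x xE => [|n] x xE.
  move: Iz; rewrite xE => -[a _ zE]; move: z0; rewrite zE big_ord0 eqxx //.
have [i _ iP] := @arg_maxP _ _ _ ord0 predT (fun i => v (x i 0)) isT.
exists (x i 0); first by rewrite xE; exact: coord_ideal_gen.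
move=> y; rewrite xE => -[a a_int ->]; apply: ultra_sum => // [|j _].
  exact: absval_ge0.
rewrite absvalM -[leRHS]mul1r ler_pM ?absval_ge0 //; last exact: iP.
by apply: ultra_int_le1.
Qed.

Definition place_ideal (v : finplace R K) : set K := [set x | OK x /\ v x < 1].

Hypothesis invK : frac_invertible K.

Section OnePlace.
Variable v : finplace R K.
Local Notation ultra := (@finplace_ultra _ _ v).

Lemma place_int_le1 x : OK x -> v x <= 1.
Proof. by apply: ultra_int_le1; exact: ultra. Qed.

Lemma place_ideal_frac : frac (place_ideal v).
Proof.
have [y y0 vy1] : exists2 y : K, y != 0 & v y < 1.
  have [x x0 vx] := finplace_nontriv v.
  have [lt|gt|e] := ltgtP (v x) 1; first by exists x.
  - exists x^-1; first by rewrite invr_eq0.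
    by rewrite absvalV invf_lt1 // (lt_trans _ gt).
  - by rewrite e eqxx in vx.
have [a a0 ay] := OK_frac y.
apply: (frac_sub_int (@frac_OK K)).
- by split; [exact: OK0|rewrite absval0].
- exists (a%:R * y); last by rewrite mulf_neq0 // natK_neq0.
  split=> //; rewrite absvalM; apply: le_lt_trans vy1.
  by rewrite ler_piMl ?absval_ge0 // place_int_le1 //; exact: OK_nat.
- move=> x z [hx vx] [hz vz]; split; first exact: OKD.
  by apply: le_lt_trans (ultra _ _) _; rewrite gt_max vx.
- move=> c x hc [hx vx]; split; first exact: OKM.
  by rewrite absvalM; apply: le_lt_trans vx; rewrite ler_piMl ?absval_ge0 // place_int_le1.
- by move=> x [].
Qed.

(** The residue ring is finite, so the powers of b repeat. An integral b outside the ideal has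
    absolute value 1, and cancelling b ^ i shows that b ^ d is an inverse of b. *)
Lemma place_ideal_max : max_ideal (place_ideal v).
Proof.
have PO : place_ideal v `<=` OK by move=> x [].
split=> //; first exact: place_ideal_frac.
  by move=> [_]; rewrite absval1 ltxx.
move=> b hb nb.
have vb : v b = 1.
  apply/eqP; rewrite eq_le place_int_le1 //= leNgt; apply/negP => lt; exact: nb.
have [N [T [f [[_ fcov _] _]]]] := frac_index_ex place_ideal_frac PO.
have /choice[g gP] i : exists t, place_ideal v (b ^+ i - f t).
  by apply: fcov; exact: OKX.
have [i [d gid]] := pigeonhole g.
have [_] : place_ideal v (b ^+ i - b ^+ (i + d.+1)).
  have -> : b ^+ i - b ^+ (i + d.+1) =
    (b ^+ i - f (g i)) - (b ^+ (i + d.+1) - f (g (i + d.+1)%N)) by rewrite gid; ring.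
  by apply: (fracB place_ideal_frac).
have -> : b ^+ i - b ^+ (i + d.+1) = b ^+ i * (1 - b ^+ d.+1) by rewrite exprD; ring.
rewrite absvalM absvalX vb expr1n mul1r => lt; exists (b ^+ d); first exact: OKX.
split; last by rewrite -exprS.
by apply: OKB; [exact: OK1|apply: OKM => //; exact: OKX].
Qed.

(** In 1 = b + y c one of the terms has absolute value 1. Accordingly b or c has absolute value 1,
    and y is (b y) / b or (c y) / c with integral numerator. *)
Lemma place_loc y : v y <= 1 -> exists a b, [/\ OK a, OK b, v b = 1 & y * b = a].
Proof.
move=> vy; have [b [c [hb hc hby hcy e]]] := pruefer invK y.
have [vb|vb] := ltP (v b) 1; last first.
  exists (b * y), b; split=> //; last by rewrite mulrC.
  by apply/eqP; rewrite eq_le place_int_le1 //.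
exists (c * y), c; split=> //; last by rewrite mulrC.
have : v (y * c) = 1.
  rewrite -(absval1 v); apply: (absval_lt_eq ultra).
  by rewrite -e opprD addrCA subrr addr0 absvalN e absval1.
rewrite absvalM => vyc; apply/eqP; rewrite eq_le place_int_le1 //=.
by rewrite -vyc ler_piMl ?absval_ge0.
Qed.

Lemma place_dvr : exists p N, dvr_data v (place_ideal v) p N.
Proof.
have [fP PO P1 Pmax] := place_ideal_max.
have [N PN] := frac_index_ex fP PO.
have [p Pp pmax] := frac_absmax ultra fP.
have unif y : v y < 1 -> v y <= v p.
  move=> vy; have [a [b [ha hb vb e]]] := place_loc (ltW vy).
  have vE : v y = v a by rewrite -e absvalM vb mulr1.
  by rewrite vE; apply: pmax; split=> //; rewrite -vE.
exists p, N; split=> //.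
- exact: ultra.
- exact: place_int_le1.
- by move=> x hx; split=> [|[]].
- apply/eqP => p0; have [[x Px x0] _ _ _] := fP.
  have := pmax x Px; rewrite p0 absval0 le_eqVlt ltNge absval_ge0 orbF absval_eq0.
  exact/negP.
- by case: Pp.
- exact: place_loc.
Qed.

(** The one use of the normalization: it fixes the value at a uniformizer, which the ideal alone
    leaves free. *)
Lemma place_abs_unif p N : dvr_data v (place_ideal v) p N -> v p = N%:R^-1.
Proof.
move=> D; rewrite -(completion_abs_emb v).
have p0 : to_completion v p != 0 by rewrite fmorph_eq0 (dvr_p0 D).
rewrite (finplace_normalized p0); last first.
  by rewrite /completion_int /= completion_abs_emb ltW // (dvr_p1 D).
congr (_%:R^-1); apply: is_index_coset_index; last exact: (dvr_index_uniformizer D).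
by apply: scale_subgroup; exact: (completion_int_subgroup D).
Qed.

End OnePlace.

Lemma place_eq (v w : finplace R K) : (forall x, v x = w x) -> v = w.
Proof.
case: v w => [[f f1 f2 f3 f4] f5 f6 f7] [[g g1 g2 g3 g4] g5 g6 g7] /= fg.
have e : f = g by apply/funext.
subst g; have e1 : f1 = g1 by exact: Prop_irrelevance.
have e2 : f2 = g2 by exact: Prop_irrelevance.
have e3 : f3 = g3 by exact: Prop_irrelevance.
have e4 : f4 = g4 by exact: Prop_irrelevance.
subst g1 g2 g3 g4; congr FinPlace; exact: Prop_irrelevance.
Qed.

(** By [place_loc] the ideal determines the valuation ring, hence the uniformizers; the
    normalization gives them the same value 1 / N, and every nonzero element is a power of p times a
    unit. *)
Lemma place_ideal_inj (v w : finplace R K) : place_ideal v = place_ideal w -> v = w.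
Proof.
move=> vw.
have le1 (v1 w1 : finplace R K) y : place_ideal v1 = place_ideal w1 ->
    v1 y <= 1 -> w1 y <= 1.
  move=> P1 /place_loc[a [b [ha hb vb e]]].
  have wb : w1 b = 1.
    apply/eqP; rewrite eq_le place_int_le1 //= leNgt; apply/negP => lt.
    have [_] : place_ideal v1 b by rewrite P1.
    by rewrite vb ltxx.
  by have := place_int_le1 w1 ha; rewrite -e absvalM wb mulr1.
have lt1 (v1 w1 : finplace R K) y : place_ideal v1 = place_ideal w1 ->
    v1 y < 1 -> w1 y < 1.
  move=> P1 vy; have [->|y0] := eqVneq y 0; first by rewrite absval0.
  rewrite ltNge; apply/negP => wy.
  have : v1 y^-1 <= 1.
    by apply: (le1 w1); rewrite // absvalV invf_le1 // (lt_le_trans ltr01).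
  by rewrite absvalV invf_le1 ?leNgt ?vy // lt_def absval_ge0 absval_eq0 y0.
have [p [N D]] := place_dvr v; have [q [N' D']] := place_dvr w.
have NN : N = N'.
  apply: (is_index_uniq _ (dvr_index D)); last by rewrite vw; exact: (dvr_index D').
  exact/frac_subgroup/place_ideal_frac.
have vp0 : 0 < v p by rewrite lt_def absval_ge0 absval_eq0 (dvr_p0 D).
have wp0 : 0 < w p by rewrite lt_def absval_ge0 absval_eq0 (dvr_p0 D).
have pw : w p = v p.
  rewrite (place_abs_unif D) NN -(place_abs_unif D'); apply/eqP; rewrite eq_le.
  rewrite (dvr_unif D'); last by apply: (lt1 v) => //; exact: (dvr_p1 D).
  have : w (q / p) <= 1.
    apply: (le1 v) => //; rewrite absvalM absvalV ler_pdivrMr // mul1r.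
    by apply: (dvr_unif D); apply: (lt1 w) => //; exact: (dvr_p1 D').
  by rewrite absvalM absvalV ler_pdivrMr // mul1r.
have eq_le1 x : x != 0 -> v x <= 1 -> v x = w x.
  move=> x0 /(dvr_abs_pow D x0)[k vx].
  have pk0 : p ^+ k != 0 by rewrite expf_neq0 // (dvr_p0 D).
  have v1 : v (x / p ^+ k) = 1.
    by rewrite absvalM absvalV absvalX vx divff // expf_neq0 // gt_eqF.
  have w1 : w (x / p ^+ k) = 1.
    apply/eqP; rewrite eq_le (le1 v) ?v1 //=.
    have := le1 v w (x / p ^+ k)^-1 vw; rewrite !absvalV v1 invr1 lexx => /(_ isT).
    by rewrite invf_le1 // lt_def absval_ge0 absval_eq0 mulf_neq0 ?invr_eq0.
  rewrite vx -pw -absvalX -[x in RHS](divfK pk0) absvalM w1.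
  by rewrite mul1r.
apply: place_eq => x; have [->|x0] := eqVneq x 0; first by rewrite !absval0.
have [/(eq_le1 x x0)//|vx] := leP (v x) 1.
apply: invr_inj; rewrite -!absvalV; apply: eq_le1; first by rewrite invr_eq0.
by rewrite absvalV invf_le1 ?ltW // (lt_trans ltr01).
Qed.

(** The place is given by the P-adic valuation; its normalization follows from the index N ^ k of p
    ^ k O_v. *)
Lemma place_exists P : max_ideal P -> exists v : finplace R K, place_ideal v = P.
Proof.
move=> Pmax; have [fP PO P1 Pm] := Pmax.
have [N PN] := frac_index_ex fP PO.
have N1 : (1 < N)%N.
  have sO := @OK_subgroup K; have sP := frac_subgroup fP.
  rewrite ltn_neqAle (is_index_gt0 sO PN) andbT eq_sym; apply/eqP => N1.
  by apply: P1; apply: (is_index1 sO sP) => //; [rewrite -N1|exact: OK1].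
have [ord [ordM ordD ord_loc ord_P [p p0 op]]] := ord_exists invK Pmax.
(* The base |O_K / P| is imposed by the normalization. *)
pose f x : R := if x == 0 then 0 else N%:R ^ (- ord x).
have NR0 : N%:R != 0 :> R by rewrite pnatr_eq0 -lt0n ltnW.
have NR1 : 1 < N%:R :> R by rewrite ltr1n.
have f_ge0 x : 0 <= f x by rewrite /f; case: eqP => // _; rewrite exprz_ge0.
have f_eq0 x : (f x == 0) = (x == 0).
  by rewrite /f; case: ifP => // _; rewrite ?eqxx // expfz_eq0 (negPf NR0) andbF.
have fM x y : f (x * y) = f x * f y.
  rewrite /f mulf_eq0; case: eqP => [_|/eqP x0] /=; first by rewrite mul0r.
  case: eqP => [_|/eqP y0]; first by rewrite mulr0.
  by rewrite ordM // opprD expfzDr.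
have fU x y : f (x + y) <= Num.max (f x) (f y).
  have [->|x0] := eqVneq x 0; first by rewrite add0r le_max lexx orbT.
  have [->|y0] := eqVneq y 0; first by rewrite addr0 le_max lexx.
  rewrite {1}/f; case: eqP => [_|/eqP xy0]; first by rewrite le_max f_ge0.
  rewrite /f (negPf x0) (negPf y0) le_max !ler_eXz2l //  !lerN2.
  by have := ordD x y x0 y0 xy0; rewrite ge_min.
have fD x y : f (x + y) <= f x + f y.
  by apply: le_trans (fU x y) _; rewrite ge_max lerDl lerDr !f_ge0.
pose v := AbsVal f_ge0 f_eq0 fM fD.
have f_le1 x : x != 0 -> (f x <= 1) = (0 <= ord x).
  by move=> x0; rewrite /f (negPf x0) -(expr0z N%:R) ler_eXz2l // lerNl oppr0.
have f_lt1 x : x != 0 -> (f x < 1) = (0 < ord x).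
  by move=> x0; rewrite /f (negPf x0) -(expr0z N%:R) ltr_eXz2l // ltrNl oppr0.
have v_P x : OK x -> v x < 1 <-> P x.
  move=> hx; have [->|x0] := eqVneq x 0; last by rewrite -ord_P // -f_lt1.
  by rewrite absval0; split=> // _; exact: frac0.
have fp : f p = N%:R^-1 by rewrite /f (negPf p0) op exprN1.
have D : dvr_data v P p N.
  split=> //.
  - move=> x hx; have [->|x0] := eqVneq x 0; first by rewrite absval0.
    by rewrite /= f_le1 //; apply/ord_loc => //; exact: OK_loc.
  - by rewrite /= f_lt1 // op.
  - move=> y; have [->|y0] := eqVneq y 0; first by rewrite !absval0 absval_ge0.
    by rewrite /= f_lt1 // fp /f (negPf y0) -exprN1 ler_eXz2l // lerN2 gtz0_ge1.
  - move=> y; have [->|y0] := eqVneq y 0.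
      by exists 0, 1; split; rewrite ?mul0r ?absval1 //; [exact: OK0|exact: OK1].
    rewrite /= f_le1 // => /(ord_loc y y0)[a [b [ha hb nb e]]].
    exists a, b; split=> //; apply/eqP; rewrite eq_le.
    have -> : f b <= 1.
      rewrite f_le1; last exact: (notP_neq0 Pmax).
      by apply/ord_loc; [exact: (notP_neq0 Pmax)|exact: OK_loc].
    by rewrite leNgt; apply/negP => /(v_P b hb).
have norm (a : completion v) : a != 0 -> completion_int v a ->
    completion_abs a = (coset_index (completion_int v)
         [set a * x | x in completion_int v])%:R^-1.
  move=> a0 a1; have [k [-> ak]] := dvr_index_scale D a0 a1.
  rewrite (is_index_coset_index _ ak); last first.
    exact: scale_subgroup (completion_int_subgroup D).
  by rewrite /= fp natrX exprVn.
have nontriv : exists2 x : K, x != 0 & v x != 1.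
  by exists p => //; rewrite lt_eqF //= f_lt1 // op.
exists (@FinPlace R K v fU nontriv norm); apply/seteqP; split=> x.
  by move=> [hx /(v_P x hx)].
by move=> Px; split; [exact: PO|apply/v_P => //; exact: PO].
Qed.

End Places.

(** * The product formula *)

Section ProductFormula.
Variables (R : realType) (K : fieldExtType rat).
Local Notation OK := (@ring_of_integers K).
Local Notation frac := (@is_fractional_ideal K).
Local Notation place := (finplace R K).
Implicit Types (v : place) (f g : place -> R).

(** Finiteness of the support is part of the notion, since the product over all places takes the
    default value 1 on an infinite support. *)
Definition has_prod f (c : R) := exists A : {fset place},
  (forall v, v \notin A -> f v = 1) /\ \prod_(v <- A) f v = c.

Lemma has_prodE f c : has_prod f c -> \big[*%R/1]_(v \in [set: place]) f v = c.
Proof. by move=> [A [f1 <-]]; exact: fsbigTE. Qed.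

Lemma has_prod_eq f g c : f =1 g -> has_prod f c -> has_prod g c.
Proof.
move=> fg [A [f1 <-]]; exists A; split; first by move=> v /f1; rewrite fg.
by apply: eq_bigr => v _; rewrite fg.
Qed.

Lemma has_prod1 : has_prod (fun=> 1) 1.
Proof. by exists fset0; split=> //; rewrite big1. Qed.

Lemma has_prod_single w (c : R) : has_prod (fun v => if v == w then c else 1) c.
Proof.
exists [fset w]%fset; split=> [v|]; first by rewrite inE => /negPf ->.
by rewrite big_seq_fset1 eqxx.
Qed.

Lemma has_prodM f g c d : has_prod f c -> has_prod g d ->
  has_prod (fun v => f v * g v) (c * d).
Proof.
move=> fc gd; have [A [f1 _]] := fc; have [B [g1 _]] := gd.
have f1' v : v \notin (A `|` B)%fset -> f v = 1.
  by rewrite inE negb_or => /andP[/f1].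
have g1' v : v \notin (A `|` B)%fset -> g v = 1.
  by rewrite inE negb_or => /andP[_ /g1].
exists (A `|` B)%fset; split=> [v vAB|]; first by rewrite f1' // g1' // mulr1.
rewrite big_split /= -(has_prodE fc) -(has_prodE gd).
by congr (_ * _); apply/esym/fsbigTE.
Qed.

Lemma has_prod_powR f c r : (forall v, 0 <= f v) -> has_prod f c ->
  has_prod (fun v => f v `^ r) (c `^ r).
Proof.
move=> f0 [A [f1 <-]]; exists A; split=> [v /f1 ->|]; first by rewrite powR1.
suff [] : 0 <= \prod_(v <- A) f v /\
  \prod_(v <- A) f v `^ r = (\prod_(v <- A) f v) `^ r by [].
elim: (enum_fset A) => [|v s [s0 sE]]; first by rewrite !big_nil powR1.
by rewrite !big_cons sE powRM // mulr_ge0.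
Qed.

(** The maximum of v on I; the default 0 is not met for fractional ideals. *)
Definition ideal_abs v (I : set K) : R :=
  xget 0 [set c | exists x, [/\ I x, c = v x & forall y, I y -> v y <= v x]].

Lemma ideal_absE v I x : I x -> (forall y, I y -> v y <= v x) -> ideal_abs v I = v x.
Proof.
move=> Ix xmax; apply: xget_unique; first by exists x.
by move=> _ [z [Iz -> zmax]]; apply/eqP; rewrite eq_le xmax // zmax.
Qed.

Lemma ideal_abs_ex v I : frac I ->
  exists x, [/\ I x, ideal_abs v I = v x & forall y, I y -> v y <= v x].
Proof.
move=> fI; have [x Ix xmax] := frac_absmax (@finplace_ultra _ _ v) fI.
by exists x; split=> //; exact: ideal_absE.
Qed.

Lemma ideal_abs_idmul v I J : frac I -> frac J ->
  ideal_abs v (idmul I J) = ideal_abs v I * ideal_abs v J.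
Proof.
move=> fI fJ; have [x [Ix -> xmax]] := ideal_abs_ex v fI.
have [y [Jy -> ymax]] := ideal_abs_ex v fJ.
rewrite -absvalM; apply: ideal_absE; first exact: idmul_mem.
apply: idmul_ind => /=; first by rewrite absval0 absval_ge0.
  move=> z w zle wle; apply: le_trans (finplace_ultra _ _ _) _.
  by rewrite ge_max zle.
by move=> z w Iz Jw; rewrite !absvalM ler_pM ?absval_ge0 ?xmax ?ymax.
Qed.

Lemma ideal_abs_OK v : ideal_abs v OK = 1.
Proof.
rewrite -(absval1 v); apply: ideal_absE; first exact: OK1.
by move=> y hy; rewrite absval1 place_int_le1.
Qed.

Lemma ideal_abs_coord v n (x : 'cV[K]_n) :
  ideal_abs v (coord_ideal x) = \big[Num.max/0]_(i < n) v (x i 0).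
Proof.
have [x0|/eqP/cV0Pn[j xj]] := pselect (x = 0).
  rewrite x0; transitivity (v 0).
    apply: ideal_absE => [|_ [a _ ->]].
      exists (fun=> 0) => [i|]; first exact: OK0.
      by rewrite big1 // => i _; rewrite mul0r.
    by rewrite big1 // => i _; rewrite mxE mulr0.
  rewrite absval0; elim/big_ind: _ => // [_ _ <- <-|i _]; first by rewrite maxxx.
  by rewrite mxE absval0.
have n0 : (0 < n)%N by case: (n) j {xj} => [[]|].
case: n n0 x j xj => // n _ x j xj.
have [i _ iP] := @arg_maxP _ _ _ ord0 predT (fun i => v (x i 0)) isT.
transitivity (v (x i 0)).
  apply: ideal_absE; first exact: coord_ideal_gen.
  move=> _ [a a_int ->]; apply: ultra_sum => [||k _].
  - exact: finplace_ultra.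
  - exact: absval_ge0.
  - rewrite absvalM -[leRHS]mul1r ler_pM ?absval_ge0 ?place_int_le1 //; exact: iP.
apply/eqP; rewrite eq_le; apply/andP; split.
  exact: (@le_bigmax_cond _ _ _ _ _ predT).
apply: bigmax_le; first exact: absval_ge0.
by move=> k _; exact: iP.
Qed.

Hypothesis invK : frac_invertible K.

Lemma max_ideal_sub_eq (P Q : set K) : max_ideal P -> max_ideal Q -> P `<=` Q -> P = Q.
Proof.
move=> [fP PO P1 Pmax] [fQ QO Q1 _] PQ; apply/seteqP; split=> // b Qb.
apply: contrapT => nPb; have [c hc Pc] := Pmax b (QO _ Qb) nPb.
apply: Q1; rewrite -[1](subrK (b * c)); apply: fracD => //; first exact: PQ.
exact: fracMr.
Qed.

(** Only the place attached to P contributes. At any other place P is not contained in the ideal of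
    the place, so it has an element of absolute value 1. *)
Lemma has_prod_max_ideal (P : set K) N : max_ideal P -> is_index OK P N ->
  has_prod (fun v => ideal_abs v P) N%:R^-1.
Proof.
move=> Pmax PN; have [fP PO P1 _] := Pmax.
have [w wP] := place_exists R invK Pmax.
apply: (has_prod_eq _ (has_prod_single w _)) => v.
have [->|vw] := eqVneq v w.
  have [p [M D]] := place_dvr invK w; have [x [Px -> xmax]] := ideal_abs_ex w fP.
  have NM : N = M.
    by apply: (is_index_uniq (frac_subgroup fP) PN); rewrite -wP; exact: (dvr_index D).
  rewrite NM -(place_abs_unif D); apply/eqP; rewrite eq_le.
  have [a [b [ha hb wb e]]] := dvr_loc D (ltW (dvr_p1 D)).
  have wa : w p = w a by rewrite -e absvalM wb mulr1.
  rewrite (dvr_unif D) ?andbT.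
    rewrite wa; apply: xmax; rewrite -wP; split=> //.
    by rewrite -wa (dvr_p1 D).
  by move: Px; rewrite -{1}wP => -[].
have [x [Px -> xmax]] := ideal_abs_ex v fP; apply/eqP; rewrite eq_le.
rewrite place_int_le1 ?andbT; last exact: PO.
rewrite leNgt; apply/negP => lt; case/eqP: vw; apply: (place_ideal_inj invK).
rewrite wP; apply/esym/max_ideal_sub_eq => //; first exact: place_ideal_max.
by move=> y Py; split; [exact: PO|exact: le_lt_trans (xmax y Py) lt].
Qed.

(* For [j] in [J] but not in [P J], multiplication by [j] induces an
   isomorphism from [OK / P] onto [J / P J]. *)
Lemma is_index_idmul (P J : set K) N : max_ideal P -> frac J -> is_index OK P N ->
  is_index J (idmul P J) N.
Proof.
move=> Pmax fJ [T [f [[f_int fcov finj] TN]]]; have [fP PO P1 Pm] := Pmax.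
have fPJ := idmul_frac fP fJ.
have [j [Jj nj]] : exists j, J j /\ ~ idmul P J j.
  apply: contrapT => no; apply: P1; apply: (frac_mulr_eq_1 fJ fP PO).
  apply/seteqP; split; first exact: idmul_sub.
  by move=> x Jx; apply: contrapT => nx; apply: no; exists x.
have [J' fJ' JJ'] := invK fJ.
have [t J't njt] : exists2 t, J' t & ~ P (j * t).
  apply: contrapT => no; apply: nj; rewrite -[j]mulr1.
  have : idmul J' J 1 by rewrite idmulC JJ'; exact: OK1.
  suff h : idmul J' J `<=` [set z | idmul P J (j * z)] by move=> /h.
  apply: idmul_ind => [|u w|u w J'u Jw] /=; first by rewrite mulr0; exact: idmul0.
    by rewrite mulrDr; exact: idmulD.
  rewrite mulrA; apply: idmul_mem => //; apply: contrapT => nP.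
  by apply: no; exists u.
have JJO y u : J y -> J' u -> OK (y * u) by move=> Jy J'u; rewrite -JJ'; exact: idmul_mem.
have [b' hb' Pb] := Pm _ (JJO _ _ Jj J't) njt.
exists T, (fun i => f i * j); split=> //; split=> [i|y Jy|i k].
- exact: frac_mul.
- have hx : OK (t * b' * y) by rewrite mulrAC; apply: OKM => //; rewrite mulrC; exact: JJO.
  have [i Pi] := fcov _ hx; exists i.
  have -> : y - f i * j = (1 - j * t * b') * y + (t * b' * y - f i) * j by ring.
  by apply: idmulD; exact: idmul_mem.
- rewrite -mulrBl => Pik; apply: finj; apply: contrapT => nik.
  have h_int : OK (f i - f k) by exact: OKB.
  have [c hc Pc] := Pm _ h_int nik; apply: nj.
  have -> : j = (1 - (f i - f k) * c) * j + c * ((f i - f k) * j) by ring.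
  by apply: idmulD; [exact: idmul_mem|exact: (frac_mul fPJ)].
Qed.

(** Induction on the index: with P maximal above I and J = P^-1 I, one has I = P J, and |O_K / I| is
    |O_K / J| times |J / P J| = |O_K / P|. *)
Lemma has_prod_ideal (I : set K) N : frac I -> I `<=` OK -> is_index OK I N ->
  has_prod (fun v => ideal_abs v I) N%:R^-1.
Proof.
elim/ltn_ind: N I => N IH I fI IO IN.
have [I1|nI1] := pselect (I 1).
  have IE : I = OK.
    by apply/seteqP; split=> // x hx; rewrite -[x]mulr1; exact: frac_mul.
  have sO := @OK_subgroup K; have N1 : N = 1%N.
    by apply: (is_index_uniq sO _ (is_index_refl sO)); move: IN; rewrite IE.
  rewrite N1 invr1; apply: (@has_prod_eq (fun=> 1)); last exact: has_prod1.
  by move=> v; rewrite IE ideal_abs_OK.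
have [P Pmax IP] := exists_max_ideal fI IO nI1; have [fP PO P1 _] := Pmax.
have [Q fQ PQ] := invK fP.
pose J := idmul Q I; have fJ : frac J by exact: idmul_frac.
have IPJ : I = idmul P J by rewrite idmulA PQ idmul_OK.
have JO : J `<=` OK by rewrite -PQ /J [idmul P Q]idmulC; exact: idmulS.
have IJ : I `<=` J by rewrite IPJ; exact: idmul_sub.
have nJI : ~ J `<=` I.
  move=> JI; have JE : J = I by apply/seteqP; split.
  by apply: P1; apply: (frac_mulr_eq_1 fI fP PO); rewrite [RHS]IPJ JE.
have [M JM] := frac_index_ex fJ JO; have [L PL] := frac_index_ex fP PO.
have MN := is_index_proper_lt fJ fI IJ JO nJI IN JM.
have JIL : is_index J I L by rewrite IPJ; exact: is_index_idmul.
have NE : N = (M * L)%N.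
  apply: (is_index_uniq (frac_subgroup fI) IN).
  exact: is_index_trans (@OK_subgroup K) (frac_subgroup fJ) (frac_subgroup fI) JO IJ JM JIL.
rewrite NE natrM invfM mulrC.
apply: has_prod_eq (has_prodM (has_prod_max_ideal Pmax PL) (IH M MN J fJ JO JM)) => v.
by rewrite -ideal_abs_idmul // -IPJ.
Qed.

End ProductFormula.

(** * The finite part of the height of a vector *)

Section ContentProduct.
Variables (R : realType) (K : fieldExtType rat).
Local Notation OK := (@ring_of_integers K).
Local Notation m := (\dim {: K}).
Hypothesis invK : frac_invertible K.

Definition vec_abs n (x : 'cV[K]_n) (v : finplace R K) : R :=
  \big[Num.max/0]_(i < n) v (x i 0).

Lemma vec_abs_ge0 n (x : 'cV[K]_n) v : 0 <= vec_abs x v.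
Proof. by rewrite /vec_abs; apply: bigmax_ge_id. Qed.

Lemma vec_absZ n a (x : 'cV[K]_n) v : vec_abs (a *: x) v = v a * vec_abs x v.
Proof.
rewrite /vec_abs; elim/big_rec2: _ => [|i y z _ ->]; first by rewrite mulr0.
by rewrite mxE absvalM maxr_pMr ?absval_ge0.
Qed.

Lemma has_prodV f c : has_prod f c -> has_prod (fun v : finplace R K => (f v)^-1) c^-1.
Proof.
move=> [A [f1 <-]]; exists A; split; first by move=> v /f1 ->; rewrite invr1.
by rewrite prodfV.
Qed.

Lemma has_prod_vec_abs_int n (x : 'cV[K]_n) : x != 0 -> (forall i, OK (x i 0)) ->
  has_prod (vec_abs x) (ideal_norm (coord_ideal x))%:R^-1.
Proof.
move=> x0 x_int; have fx := coord_ideal_frac x0.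
have xO : coord_ideal x `<=` OK.
  by move=> _ [a a_int ->]; apply: OK_sum => i; exact: OKM.
have [N xN] := frac_index_ex fx xO.
rewrite /ideal_norm (is_index_coset_index (frac_subgroup fx) xN).
apply: has_prod_eq (has_prod_ideal R invK fx xO xN) => v.
exact: ideal_abs_coord.
Qed.

Lemma has_prod_nat (a : nat) : a != 0%N ->
  exists2 N, (a ^ m <= N)%N & has_prod (fun v : finplace R K => v a%:R) N%:R^-1.
Proof.
move=> a0; have [N aN] := is_index_OK_nat_ex K a0.
exists N; first exact: is_index_OK_nat_le a0 aN.
have faO : is_fractional_ideal (scale_set a%:R OK).
  by apply: frac_scale; [exact: natK_neq0|exact: frac_OK].
apply: has_prod_eq (has_prod_ideal R invK faO _ aN) => [v|]; last exact/scale_OK_sub/OK_nat.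
apply: ideal_absE; first by exists 1; [exact: OK1|rewrite mulr1].
by move=> _ [y hy <-]; rewrite absvalM ler_piMr ?absval_ge0 ?place_int_le1.
Qed.

Lemma vec_integral_multiple n (x : 'cV[K]_n) :
  exists2 a : nat, a != 0%N & forall i, OK ((a%:R *: x) i 0).
Proof.
have /choice[d dP] i : exists d : nat, d != 0%N /\ OK (d%:R * x i 0).
  by have [d] := OK_frac (x i 0); exists d.
exists (\prod_i d i)%N.
  by rewrite -lt0n prodn_gt0 // => i; rewrite lt0n; case: (dP i).
move=> i; rewrite mxE (bigD1 i) //= mulnC natrM -mulrA.
by apply: OKM; [exact: OK_nat|case: (dP i)].
Qed.

(** [N] stands for |O_K / a O_K|, and 1 / N is the product of the |a|_v over the finite places. The
    product for x is obtained by dividing that of the integral vector a x by it. *)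
Lemma has_prod_vec_abs n (x : 'cV[K]_n) : x != 0 ->
  exists (a : nat) (c N : R), [/\ a != 0%N /\ a%:R ^+ m <= N, 0 <= c,
    forall i, OK ((a%:R *: x) i 0), has_prod (vec_abs x) c
    & has_prod (vec_abs (a%:R *: x)) (N^-1 * c)].
Proof.
move=> x0; have [a a0 ax_int] := vec_integral_multiple x.
have aK := natK_neq0 K a0.
have ax0 : a%:R *: x != 0 by rewrite scaler_eq0 negb_or aK.
have axc := has_prod_vec_abs_int ax0 ax_int.
set c' : R := _^-1 in axc.
have [N aN aP] := has_prod_nat a0.
have N0 : N%:R != 0 :> R.
  rewrite pnatr_eq0 -lt0n; apply: leq_trans aN.
  by rewrite expn_gt0 lt0n a0.
exists a, (N%:R * c'), N%:R; split=> //.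
- by split; rewrite // -natrX ler_nat.
- by rewrite mulr_ge0 // invr_ge0.
- rewrite -[X in X * c']invrK; apply: has_prod_eq (has_prodM (has_prodV aP) axc) => v.
  by rewrite vec_absZ mulKf // absval_eq0.
- by rewrite mulKf.
Qed.

End ContentProduct.

(** * The number of archimedean embeddings *)

Section Archimedean.
Variables (R : realType) (K : fieldExtType rat) (r s : nat).
Variable E : arch_embeddings R K r s.
Local Notation m := (\dim {: K}).

Lemma numfield_primitive_element : exists t : K, <<1; t>>%VS = {: K}%VS.
Proof.
have sepK : separable 1 {: K}.
  apply/separableP => y _; have [//|/separablePn_pchar[p]] := boolP (separable_element 1 y).
  rewrite inE => /andP[p_pr /eqP p0] _; exfalso.
  by have := natK_neq0 K (lt0n_neq0 (prime_gt0 p_pr)); rewrite p0 eqxx.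
exists (separable_generator 1 {: K}).
by rewrite -(eq_adjoin_separable_generator sepK) ?sub1v.
Qed.

Lemma emb_inQ (L : fieldType) (f : {rmorphism K -> L}) (p : {poly rat}) t :
  f (map_poly (in_alg K) p).[t] = (map_poly (ratr : rat -> L) p).[f t].
Proof.
rewrite -horner_map -map_poly_comp; congr (_.[_]).
by apply: eq_map_poly => q; exact: (fmorph_eq_rat (f \o in_alg K)).
Qed.

Lemma emb_eq (L : fieldType) (f g : {rmorphism K -> L}) t :
  <<1; t>>%VS = {: K}%VS -> f t = g t -> f =1 g.
Proof.
move=> tK fg x; have : x \in <<1; t>>%VS by rewrite tK memvf.
case/Fadjoin_polyP => p /polyOver1P[q ->] ->.
by rewrite !emb_inQ fg.
Qed.

(** The real embeddings, the complex ones and the conjugates of the latter send a primitive element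
    to distinct roots of its minimal polynomial, which has degree m. *)
Lemma arch_embeddings_le : (r + 2 * s <= m)%N.
Proof.
have [t tK] := numfield_primitive_element.
have [p pE] := polyOver1P (minPolyOver 1 t).
have p_mon : p \is monic.
  have := monic_minPoly 1 t; rewrite pE !monicE lead_coef_map -(rmorph1 (in_alg K)).
  by move=> /eqP/fmorph_inj ->.
pose P : {poly R[i]} := map_poly ratr p.
have P0 : P != 0 by rewrite map_poly_eq0 monic_neq0.
have sP : size P = m.+1.
  rewrite size_map_poly -(size_map_poly (in_alg K)) -pE size_minPoly.
  by congr (_.+1); have := dim_Fadjoin 1 t; rewrite tK dimv1 muln1.
have root_emb (f : {rmorphism K -> R[i]}) : root P (f t).
  rewrite /root -emb_inQ -pE; apply/eqP.
  by have /rootP -> := root_minPoly 1 t; rewrite rmorph0.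
pose fr i : {rmorphism K -> R[i]} := (real_complex R \o real_emb E i : {rmorphism K -> R[i]}).
pose fc i : {rmorphism K -> R[i]} := (Num.conj \o complex_emb E i : {rmorphism K -> R[i]}).
pose rs := [seq fr i t | i <- enum 'I_r] ++ ([seq complex_emb E i t | i <- enum 'I_s] ++
  [seq fc i t | i <- enum 'I_s]).
have rs_root : all (root P) rs.
  rewrite !all_cat; apply/and3P; split; apply/allP => _ /mapP[i _ ->]; exact: root_emb.
have srs : size rs = (r + 2 * s)%N.
  by rewrite !size_cat !size_map -!enumT -!cardE !card_ord mul2n addnn.
rewrite -ltnS -sP -srs; apply: max_poly_roots => //.
have cc i j : complex_emb E i t != fc j t.
  by apply/eqP => h; apply: (@complex_emb_conj _ _ _ _ E i j) => x; exact: (emb_eq tK h).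
(* A complex embedding with real values would be its own conjugate, which the case of equal indices
   in [complex_emb_conj] forbids. *)
have frc i j : fr i t != complex_emb E j t.
  apply/eqP => h; apply: (@complex_emb_conj _ _ _ _ E j j) => x.
  have {}h : fr i x = complex_emb E j x := emb_eq tK h x.
  by rewrite -h; apply/esym; exact: conjc_real.
have frcc i j : fr i t != fc j t.
  apply/eqP => h; case/eqP: (frc i j).
  have {}h : Num.conj (fr i t) = complex_emb E j t by rewrite h /= conjCK.
  by rewrite -h; apply/esym; exact: conjc_real.
have uniq_emb k (g : 'I_k -> {rmorphism K -> R[i]}) :
    (forall i j, g i =1 g j -> i = j) -> uniq [seq g i t | i <- enum 'I_k].
  move=> g_inj; rewrite map_inj_uniq ?enum_uniq // => i j gij.
  by apply: g_inj; exact: (emb_eq tK).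
rewrite cat_uniq has_cat negb_or cat_uniq; apply/and3P; split; last apply/and3P; last split.
- apply: uniq_emb => i j h; apply: (real_emb_inj (a := E)) => x.
  by have /complexI := h x.
- apply/andP; split; apply/hasPn => _ /mapP[j _ ->]; apply/mapP => -[i _ /esym].
    by apply/eqP; exact: frc.
  by apply/eqP; exact: frcc.
- by apply: uniq_emb => i j; exact: complex_emb_inj.
- apply/hasPn => _ /mapP[j _ ->]; apply/mapP => -[i _ /esym].
  by apply/eqP; exact: cc.
- apply: uniq_emb => i j h; apply: (complex_emb_inj (a := E)) => x.
  by apply: (can_inj conjCK); exact: h.
Qed.

End Archimedean.

(** * Humbert forms and Gram matrices *)

Section Cholesky.
Variables (F : numFieldType) (c : {rmorphism F -> F}).
Hypothesis cK : involutive c.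

(* [c] is the identity in the real case and the conjugation in the complex case. *)
Definition adjmx m n (A : 'M[F]_(m, n)) : 'M[F]_(n, m) := (map_mx c A)^T.

Definition sesq_form n (A : 'M[F]_n) (y : 'cV[F]_n) : F := (adjmx y *m A *m y) 0 0.

Definition posdef n (A : 'M[F]_n) := adjmx A = A /\
  forall y : 'cV[F]_n, y != 0 -> 0 < sesq_form A y.

Lemma adjmxM m n p (A : 'M[F]_(m, n)) (B : 'M[F]_(n, p)) :
  adjmx (A *m B) = adjmx B *m adjmx A.
Proof. by rewrite /adjmx map_mxM trmx_mul. Qed.

Lemma adjmxK m n (A : 'M[F]_(m, n)) : adjmx (adjmx A) = A.
Proof. by apply/matrixP => i j; rewrite !mxE cK. Qed.

Lemma det_adjmx n (A : 'M[F]_n) : \det (adjmx A) = c (\det A).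
Proof. by rewrite det_tr det_map_mx. Qed.

Lemma sesq_form_gram n (g : 'M[F]_n) y :
  sesq_form (adjmx g *m g) y = \sum_i c ((g *m y) i 0) * (g *m y) i 0.
Proof.
rewrite /sesq_form !mulmxA -adjmxM -mulmxA mxE.
by apply: eq_bigr => i _; rewrite !mxE.
Qed.

Lemma posdef_gram n (g : 'M[F]_n) : (forall z, z != 0 -> 0 < c z * z) ->
  g \in unitmx -> posdef (adjmx g *m g).
Proof.
move=> cpos gu; split; first by rewrite adjmxM adjmxK.
have cge0 z : 0 <= c z * z.
  by have [->|/cpos/ltW//] := eqVneq z 0; rewrite mulr0.
move=> y y0; rewrite sesq_form_gram.
have /cV0Pn[i gi] : g *m y != 0.
  by apply: contraNneq y0 => gy0; rewrite -(mulKmx gu y) gy0 mulmx0.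
rewrite (bigD1 i) //= ltr_pwDl ?cpos //; exact: sumr_ge0.
Qed.

Hypothesis csqrt : forall a, 0 < a -> exists d, c d * d = a.

(** Induction by the Schur complement C' = C - a^-1 b^* b of the corner a. With g'^* g' = C' and
    c(d) d = a, the factor g has blocks d, b / c(d), 0 and g'. *)
Lemma cholesky n (A : 'M[F]_n) : posdef A ->
  exists2 g, g \in unitmx & adjmx g *m g = A.
Proof.
elim: n A => [|n IH] A [Ah Apos].
  by exists 1%:M; [exact: unitmx1|apply/matrixP => -[]].
change 'M[F]_(1 + n) in A.
have {}Apos (y : 'cV[F]_(1 + n)) : y != 0 -> 0 < sesq_form A y := Apos y.
have Aij (i j : 'I_(1 + n)) : c (A j i) = A i j.
  by have /matrixP/(_ i j) := Ah; rewrite !mxE.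
pose a := A 0 0; pose b : 'rV[F]_n := ursubmx A; pose C : 'M[F]_n := drsubmx A.
have ulE : ulsubmx A = a%:M.
  apply/matrixP => i j; rewrite !ord1 !mxE eqxx mulr1n.
  by congr (A _ _); apply/val_inj.
have dlE : dlsubmx A = adjmx b.
  by apply/matrixP => i j; rewrite !mxE Aij.
have Ch : adjmx C = C.
  by apply/matrixP => i j; rewrite !mxE Aij.
have AE : A = block_mx a%:M b (adjmx b) C by rewrite -ulE -dlE submxK.
have adj_col m1 m2 (u : 'cV[F]_m1) (w : 'cV[F]_m2) :
    adjmx (col_mx u w) = row_mx (adjmx u) (adjmx w).
  by rewrite /adjmx map_col_mx tr_col_mx.
have ca : c a = a by rewrite /a Aij.
have a0 : 0 < a.
  have := Apos (col_mx (1%:M : 'cV[F]_1) 0); rewrite /sesq_form AE adj_col mul_row_block mul_row_col.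
  have -> : adjmx (0 : 'cV[F]_n) = 0 by rewrite /adjmx map_mx0 trmx0.
  rewrite mulmx0 addr0 !mul0mx addr0 mulmx1 /adjmx map_mx1 trmx1 mul1mx mxE eqxx mulr1n.
  apply; apply/cV0Pn; exists (lshift n 0); by rewrite col_mxEu mxE eqxx oner_neq0.
have an0 : a != 0 by rewrite gt_eqF.
pose C' := C - a^-1 *: (adjmx b *m b).
have adjZ m1 m2 k (M : 'M[F]_(m1, m2)) : adjmx (k *: M) = c k *: adjmx M.
  by rewrite /adjmx map_mxZ linearZ.
have cai : c a^-1 = a^-1 by rewrite fmorphV ca.
have C'pos : posdef C'.
  split.
    rewrite /C' {1}/adjmx map_mxB linearB /= -/(adjmx C) Ch; congr (_ - _).
    by rewrite -/(adjmx _) adjZ cai adjmxM adjmxK.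
  (* This first coordinate cancels the top block of the product by A, leaving the value of C' at
     y. *)
  move=> y y0; have := Apos (col_mx (- a^-1 *: (b *m y)) y).
  rewrite /sesq_form {1}AE -mulmxA mul_block_col adj_col mul_row_col.
  rewrite mul_scalar_mx scalerA mulrN divff // scaleN1r addNr mulmx0 add0r.
  rewrite -scalemxAr !scaleNr addrC mulmxA => h; rewrite -mulmxA /C' mulmxBl -scalemxAl.
  apply: h; apply: contraNneq y0 => yy0.
  by apply/eqP/matrixP => i j; move/matrixP: yy0 => /(_ (rshift 1 i) j); rewrite col_mxEd !mxE.
have [g' g'u g'E] := IH _ C'pos; have [d dE] := csqrt a0.
have d0 : d != 0 by apply: contraNneq an0 => d0; rewrite -dE d0 mulr0.
have cd0 : c d != 0 by rewrite fmorph_eq0.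
pose g : 'M[F]_(1 + n) := block_mx d%:M ((c d)^-1 *: b) 0 g'.
have gu : g \in unitmx.
  rewrite unitmxE det_ublock det_scalar expr1 unitrM unitfE d0 /=.
  by rewrite -unitmxE.
suff gA : adjmx g *m g = A by exists g.
have -> : adjmx g =
    block_mx (c d)%:M 0 (d^-1 *: adjmx b) (adjmx g').
  rewrite /g /adjmx map_block_mx tr_block_mx map_scalar_mx tr_scalar_mx map_mx0 trmx0.
  by rewrite map_mxZ linearZ /= fmorphV cK.
rewrite /g mulmx_block !mul0mx !mulmx0 !addr0.
have -> : (c d)%:M *m d%:M = a%:M :> 'M[F]_1 by rewrite -scalar_mxM -dE.
rewrite mul_scalar_mx scalerA.
rewrite divff // scale1r mul_mx_scalar scalerA divff // scale1r.
rewrite g'E -scalemxAl -scalemxAr scalerA -invfM [d * _]mulrC dE AE /C'.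
by rewrite addrC subrK.
Qed.

End Cholesky.

Section Forms.
Variables (R : realType) (r s n : nat).
Local Notation conjR := (idfun : {rmorphism R -> R}).
Local Notation conjCi := (Num.conj : {rmorphism R[i] -> R[i]}).

Lemma conjM_complex_abs (z : R[i]) : Num.conj z * z = (complex_abs z)%:C%C.
Proof.
rewrite mulrC -normCK /complex_abs rmorphXn /=.
by congr (_ ^+ 2).
Qed.

Lemma complex_abs_ge0 (z : R[i]) : 0 <= complex_abs z.
Proof. exact: sqr_ge0. Qed.

Lemma conjM_gt0 (z : R[i]) : z != 0 -> 0 < Num.conj z * z.
Proof. by move=> z0; rewrite mulrC mul_conjC_gt0. Qed.

Lemma real_formE (A : 'M[R]_n) y : real_form A y = sesq_form conjR A y.
Proof. by rewrite /real_form /sesq_form /adjmx map_mx_id. Qed.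

Definition gram_forms (S : humbert_form R r s n)
    (gr : 'I_r -> 'M[R]_n) (gc : 'I_s -> 'M[R[i]]_n) :=
  [/\ forall i, gr i \in unitmx, forall i, gc i \in unitmx,
      forall i, humbert_real S i = adjmx conjR (gr i) *m gr i
    & forall i, humbert_complex S i = adjmx conjCi (gc i) *m gc i].

Lemma real_csqrt (a : R) : 0 < a -> exists d, conjR d * d = a.
Proof. by move=> a0; exists (Num.sqrt a); rewrite /= -expr2 sqr_sqrtr // ltW. Qed.

Lemma complex_csqrt (a : R[i]) : 0 < a -> exists d, conjCi d * d = a.
Proof.
move=> a0; exists (sqrtC a).
rewrite /= conj_Creal ?ger0_real ?sqrtC_ge0 ?ltW //.
by rewrite -expr2 sqrtCK.
Qed.

Lemma symmetric_adjmx (A : 'M[R]_n) : (A \is symmetricmx) = (adjmx conjR A == A).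
Proof. by rewrite qualifE /= expr0 scale1r eq_sym /adjmx map_trmx. Qed.

Lemma hermitian_adjmx (A : 'M[R[i]]_n) : (A \is hermsymmx) = (adjmx conjCi A == A).
Proof. by rewrite qualifE /= expr0 scale1r eq_sym /adjmx map_trmx. Qed.

Lemma gram_forms_cholesky (S : humbert_form R r s n) :
  exists gr gc, gram_forms S gr gc.
Proof.
have /choice[gr grP] i : exists g, g \in unitmx /\ adjmx conjR g *m g = humbert_real S i.
  have [] := @cholesky _ conjR (fun=> erefl) real_csqrt _ (humbert_real S i).
    split; first by apply/eqP; rewrite -symmetric_adjmx humbert_real_sym.
    by move=> y y0; rewrite -real_formE; apply: humbert_real_posdef.
  by move=> g gu gE; exists g.
have /choice[gc gcP] i : exists g, g \in unitmx /\ adjmx conjCi g *m g = humbert_complex S i.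
  have [] := @cholesky _ conjCi conjCK complex_csqrt _ (humbert_complex S i).
    split; first by apply/eqP; rewrite -hermitian_adjmx humbert_complex_herm.
    by move=> y y0; exact: humbert_complex_posdef.
  by move=> g gu gE; exists g.
by exists gr, gc; split=> i; do ?[by case: (grP i)|by case: (gcP i)].
Qed.

Lemma gram_forms_exists (gr : 'I_r -> 'M[R]_n) (gc : 'I_s -> 'M[R[i]]_n) :
  (forall i, gr i \in unitmx) -> (forall i, gc i \in unitmx) ->
  exists S, gram_forms S gr gc.
Proof.
move=> gru gcu.
have rpos (z : R) : z != 0 -> 0 < conjR z * z.
  by move=> z0; rewrite /= -expr2 lt_def sqr_ge0 sqrf_eq0 z0.
have pr i := @posdef_gram _ conjR (fun=> erefl) _ (gr i) rpos (gru i).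
have pc i := @posdef_gram _ conjCi conjCK _ (gc i) conjM_gt0 (gcu i).
have rsym i : adjmx conjR (gr i) *m gr i \is symmetricmx.
  by rewrite symmetric_adjmx; apply/eqP; case: (pr i).
have csym i : adjmx conjCi (gc i) *m gc i \is hermsymmx.
  by rewrite hermitian_adjmx; apply/eqP; case: (pc i).
have rp i y : y != 0 -> 0 < real_form (adjmx conjR (gr i) *m gr i) y.
  by move=> y0; rewrite real_formE; have [_ h] := pr i; exact: h.
have cp i y : y != 0 -> 0 < complex_form (adjmx conjCi (gc i) *m gc i) y.
  by move=> y0; have [_ h] := pc i; exact: h.
by exists (HumbertForm rsym rp csym cp).
Qed.

Lemma gram_forms_eval (K : fieldExtType rat) (E : arch_embeddings R K r s) S gr gc x :
  gram_forms S gr gc -> humbert_eval E S x =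
  (\prod_i \sum_k `|(gr i *m map_mx (real_emb E i) x) k 0| ^+ 2) *
  (\prod_i \sum_k complex_abs ((gc i *m map_mx (complex_emb E i) x) k 0)) ^+ 2.
Proof.
move=> [_ _ rE cE]; rewrite /humbert_eval; congr (_ * _ ^+ 2).
  apply: eq_bigr => i _; rewrite rE real_formE sesq_form_gram.
  by apply: eq_bigr => k _; rewrite /= -expr2 real_normK ?num_real.
apply: eq_bigr => i _; rewrite cE -[complex_form _ _]/(sesq_form conjCi _ _).
rewrite sesq_form_gram (eq_bigr (fun k => (complex_abs
  ((gc i *m map_mx (complex_emb E i) x) k 0))%:C%C)); last first.
  by move=> k _; exact: conjM_complex_abs.
by rewrite -rmorph_sum.
Qed.

Lemma gram_forms_det S gr gc : gram_forms S gr gc ->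
  humbert_det S =
  ((\prod_i `|\det (gr i)|) * (\prod_i complex_abs (\det (gc i)))) ^+ 2.
Proof.
move=> [_ _ rE cE]; rewrite /humbert_det exprMn; congr (_ * _ ^+ 2).
  rewrite -prodrXl; apply: eq_bigr => i _.
  by rewrite rE det_mulmx det_adjmx /= real_normK ?num_real.
apply: eq_bigr => i _; rewrite cE det_mulmx det_adjmx.
by rewrite conjM_complex_abs.
Qed.

End Forms.

(** * Invariance of local norms and determinants under GL_n(O_v) *)

Section FiniteUnimodular.
Variables (R : realType) (K : fieldExtType rat) (v : finplace R K).
Local Notation cabs := (@completion_abs R K v).
Local Notation ultra := (@finplace_ultra R K v).

Lemma completion_abs_sum_le (I : Type) (t : seq I) (Q : pred I) F (c : R) :
  0 <= c -> (forall i, Q i -> cabs (F i) <= c) -> cabs (\sum_(i <- t | Q i) F i) <= c.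
Proof.
move=> c0 Fc; apply: (big_ind (fun a => cabs a <= c)) => //.
  by rewrite completion_abs0.
by move=> a b ac bc; apply: le_trans (completion_absD ultra _ _) _; rewrite ge_max ac.
Qed.

Lemma completion_abs1 : cabs 1 = 1.
Proof. by rewrite -(rmorph1 (to_completion v)) /= completion_abs_emb absval1. Qed.

Lemma completion_abs_int_mul n (A : 'M[completion v]_n) (x : 'cV_n) :
  (forall i j, completion_int v (A i j)) ->
  \big[Num.max/0]_(i < n) cabs ((A *m x) i 0) <= \big[Num.max/0]_(i < n) cabs (x i 0).
Proof.
move=> A_int; apply: bigmax_le => [|i _]; first exact: bigmax_ge_id.
rewrite mxE; apply: completion_abs_sum_le => [|j _]; first exact: bigmax_ge_id.
rewrite completion_absM //; last exact: ultra.
apply: le_trans (le_bigmax _ _ j); rewrite ler_piMl ?completion_abs_ge0 //.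
- exact: ultra.
- exact: A_int.
Qed.

Lemma GL_integral_max n (A : 'M[completion v]_n) (x : 'cV_n) : GL_integral A ->
  \big[Num.max/0]_(i < n) cabs ((A *m x) i 0) = \big[Num.max/0]_(i < n) cabs (x i 0).
Proof.
move=> [Au A_int Ai_int]; apply/eqP; rewrite eq_le completion_abs_int_mul //=.
by rewrite -{1}(mulKmx Au x) completion_abs_int_mul.
Qed.

Lemma completion_abs_det_le1 n (A : 'M[completion v]_n) :
  (forall i j, completion_int v (A i j)) -> cabs (\det A) <= 1.
Proof.
move=> A_int; apply: completion_abs_sum_le => // p _.
rewrite completion_absM; last exact: ultra.
have -> : cabs ((-1) ^+ p) = 1.
  by case: (perm.odd_perm p); rewrite ?expr0 ?expr1 ?completion_absN ?completion_abs1 //; exact: ultra.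
rewrite mul1r; apply: (big_ind (fun a => cabs a <= 1)) => [|a b a1 b1|i _].
- by rewrite completion_abs1.
- rewrite completion_absM; last exact: ultra.
  by rewrite mulr_ile1 // completion_abs_ge0 //; exact: ultra.
- exact: A_int.
Qed.

Lemma GL_integral_det n (A : 'M[completion v]_n) : GL_integral A -> cabs (\det A) = 1.
Proof.
move=> [Au A_int Ai_int]; apply/eqP; rewrite eq_le completion_abs_det_le1 //=.
have dd : cabs (\det A) * cabs (\det (invmx A)) = 1.
  rewrite -completion_absM; last exact: ultra.
  by rewrite -det_mulmx mulmxV // det1 completion_abs1.
rewrite -dd ler_piMr ?completion_abs_ge0 //; first exact: ultra.
exact: completion_abs_det_le1.
Qed.

Lemma vec_abs_completion n (x : 'cV[K]_n) :
  \big[Num.max/0]_(i < n) cabs (map_mx (to_completion v) x i 0) = vec_abs x v.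
Proof. by apply: eq_bigr => i _; rewrite mxE completion_abs_emb. Qed.

End FiniteUnimodular.

(** * Comparison of the two constants *)

Section ExtendedReals.
Variables (R : realType) (m : nat).
Hypothesis m0 : (0 < m)%N.
Implicit Types (a b : \bar R) (X Y : set R).

Lemma root_pow (x : R) : 0 <= x -> (x `^ m%:R^-1) ^+ m = x.
Proof.
move=> x0; rewrite -powR_mulrn ?powR_ge0 // -powRrM mulVf ?powRr1 //.
by rewrite pnatr_eq0 -lt0n.
Qed.

Lemma expeyy : (+oo ^+ m = +oo :> \bar R)%E.
Proof.
case: m m0 => // k _; elim: k => [|k IH]; first by [].
by rewrite expeS IH mulyy.
Qed.

Lemma lee_exp2l a b : (0 <= a)%E -> (a <= b)%E -> (a ^+ m <= b ^+ m)%E.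
Proof.
move=> a0 ab; elim: m => [|k IH]; first by rewrite !expe0.
by rewrite !expeS; apply: lee_pmul => //; exact: expe_ge0.
Qed.

Lemma ereal_inf_fin X : (forall x, X x -> 0 <= x) -> X !=set0 ->
  exists x : R, [/\ 0 <= x, ereal_inf [set y%:E | y in X] = x%:E
    & forall y, X y -> x <= y].
Proof.
move=> X0 [x Xx]; set I := ereal_inf _.
have I0 : (0 <= I)%E by apply: le_ereal_inf_tmp => _ [y Xy <-]; rewrite lee_fin X0.
have Ile y : X y -> (I <= y%:E)%E by move=> Xy; apply: ereal_inf_lbound; exists y.
have If : I \is a fin_num.
  by rewrite ge0_fin_numE //; apply: le_lt_trans (Ile x Xx) (ltry _).
exists (fine I); split; first exact: fine_ge0.
  by rewrite fineK.
by move=> y /Ile; rewrite -[in leLHS](fineK If) lee_fin.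
Qed.

(** The m-th root of the infimum of X is a real lower bound of Y. *)
Lemma le_ereal_inf_exp X Y : X !=set0 -> Y !=set0 ->
  (forall x, X x -> 0 <= x) -> (forall y, Y y -> 0 <= y) ->
  (forall y, Y y -> exists2 x, X x & x <= y ^+ m) ->
  (ereal_inf [set x%:E | x in X] <= ereal_inf [set y%:E | y in Y] ^+ m)%E.
Proof.
move=> Xn Yn X0 Y0 XY.
have [x [x0 -> xle]] := ereal_inf_fin X0 Xn.
have [y [y0 yE _]] := ereal_inf_fin Y0 Yn.
have : ((x `^ m%:R^-1)%:E <= ereal_inf [set y%:E | y in Y])%E.
  apply: le_ereal_inf_tmp => _ [z Yz <-]; rewrite lee_fin.
  have [w Xw wz] := XY z Yz.
  rewrite -(@ler_pXn2r _ m) // ?nnegrE ?powR_ge0 ?Y0 // root_pow //.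
  exact: le_trans (xle w Xw) wz.
rewrite yE lee_fin => h; rewrite -EFin_expe lee_fin -[x]root_pow //.
by rewrite ler_pXn2r // nnegrE ?powR_ge0.
Qed.

Lemma ereal_inf_exp_le X Y : X !=set0 -> Y !=set0 ->
  (forall x, X x -> 0 <= x) -> (forall y, Y y -> 0 <= y) ->
  (forall x, X x -> exists2 y, Y y & y ^+ m <= x) ->
  (ereal_inf [set y%:E | y in Y] ^+ m <= ereal_inf [set x%:E | x in X])%E.
Proof.
move=> Xn Yn X0 Y0 XY.
have [y [y0 -> yle]] := ereal_inf_fin Y0 Yn.
apply: le_ereal_inf_tmp => _ [z Xz <-]; have [w Yw wz] := XY z Xz.
rewrite -EFin_expe lee_fin; apply: le_trans wz.
by rewrite ler_pXn2r // ?nnegrE ?yle ?Y0.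
Qed.

(** For finite c the m-th root of c bounds Z, an infinite member being impossible since its power is
    infinite. The supremum itself is not assumed finite. *)
Lemma ereal_sup_exp_le (Z : set (\bar R)) c : Z !=set0 ->
  (forall z, Z z -> (0 <= z)%E) -> (forall z, Z z -> (z ^+ m <= c)%E) ->
  (ereal_sup Z ^+ m <= c)%E.
Proof.
move=> [z0 Zz0] Zge Zle.
have c0 : (0 <= c)%E by apply: le_trans (Zle _ Zz0); apply: expe_ge0; exact: Zge.
case: c c0 Zle => [c|_ _|//]; last by rewrite leey.
rewrite lee_fin => c0 Zle.
have : (ereal_sup Z <= (c `^ m%:R^-1)%:E)%E.
  apply: ge_ereal_sup => z Zz; have := Zle z Zz; have := Zge z Zz.
  case: z Zz => [z||] Zz //; last by rewrite expeyy leye_eq.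
  rewrite -EFin_expe !lee_fin => z0' zc.
  by rewrite -(@ler_pXn2r _ m) // ?nnegrE ?powR_ge0 // root_pow.
move=> h; rewrite -[c]root_pow // EFin_expe; apply: lee_exp2l => //.
by apply: le_trans (Zge _ Zz0) _; exact: ereal_sup_ubound.
Qed.

End ExtendedReals.

Section Comparison.
Variables (R : realType) (K : fieldExtType rat) (r s n : nat).
Variable E : arch_embeddings R K r s.
Local Notation m := (\dim {: K}).
Local Notation family := (adelic_family R K r s n).

Definition T_value (h : family) (x : 'cV[K]_n) : R :=
  height E h x ^+ 2 / adelic_abs_det h `^ (2 / (n * m)%:R).

Definition P_value (S : humbert_form R r s n) (x : 'cV[K]_n) : R :=
  humbert_eval E S x /
    ((ideal_norm (coord_ideal x))%:R ^+ 2 * humbert_det S `^ n%:R^-1).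

Lemma gram_eval_ge0 (S : humbert_form R r s n) gr gc x :
  gram_forms S gr gc -> 0 <= humbert_eval E S x.
Proof.
move=> /gram_forms_eval ->; rewrite mulr_ge0 ?sqr_ge0 //.
by apply: prodr_ge0 => i _; apply: sumr_ge0 => k _; exact: sqr_ge0.
Qed.

Lemma T_value_ge0 h x : 0 <= T_value h x.
Proof. by rewrite /T_value divr_ge0 ?sqr_ge0 ?powR_ge0. Qed.

Lemma P_value_ge0 S x : 0 <= P_value S x.
Proof.
have [gr [gc Sg]] := gram_forms_cholesky S.
by rewrite /P_value divr_ge0 ?(gram_eval_ge0 _ Sg) // mulr_ge0 ?sqr_ge0 ?powR_ge0.
Qed.

Lemma adelic_abs_det_Ainf (h : family) : GL_Ainf h -> adelic_abs_det h =
  (\prod_i `|\det (at_real h i)|) * (\prod_i complex_abs (\det (at_complex h i))).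
Proof.
move=> [_ hf]; rewrite /adelic_abs_det fsbig1 ?mulr1 // => v _.
exact: GL_integral_det.
Qed.

Lemma height_Ainf (h : family) x c : GL_Ainf h -> has_prod (vec_abs x) c ->
  \big[*%R/1]_(v \in [set: finplace R K])
    height_finite (at_finite h v *m map_mx (@to_completion R K v) x) = c `^ m%:R^-1.
Proof.
move=> [_ hf] xc; apply: has_prodE.
apply: has_prod_eq (has_prod_powR m%:R^-1 (vec_abs_ge0 x) xc) => v.
by rewrite /height_finite GL_integral_max // vec_abs_completion.
Qed.

(** Squaring and taking the m-th power turns the exponents 1 / (2 m) and 1 / m of the local heights
    into 1 at real places and 2 at complex ones, as in S[x]. The determinant gets the exponent 2 /
    n, and det(S) is the square of the absolute determinant. *)
Lemma T_value_exp (h : family) S x c : (0 < n)%N -> GL_Ainf h ->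
  gram_forms S (at_real h) (at_complex h) -> 0 <= c -> has_prod (vec_abs x) c ->
  T_value h x ^+ m = humbert_eval E S x * c ^+ 2 / humbert_det S `^ n%:R^-1.
Proof.
move=> n0 hA Sh c0 xc; have m0 := dimK_gt0 K.
rewrite /T_value /height (height_Ainf hA xc) (adelic_abs_det_Ainf hA).
rewrite (gram_forms_eval E x Sh) (gram_forms_det Sh).
set d := (\prod_i `|_|) * _.
set HR := \prod_(i < r) height_real _ _; set HC := \prod_(i < s) height_complex _ _.
set A := \prod_(i < r) \sum_k _; set B := \prod_(i < s) \sum_k _.
have hR : HR ^+ (2 * m) = A.
  rewrite -prodrXl; apply: eq_bigr => i _; rewrite /height_real root_pow //.
    by rewrite muln_gt0.
  by apply: sumr_ge0 => k _; exact: sqr_ge0.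
have hC : HC ^+ m = B.
  rewrite -prodrXl; apply: eq_bigr => i _; rewrite /height_complex root_pow //.
  by apply: sumr_ge0 => k _; exact: complex_abs_ge0.
have hD : (d `^ (2 / (n * m)%:R)) ^+ m = (d ^+ 2) `^ n%:R^-1.
  have d0 : 0 <= d.
    by rewrite mulr_ge0 //; apply: prodr_ge0 => i _; rewrite ?complex_abs_ge0.
  rewrite -powR_mulrn ?powR_ge0 // -powRrM -[d ^+ 2]powR_mulrn // -powRrM.
  congr (_ `^ _); rewrite natrM invfM -!mulrA mulVf ?mulr1 //.
  by rewrite pnatr_eq0 -lt0n.
rewrite expr_div_n hD; congr (_ / _); have hF := root_pow m0 c0.
set F := c `^ _ in hF *; rewrite -hR -hC -hF !exprMn -!exprM.
rewrite [(m * 2)%N]mulnC mul2n -addnn !exprD.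
by move: (HR ^+ m) (HC ^+ m) (F ^+ m) => u v w; ring.
Qed.

Hypothesis invK : frac_invertible K.
Hypothesis n0 : (0 < n)%N.

(* In [nonzero_integral_vectors] the inequality is between coefficient functions. *)
Lemma nonzero_integral_vectorsP (x : 'cV[K]_n) : nonzero_integral_vectors x <->
  x != 0 /\ forall i, ring_of_integers (x i 0).
Proof.
suff e : (fun_of_matrix x = 0) <-> (x = 0).
  by split=> -[/eqP x0 x_int]; split=> //; apply/eqP; rewrite ?e // -e.
split=> [x0|->]; last by apply/funext => i; apply/funext => j; rewrite mxE.
by apply/matrixP => i j; rewrite x0 mxE.
Qed.

Lemma P_value_int (S : humbert_form R r s n) (h : family) x : GL_Ainf h ->
  gram_forms S (at_real h) (at_complex h) -> nonzero_integral_vectors x ->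
  P_value S x = T_value h x ^+ m.
Proof.
move=> hA Sh /nonzero_integral_vectorsP[x0 x_int].
have xc := has_prod_vec_abs_int R invK x0 x_int.
rewrite (T_value_exp n0 hA Sh _ xc) // /P_value.
by rewrite exprVn invfM mulrA.
Qed.

Lemma humbert_evalZ (S : humbert_form R r s n) (a : nat) (x : 'cV[K]_n) :
  humbert_eval E S (a%:R *: x) = (a%:R ^+ (r + 2 * s)) ^+ 2 * humbert_eval E S x.
Proof.
have [gr [gc Sg]] := gram_forms_cholesky S.
rewrite !(gram_forms_eval E _ Sg).
have -> : \prod_i \sum_k `|(gr i *m map_mx (real_emb E i) (a%:R *: x)) k 0| ^+ 2 =
   (a%:R ^+ r) ^+ 2 * \prod_i \sum_k `|(gr i *m map_mx (real_emb E i) x) k 0| ^+ 2.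
  rewrite -exprM mulnC exprM -[X in _ ^+ X * _](card_ord r) -prodr_const -big_split /=.
  apply: eq_bigr => i _; rewrite mulr_sumr; apply: eq_bigr => k _.
  rewrite map_mxZ rmorph_nat -scalemxAr mxE normrM exprMn.
  by rewrite normr_nat.
have -> : \prod_i \sum_k complex_abs ((gc i *m map_mx (complex_emb E i) (a%:R *: x)) k 0) =
   (a%:R ^+ s) ^+ 2 * \prod_i \sum_k complex_abs ((gc i *m map_mx (complex_emb E i) x) k 0).
  rewrite -exprM mulnC exprM -[X in _ ^+ X * _](card_ord s) -prodr_const -big_split /=.
  apply: eq_bigr => i _; rewrite mulr_sumr; apply: eq_bigr => k _.
  rewrite map_mxZ rmorph_nat -scalemxAr mxE /complex_abs Normc.normcM exprMn.
  congr (_ ^+ 2 * _); apply: (@complexI R); rewrite rmorph_nat.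
  exact: (normr_nat R[i] a).
have -> : a%:R ^+ (r + 2 * s) = a%:R ^+ r * (a%:R ^+ s) ^+ 2 :> R.
  by rewrite exprD [(2 * s)%N]mulnC exprM.
move: (a%:R ^+ r) (a%:R ^+ s) (\prod_i _) (\prod_i _) => u v A B.
by rewrite !exprMn; ring.
Qed.

Lemma P_value_le (S : humbert_form R r s n) (h : family) x : GL_Ainf h ->
  gram_forms S (at_real h) (at_complex h) -> x != 0 ->
  exists2 y, nonzero_integral_vectors y & P_value S y <= T_value h x ^+ m.
Proof.
move=> hA Sh x0.
have [a [c [N [[a0 aN] c0 ax_int xc axc]]]] := has_prod_vec_abs R invK x0.
have ax0 : a%:R *: x != 0 by rewrite scaler_eq0 negb_or natK_neq0.
have ax_nz : nonzero_integral_vectors (a%:R *: x).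
  exact/nonzero_integral_vectorsP.
exists (a%:R *: x); first exact: ax_nz.
have aR : 1 <= a%:R :> R by rewrite ler1n lt0n.
have N0 : 0 < N by apply: lt_le_trans aN; rewrite exprn_gt0 // (lt_le_trans ltr01).
have Nc0 : 0 <= N^-1 * c by rewrite mulr_ge0 // invr_ge0 ltW.
rewrite (etrans (P_value_int hA Sh ax_nz) (T_value_exp n0 hA Sh Nc0 axc)).
rewrite (T_value_exp n0 hA Sh c0 xc) humbert_evalZ ler_wpM2r ?invr_ge0 ?powR_ge0 // exprMn.
have -> : (a%:R ^+ (r + 2 * s)) ^+ 2 * humbert_eval E S x * (N^-1 ^+ 2 * c ^+ 2) =
  (a%:R ^+ (r + 2 * s) / N) ^+ 2 * (humbert_eval E S x * c ^+ 2).
  by rewrite exprMn; ring.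
have q1 : a%:R ^+ (r + 2 * s) / N <= 1.
  rewrite ler_pdivrMr // mul1r; apply: le_trans aN.
  by rewrite ler_weXn2l //; exact: arch_embeddings_le E.
have q0 : 0 <= a%:R ^+ (r + 2 * s) / N by rewrite divr_ge0 ?exprn_ge0 // ltW.
apply: ler_piMl; last exact: exprn_ile1.
by rewrite mulr_ge0 ?sqr_ge0 // (gram_eval_ge0 _ Sh).
Qed.

Lemma nonzero_integral_vector_ex : @nonzero_integral_vectors K n !=set0.
Proof.
exists (const_mx 1); apply/nonzero_integral_vectorsP; split; last by move=> i; rewrite mxE; exact: OK1.
by apply/cV0Pn; exists (Ordinal n0); rewrite mxE oner_neq0.
Qed.

Definition T_inf (h : family) : \bar R :=
  ereal_inf [set (T_value h x)%:E | x in [set x : 'cV[K]_n | x != 0]].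

Definition P_inf (S : humbert_form R r s n) : \bar R :=
  ereal_inf [set (P_value S x)%:E | x in @nonzero_integral_vectors K n].

Lemma T_inf_ge0 h : (0 <= T_inf h)%E.
Proof. by apply: le_ereal_inf_tmp => _ [x _ <-]; rewrite lee_fin T_value_ge0. Qed.

Lemma P_inf_eq (S : humbert_form R r s n) (h : family) : GL_Ainf h ->
  gram_forms S (at_real h) (at_complex h) -> P_inf S = (T_inf h ^+ m)%E.
Proof.
move=> hA Sh; have m0 := dimK_gt0 K.
have [z zi] := nonzero_integral_vector_ex.
have /nonzero_integral_vectorsP[z0 _] := zi.
pose X := [set P_value S x | x in @nonzero_integral_vectors K n].
pose Y := [set T_value h x | x in [set x : 'cV[K]_n | x != 0]].
have -> : P_inf S = ereal_inf [set x%:E | x in X].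
  by rewrite /P_inf /X -image_comp.
have -> : T_inf h = ereal_inf [set x%:E | x in Y].
  by rewrite /T_inf /Y -image_comp.
have Xn : X !=set0 by exists (P_value S z), z.
have Yn : Y !=set0 by exists (T_value h z), z.
have X0 x : X x -> 0 <= x by move=> [y _ <-]; exact: P_value_ge0.
have Y0 x : Y x -> 0 <= x by move=> [y _ <-]; exact: T_value_ge0.
apply/eqP; rewrite eq_le le_ereal_inf_exp ?ereal_inf_exp_le //.
  move=> _ [x xi <-]; exists (T_value h x); first by exists x => //; case/nonzero_integral_vectorsP: xi.
  by rewrite (P_value_int hA Sh).
move=> _ [x x0 <-]; have [y yi yx] := P_value_le hA Sh x0.
by exists (P_value S y) => //; exists y.
Qed.

End Comparison.

(** * The double coset of [lambda_1] and the class number *)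

Section ClassNumber.
Variables (R : realType) (K : fieldExtType rat) (r s n : nat).
Variable E : arch_embeddings R K r s.
Local Notation family := (adelic_family R K r s n).

Lemma GL_Ainf_mul_Kinf (g l : family) : GL_Kinf g -> GL_Ainf l ->
  GL_Ainf (adelic_mul g l).
Proof.
move=> [[gr gc] gf] [[lr lc] lf]; split=> [|v]; last by rewrite /= gf mul1mx; exact: lf.
by split=> i; rewrite /= unitmx_mul ?gr ?gc ?lr ?lc.
Qed.

(** The archimedean components of [lambda_1] are arbitrary invertible matrices; g absorbs them, so
    that every family of Cholesky factors is reached. *)
Lemma GL_Kinf_translate (l : family) (gr : 'I_r -> 'M[R]_n) (gc : 'I_s -> 'M[R[i]]_n) :
  GL_Ainf l -> (forall i, gr i \in unitmx) -> (forall i, gc i \in unitmx) ->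
  exists2 g : family, GL_Kinf g & at_real (adelic_mul g l) = gr /\
    at_complex (adelic_mul g l) = gc.
Proof.
move=> [[lr lc] lf] gru gcu.
exists (AdelicFamily (fun i => gr i *m invmx (at_real l i))
  (fun i => gc i *m invmx (at_complex l i)) (fun=> 1%:M)).
  by split=> //; split=> i; rewrite /= unitmx_mul unitmx_inv ?gru ?gcu ?lr ?lc.
by split; apply/funext => i /=; rewrite mulmxKV.
Qed.

(** A union indexed by the empty type would be empty, but it has to contain the identity of GL_n of
    the adeles. *)
Lemma coset_decomposition_class_number (lambda : 'I_(class_number K) -> family) :
  coset_decomposition E lambda -> class_number K <> 0%N.
Proof.
move=> [cover _ _] h0.
pose e : family := AdelicFamily (fun=> 1%:M) (fun=> 1%:M) (fun=> 1%:M).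
have : GL_adele e.
  split=> [|v|]; rewrite ?unitmx1 //; first by split=> i; rewrite unitmx1.
  rewrite [X in finite_set X](_ : _ = set0) ?finite_set0 //.
  apply/seteqP; split=> // v; apply.
  have int1 (i j : 'I_n) : completion_int v ((1%:M : 'M[completion v]_n) i j).
    rewrite /completion_int /= mxE; case: (i == j) => /=.
      by rewrite completion_abs1.
    by rewrite completion_abs0.
  by split; rewrite ?unitmx1 ?invmx1.
rewrite cover => -[i _ _]; have := ltn_ord i.
by rewrite {2}h0.
Qed.

End ClassNumber.

Theorem mainTheorem2 (R : realType) (K : fieldExtType rat) (r s n : nat)
    (E : arch_embeddings R K r s)
    (lambda : 'I_(class_number K) -> adelic_family R K r s n) :
  (2 <= n)%N ->
  coset_decomposition E lambda ->
  (gamma_p n E <= gamma_T E lambda ^+ \dim {: K})%E /\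
  (class_number K = 1%N -> gamma_p n E = (gamma_T E lambda ^+ \dim {: K})%E).
Proof.
move=> n2 dec; have n0 : (0 < n)%N by exact: ltnW.
have h0 := coset_decomposition_class_number dec.
have invK := class_number_frac_invertible h0.
have [_ _ lam0] := dec.
have m0 := dimK_gt0 K.
have hpos : (0 < class_number K)%N by rewrite lt0n; exact/eqP.
pose i0 : 'I_(class_number K) := Ordinal hpos.
have l0 : GL_Ainf (lambda i0) by exact: lam0.
have [g0 g0K _] := GL_Kinf_translate l0 (fun=> @unitmx1 R n) (fun=> @unitmx1 R[i] n).
pose sT (i : 'I_(class_number K)) : \bar R :=
  ereal_sup [set T_inf E (adelic_mul g (lambda i)) | g in @GL_Kinf R K r s n].
have gTE : gamma_T E lambda = \big[maxe/-oo%E]_i sT i by [].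
have gpE : gamma_p n E = ereal_sup [set P_inf E S | S in [set: humbert_form R r s n]] by [].
(* With [le1] this is an equality for the term of [lambda_1], whatever the class number: Cholesky
   factors turn forms into points, and Gram matrices turn points into forms. *)
have le0 : (gamma_p n E <= sT i0 ^+ \dim {: K})%E.
  rewrite gpE; apply: ge_ereal_sup => _ [S _ <-].
  have [gr [gc Sg]] := gram_forms_cholesky S; have [gru gcu _ _] := Sg.
  have [g gK [gE1 gE2]] := GL_Kinf_translate l0 gru gcu.
  rewrite (P_inf_eq E invK n0 (GL_Ainf_mul_Kinf gK l0)) ?gE1 ?gE2 //.
  by apply: lee_exp2l; [exact: T_inf_ge0|apply: ereal_sup_ubound; exists g].
have le1 : (sT i0 ^+ \dim {: K} <= gamma_p n E)%E.
  apply: ereal_sup_exp_le => //.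
  - by exists (T_inf E (adelic_mul g0 (lambda i0))), g0.
  - by move=> _ [g _ <-]; exact: T_inf_ge0.
  move=> _ [g gK <-]; have gA := GL_Ainf_mul_Kinf gK l0.
  have [[gru gcu] _] := gA; have [S Sg] := gram_forms_exists gru gcu.
  by rewrite -(P_inf_eq E invK n0 gA Sg) gpE; apply: ereal_sup_ubound; exists S.
have sT0 : (0 <= sT i0)%E.
  apply: (@le_trans _ _ (T_inf E (adelic_mul g0 (lambda i0)))); first exact: T_inf_ge0.
  by apply: ereal_sup_ubound; exists g0.
have le_gT : (sT i0 <= gamma_T E lambda)%E by rewrite gTE; exact: le_bigmax.
split; first by apply: le_trans le0 _; exact: lee_exp2l.
move=> h1; suff -> : gamma_T E lambda = sT i0 by apply/eqP; rewrite eq_le le0 le1.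
apply/eqP; rewrite eq_le le_gT andbT gTE.
apply: bigmax_le => [|i _]; first exact: leNye.
suff -> : i = i0 by [].
by apply/val_inj => /=; have := ltn_ord i; rewrite {2}h1; case: (i : nat).
Qed.
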